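(* Let $n,l\ge1$ and let $\{\mathbf b^\pm_\lambda\mid\lambda\in\Pi_l\}$ be the two bases of $\bigwedge^l$ described in the context. (a) If $\lambda\in\Pi_l$ and $x\in\widehat{\mathfrak S}_l$ is minimal such that $\mathbf i=\lambda\cdot x^{-1}+\rho\in A_l^n$, then $$\mathbf b^-_\lambda=\sum_y(-v)^{l(y)-l(x)}\,v^{-l(y_{\mathbf i})}\,\bar P_{y,x}\,|\lambda\cdot x^{-1}y\rangle,$$ where the sum is over all $y$ such that $y\le x$ and $\lambda\cdot x^{-1}y\in\Pi_l$. (b) For all $\lambda\in\Pi_l$ the coordinates of $\mathbf b^+_\lambda$ in the wedges $|\mu\rangle$ are some parabolic Kazhdan–Lusztig polynomials (with respect to the parabolic subgroup $\mathfrak S_l\subset\widehat{\mathfrak S}_l$).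
   Context: Notation. $\mathbb A=\mathbb C[v,v^{-1}]$; ''semilinear'' means $\mathbb C$-linear with $v\mapsto v^{-1}$, and for $P\in\mathbb A$, $\bar P$ is its image under $v\mapsto v^{-1}$. $\Pi_l$ is the set of partitions with at most $l$ parts (viewed in $\mathbb Z^l$), with the usual (dominance) order. $\rho=(0,-1,\dots,1-l)$. Affine Weyl group. $\widehat{\mathfrak S}_l=\mathfrak S_l\ltimes\mathbb Z^l$ is the extended affine Weyl group, with simple reflections $s_0,\dots,s_{l-1}$ (where $s_1,\dots,s_{l-1}$ generate $\mathfrak S_l$), length function $l(\cdot)$ and Bruhat order $\le$. It acts on the right on $\mathbb Z^l$: $(\mathbf i)\lambda=\mathbf i+n\lambda$ for $\lambda\in\mathbb Z^l$; $s_j$ ($j\ne0$) exchanges $i_j,i_{j+1}$; $(\mathbf i)s_0=(i_l-n,i_2,\dots,i_{l-1},i_1+n)$. A fundamental domain is $A_l^n=\{\mathbf i\in\mathbb Z^l:1-n\le i_1\le\dots\le i_l\le0\}$. Put $\lambda\cdot x=(\lambda+\rho)x-\rho$. For $\mathbf i\in A_l^n$, $\mathfrak S_{\mathbf i}$ is its isotropy group and $\mathfrak S^{\mathbf i}$ is the set of minimal length representatives of $\mathfrak S_{\mathbf i}\backslash\widehat{\mathfrak S}_l$; each $y\in\widehat{\mathfrak S}_l$ is uniquely $y=y_{\mathbf i}y^{\mathbf i}$ with $y_{\mathbf i}\in\mathfrak S_{\mathbf i}$, $y^{\mathbf i}\in\mathfrak S^{\mathbf i}$. In (a), ''minimal''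 means of minimal length. $\omega$ is the longest element of $\mathfrak S_l$. Kazhdan–Lusztig polynomials. $P_{y,x}$ is the Kazhdan–Lusztig polynomial of $\widehat{\mathfrak S}_l$ in the variable $v^{-2}$ (so that the Kazhdan–Lusztig basis element is $C'_x=v^{l(x)}\sum_{y\le x}P_{y,x}T_y$, with $T_s$ having eigenvalues $-1,v^{-2}$). The parabolic Kazhdan–Lusztig polynomials with respect to $\mathfrak S_l$ (Deodhar) are the alternating sums $\sum_{z\in\mathfrak S_l}(-1)^{l(z)}P_{yz,x}$ for $y,x$ of minimal length in their cosets in $\widehat{\mathfrak S}_l/\mathfrak S_l$; in (b) they are taken up to the usual normalization by the power $v^{l(x)-l(y)}$. Wedges. The affine Hecke algebra $\widehat{\mathbf H}_l$ is the $\mathbb A$-algebra with generators $T_i^{\pm1}$ ($1\le i<l$), $X_j^{\pm1}$ ($1\le j\le l$), with braid relations, $(T_i+1)(T_i-v^{-2})=0$, commuting $X_j$, $T_iX_iT_i=v^{-2}X_{i+1}$, $X_jT_i=T_iX_j$ for $j\ne i,i+1$. $\bigotimes^l$ is the free $\mathbb A$-module on $\otimes\mathrm x_{\mathbf i}$, $\mathbf i\in\mathbb Z^l$, with the right $\widehat{\mathbf H}_l$-action determined by: $X_j^{-1}$ replaces $i_j$ by $i_j+n$; if $i_k,i_{k+1}\in\{1-n,\dots,0\}$, then $(\otimes\mathrm x_{\mathbf i})T_k$ is $v^{-2}\otimes\mathrm x_{\mathbf i}$ if $i_k=i_{k+1}$, $v^{-1}\otimes\mathrm x_{(\mathbf i)s_k}$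 if $i_k<i_{k+1}$, $v^{-1}\otimes\mathrm x_{(\mathbf i)s_k}+(v^{-2}-1)\otimes\mathrm x_{\mathbf i}$ if $i_k>i_{k+1}$. $\Omega^l=\sum_k\mathrm{Im}(T_k+1)$; $\wedge\mathrm x_{\mathbf i}$ is the class of $\otimes\mathrm x_{\mathbf i}$ in $\bigotimes^l/\Omega^l$; those with $i_1>\dots>i_l$ form a basis. For $\lambda\in\Pi_l$, $|\lambda\rangle=\wedge\mathrm x_{\lambda+\rho}$, and $\bigwedge^l$ is the span of these. Let $\psi$ be the semilinear involution of $\bigotimes^l/\Omega^l$ with $\psi(\wedge\mathrm x_{\mathbf j})=(-1)^{l(l-1)/2}v^{\alpha}\wedge\mathrm x_{(\mathbf j)\omega}$ for $j_1>\dots>j_l$, where $(\mathbf j)\omega=(j_l,\dots,j_1)$ and $\alpha=\#\{r<s:j_r\not\equiv j_s\bmod n\}$; it preserves $\bigwedge^l$. The bases $\mathbf b^\pm_\lambda$ of $\bigwedge^l$ are characterized by $\psi(\mathbf b^\pm_\lambda)=\mathbf b^\pm_\lambda$, $\mathbf b^-_\lambda-|\lambda\rangle\in\bigoplus_{\mu<\lambda}v^{-1}\mathbb C[v^{-1}]|\mu\rangle$, $\mathbf b^+_\lambda-|\lambda\rangle\in\bigoplus_{\mu<\lambda}v\,\mathbb C[v]|\mu\rangle$.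
   Formalization: Ω^l = Σ Im(T_k+1) is replaced by its saturation with respect to 1+v^{-2}; with the literal Ω^l the quotient has torsion (e.g. the class of x_{(0,0)} for l=2) and the strictly decreasing wedges do not form a basis. *)

(* Defs.v *)
From Stdlib Require Import Relation_Operators.
From HB Require Import structures.
From mathcomp Require Import all_boot all_order all_algebra all_fingroup.
From mathcomp Require Import finmap monalg complex.
From mathcomp Require Import boolp classical_sets fsbigop reals.

Set Implicit Arguments.
Unset Strict Implicit.
Unset Printing Implicit Defensive.

Import Order.TTheory GRing.Theory Num.Theory.
Local Open Scope ring_scope.

(* [laurent C] below is [C[v, v^-1]]: [p@_k] is the coefficient of [v^k] in [p],
   and [msupp p] is the finite set of exponents occurring in [p]. The
   convolution product of [monalg] is not available here, since it requires a
   monoid without nontrivial units. *)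

Section LaurentMul.
Variable C : comNzRingType.
Local Notation A := {malg C[int]}.
Implicit Types p q r : A.

Definition laurent_mul p q : A :=
  \sum_(i <- msupp p) \sum_(j <- msupp q) << p@_i * q@_j *g i + j >>.

Lemma laurent_mulw (d1 d2 : {fset int}) p q :
  (msupp p `<=` d1)%fset -> (msupp q `<=` d2)%fset ->
  laurent_mul p q =
    \sum_(i <- d1) \sum_(j <- d2) << p@_i * q@_j *g i + j >>.
Proof.
move=> le1 le2; rewrite /laurent_mul (big_fset_incl _ le1) /=.
  apply/eq_bigr=> i _; apply/big_fset_incl => // k _ /mcoeff_outdom ->.
  by rewrite mulr0 monalgU0.
by move=> k _ /mcoeff_outdom pk; rewrite big1 // => j _; rewrite pk mul0r monalgU0.
Qed.

Lemma laurent_mulC : commutative laurent_mul.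
Proof.
move=> p q; rewrite /laurent_mul exchange_big; apply/eq_bigr=> i _.
by apply/eq_bigr=> j _; rewrite mulrC addrC.
Qed.

Lemma laurent_mulDl : left_distributive laurent_mul +%R.
Proof.
move=> p q r.
rewrite (laurent_mulw (fsubsetUl (msupp p) (msupp q)) (fsubset_refl (msupp r))).
rewrite (laurent_mulw (fsubsetUr (msupp p) (msupp q)) (fsubset_refl (msupp r))).
rewrite (laurent_mulw (msuppD_le p q) (fsubset_refl (msupp r))).
rewrite -big_split /=; apply/eq_bigr=> i _.
rewrite -big_split /=; apply/eq_bigr=> j _.
by rewrite mcoeffD mulrDl monalgUD.
Qed.

Lemma laurent_mul0l : left_zero 0 laurent_mul.
Proof. by move=> p; rewrite /laurent_mul msupp0 big_seq_fset0. Qed.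

Lemma laurent_mulDr : right_distributive laurent_mul +%R.
Proof. by move=> p q r; rewrite !(laurent_mulC p) laurent_mulDl. Qed.

Lemma laurent_mul0r : right_zero 0 laurent_mul.
Proof. by move=> p; rewrite laurent_mulC laurent_mul0l. Qed.

Lemma laurent_mulUU a b i j :
  laurent_mul << a *g i >> << b *g j >> = << a * b *g i + j >>.
Proof.
by rewrite (laurent_mulw msuppU_le msuppU_le) !big_seq_fset1 !mcoeffUU.
Qed.

Lemma laurent_mul1l : left_id << 1 *g 0 >> laurent_mul.
Proof.
move=> p; rewrite (laurent_mulw msuppU_le (fsubset_refl _)) big_seq_fset1.
by rewrite [RHS]monalgE; apply/eq_bigr=> j _; rewrite mcoeffUU mul1r add0r.
Qed.

Lemma laurent_mulA : associative laurent_mul.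
Proof.
have sl q (I : Type) (s : seq I) (F : I -> A) :
    laurent_mul (\sum_(i <- s) F i) q = \sum_(i <- s) laurent_mul (F i) q.
  exact: (big_morph (laurent_mul^~ q) (fun _ _ => laurent_mulDl _ _ _)
    (laurent_mul0l _)).
have sr q (I : Type) (s : seq I) (F : I -> A) :
    laurent_mul q (\sum_(i <- s) F i) = \sum_(i <- s) laurent_mul q (F i).
  exact: (big_morph (laurent_mul q) (fun _ _ => laurent_mulDr _ _ _)
    (laurent_mul0r _)).
move: laurent_mul sl sr laurent_mulUU => m sl sr mulUU p q r.
rewrite [p]monalgE [q]monalgE [r]monalgE !sl.
apply/eq_bigr=> i _; rewrite sr (sr << _ *g i >>) sl; apply/eq_bigr=> j _.
by rewrite !sr; apply/eq_bigr=> k _; rewrite !mulUU mulrA addrA.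
Qed.

Lemma laurent_oner_neq0 : (<< 1 *g 0 >> : A) != 0.
Proof. by rewrite monalgU_eq0 oner_eq0. Qed.

End LaurentMul.

Definition laurent (C : comNzRingType) : Type := {malg C[int]}.

HB.instance Definition _ (C : comNzRingType) :=
  GRing.Zmodule.copy (laurent C) {malg C[int]}.
HB.instance Definition _ (C : comNzRingType) :=
  GRing.Zmodule_isComNzRing.Build (laurent C) (@laurent_mulA C)
    (@laurent_mulC C) (@laurent_mul1l C) (@laurent_mulDl C)
    (@laurent_oner_neq0 C).

Section Laurent.
Variable C : comNzRingType.

Definition vpow (k : int) : laurent C := << 1 *g k >>.

(* [(-v)^k] *)
Definition nvpow (k : int) : laurent C := (-1) ^+ `|k|%N * vpow k.

(* The semilinear involution [v |-> v^-1]. *)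
Definition lbar (p : laurent C) : laurent C :=
  \sum_(k <- msupp p) << p@_k *g - k >>.

(* [v^-1 C[v^-1]] and [v C[v]]. *)
Definition vneg (p : laurent C) : Prop := forall k, k \in msupp p -> k < 0.
Definition vpos (p : laurent C) : Prop := forall k, k \in msupp p -> 0 < k.

(* Value at [q = v^-2] of an integral polynomial in [q]. *)
Definition at_q (P : {poly int}) : laurent C := (map_poly intr P).[vpow (- 2)].

Definition lcomb (I : choiceType) (M : lmodType (laurent C)) (f : I -> M)
    (c : {malg (laurent C)[I]}) : M :=
  \sum_(i <- msupp c) c@_i *: f i.

Definition is_free_basis (I : choiceType) (M : lmodType (laurent C))
    (f : I -> M) : Prop :=
  forall u : M, exists! c : {malg (laurent C)[I]}, u = lcomb f c.

End Laurent.

(* Positions [1, ..., l] are represented by ['I_l], hence shifted by one. *)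

Definition Zl (l : nat) : Type := {ffun 'I_l -> int}.
HB.instance Definition _ l := GRing.Zmodule.on (Zl l).

Section Weights.
Variable l : nat.
Implicit Types (i j lam mu : Zl l).

Definition rho : Zl l := [ffun k : 'I_l => - (k : nat)%:Z].

Definition delta (k : 'I_l) : Zl l := [ffun k' => (k' == k)%:R].

Definition is_part lam : Prop :=
  (forall j k : 'I_l, (j <= k)%N -> lam k <= lam j) /\ forall k, 0 <= lam k.

Definition dom_le mu lam : Prop :=
  \sum_k mu k = \sum_k lam k /\
  forall m : nat, \sum_(k < l | (k < m)%N) mu k <= \sum_(k < l | (k < m)%N) lam k.

Definition dom_lt mu lam : Prop := dom_le mu lam /\ mu <> lam.

Definition strictly_decreasing i : Prop :=
  forall j k : 'I_l, (j < k)%N -> i k < i j.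

(* The alcove [A_l^n]. *)
Definition in_alcove (n : nat) i : Prop :=
  (forall j k : 'I_l, (j <= k)%N -> i j <= i k) /\
  forall k, 1 - n%:Z <= i k <= 0.

(* The place permutation [(i)w], [w] the longest element of the symmetric
   group. *)
Definition reverse i : Zl l := [ffun k => i (rev_ord k)].

Definition place_perm i (s : 'S_l) : Zl l := [ffun k => i ((s^-1)%g k)].

End Weights.

(* The extended affine symmetric group. The pair [(s, lam)] is the product
   [s lam]: acting on the right, [s] acts first, then the translation [lam]. *)

Definition affS (l : nat) : Type := ('S_l * {ffun 'I_l -> int})%type.
HB.instance Definition _ l := Choice.copy (affS l) ('S_l * {ffun 'I_l -> int})%type.

Section AffineGroupLaw.
Variable l : nat.
Implicit Types x y z : affS l.

Definition aff_one : affS l := (1%g, 0).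
Definition aff_mul x y : affS l := ((x.1 * y.1)%g, place_perm x.2 y.1 + y.2).
Definition aff_inv x : affS l := ((x.1^-1)%g, - place_perm x.2 (x.1^-1)%g).

Lemma aff_mulA : associative aff_mul.
Proof.
move=> x y z; rewrite /aff_mul /= mulgA; congr pair; apply/ffunP=> k.
by rewrite !ffunE invMg permM addrA.
Qed.

Lemma aff_mul1l : left_id aff_one aff_mul.
Proof.
move=> [s m]; rewrite /aff_mul /= mul1g; congr pair; apply/ffunP=> k.
by rewrite !ffunE add0r.
Qed.

Lemma aff_mul1r : right_id aff_one aff_mul.
Proof.
move=> [s m]; rewrite /aff_mul /= mulg1; congr pair; apply/ffunP=> k.
by rewrite !ffunE invg1 perm1 addr0.
Qed.

Lemma aff_mulVl : left_inverse aff_one aff_inv aff_mul.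
Proof.
move=> [s m]; rewrite /aff_mul /= mulVg; congr pair; apply/ffunP=> k.
by rewrite !ffunE invgK permKV addNr.
Qed.

Lemma aff_mulVr : right_inverse aff_one aff_inv aff_mul.
Proof.
move=> [s m]; rewrite /aff_mul /= mulgV; congr pair; apply/ffunP=> k.
by rewrite !ffunE addrN.
Qed.

End AffineGroupLaw.

HB.instance Definition _ l := isGroup.Build (affS l) (@aff_mulA l)
  (@aff_mul1l l) (@aff_mul1r l) (@aff_mulVl l) (@aff_mulVr l).

Section AffineGroup.
Variable l : nat.
Implicit Types (i lam : Zl l) (w x y z s t : affS l).

Definition fin_aff (s : 'S_l) : affS l := (s, 0).

(* The right action in which [lam] acts as [i |-> i + n lam]. *)
Definition aff_act (n : nat) i x : Zl l := place_perm i x.1 + x.2 *+ n.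

(* [lam . x = (lam + rho) x - rho] *)
Definition dot (n : nat) lam x : Zl l := aff_act n (lam + rho l) x - rho l.

(* The second disjunct is [s_0]; there is no simple reflection when [l = 1]. *)
Definition simple_refl s : Prop :=
  (exists j k : 'I_l, k = j.+1 :> nat /\ s = (tperm j k, 0)) \/
  (exists j k : 'I_l, [/\ j = 0%N :> nat, k.+1 = l, (j < k)%N &
     s = (tperm j k, delta k - delta j)]).

(* The group of elements of length zero: the normalizer of the set of simple
   reflections. *)
Definition length0 w : Prop :=
  forall s, simple_refl s <-> simple_refl (s ^ w)%g.

Definition word_length w (r : nat) : Prop :=
  exists (om : affS l) (ss : seq (affS l)),
    [/\ length0 om, forall s, s \in ss -> simple_refl s, size ss = r
      & w = (om * \prod_(s <- ss) s)%g].

Definition len w : nat :=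
  xget 0%N [set r | word_length w r /\ forall r', word_length w r' -> (r <= r')%N].

Definition is_reflection t : Prop := exists s w, simple_refl s /\ t = (s ^ w)%g.

Definition bruhat_step y x : Prop :=
  (exists t, is_reflection t /\ x = (y * t)%g) /\ (len y < len x)%N.

Definition bruhat : affS l -> affS l -> Prop := clos_refl_trans _ bruhat_step.

(* The isotropy group of [i]. *)
Definition stab (n : nat) i w : Prop := aff_act n i w = i.

(* Minimal length representatives for the left action of [stab n i]. *)
Definition min_stab (n : nat) i w : Prop :=
  forall u, stab n i u -> (len w <= len (u * w)%g)%N.

(* The factor [y_i] in the decomposition [y = y_i y^i]. *)
Definition stab_part (n : nat) i y : affS l :=
  xget 1%g [set u | stab n i u /\ min_stab n i (u^-1 * y)%g].

(* Minimal length in the coset [w S_l]. *)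
Definition min_right w : Prop :=
  forall z : 'S_l, (len w <= len (w * fin_aff z)%g)%N.

End AffineGroup.

Section KazhdanLusztig.
Variables (C : comNzRingType) (l : nat).
Local Notation A := (laurent C).
Local Notation W := (affS l).

Section Hecke.
Variables (H : algType A) (T : W -> H).

(* [H] is the Iwahori-Hecke algebra of the extended affine symmetric group,
   with standard basis [T]. *)
Record is_iwahori_hecke : Prop := IsIwahoriHecke {
  ih_basis : is_free_basis T;
  ih_one : T 1%g = 1;
  ih_mul : forall x y, len (x * y)%g = (len x + len y)%N ->
    T x * T y = T (x * y)%g;
  ih_quad : forall s, simple_refl s -> (T s + 1) * (T s - (vpow C (- 2))%:A) = 0 }.

(* The semilinear involution [T_w |-> (T_(w^-1))^-1]. *)
Record is_hecke_bar (b : H -> H) : Prop := IsHeckeBar {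
  hb_add : forall g h, b (g + h) = b g + b h;
  hb_scale : forall a h, b (a *: h) = lbar a *: b h;
  hb_T : forall w, b (T w) * T (w^-1)%g = 1 /\ T (w^-1)%g * b (T w) = 1 }.

Variable P : W -> W -> {poly int}.

Definition kl_elt (x : W) : H :=
  vpow C (len x)%:Z *: \sum_(y \in [set y | bruhat y x]) at_q C (P y x) *: T y.

(* [P y x] is the Kazhdan-Lusztig polynomial, in the variable [q = v^-2];
   the degree condition is [2 deg P y x <= len x - len y - 1]. *)
Definition is_kl : Prop :=
  [/\ forall x, P x x = 1,
      forall y x, ~ bruhat y x -> P y x = 0,
      forall y x, bruhat y x -> y <> x ->
        ((size (P y x)).-1.*2 < len x - len y)%N
    & exists b, is_hecke_bar b /\ forall x, b (kl_elt x) = kl_elt x].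

End Hecke.

(* Parabolic Kazhdan-Lusztig polynomial with respect to [S_l], normalized by
   [v^(l(x) - l(y))]; meaningful for [y] and [x] minimal in their cosets. *)
Definition parabolic_kl (P : W -> W -> {poly int}) (y x : W) : A :=
  vpow C ((len x)%:Z - (len y)%:Z) *
  \sum_(z : 'S_l) (-1) ^+ len (fin_aff z) * at_q C (P (y * fin_aff z)%g x).

End KazhdanLusztig.

(* [M] is the free module [otimes^l] with basis [ot], and [pi : M -> L] is the
    projection onto its quotient by [Omega^l]. *)

Section Wedges.
Variables (C : comNzRingType) (l : nat).
Local Notation A := (laurent C).
Variables (M L : lmodType A) (ot : Zl l -> M).
Variables (T X XV : 'I_l -> {linear M -> M}) (pi : {linear M -> L}).

(* [T k] (for [k + 1 < l]), [X j], [XV j] are the operators by which the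
   generators [T_k], [X_j], [X_j^-1] of the affine Hecke algebra act on the
   right; thus the product [a b] acts as [b \o a]. The operator [T k] for the
   last [k] is unused. Invertibility of [T k] follows from [ha_quad]. *)
Record is_hecke_action (n : nat) : Prop := IsHeckeAction {
  ha_XV : forall j u, XV j (X j u) = u /\ X j (XV j u) = u;
  ha_XX : forall j k u, X j (X k u) = X k (X j u);
  ha_quad : forall k : 'I_l, (k.+1 < l)%N -> forall u,
    T k (T k u + u) - vpow C (- 2) *: (T k u + u) = 0;
  ha_braid : forall j k : 'I_l, k = j.+1 :> nat -> (k.+1 < l)%N -> forall u,
    T j (T k (T j u)) = T k (T j (T k u));
  ha_far : forall j k : 'I_l, (j.+1 < k)%N -> (k.+1 < l)%N -> forall u,
    T j (T k u) = T k (T j u);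
  ha_TXT : forall j k : 'I_l, k = j.+1 :> nat -> forall u,
    T j (X j (T j u)) = vpow C (- 2) *: X k u;
  ha_XT : forall j k : 'I_l, (k.+1 < l)%N -> j <> k -> j <> k.+1 :> nat ->
    forall u, T k (X j u) = X j (T k u);
  ha_XV_ot : forall j i, XV j (ot i) = ot (i + delta j *+ n);
  ha_T_ot : forall (j k : 'I_l) (i : Zl l), k = j.+1 :> nat ->
    1 - n%:Z <= i j <= 0 -> 1 - n%:Z <= i k <= 0 ->
    let i' := place_perm i (tperm j k) in
    [/\ i j = i k -> T j (ot i) = vpow C (- 2) *: ot i,
        i j < i k -> T j (ot i) = vpow C (- 1) *: ot i'
      & i k < i j -> T j (ot i) = vpow C (- 1) *: ot i'
                                  + (vpow C (- 2) - 1) *: ot i] }.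

(* The submodule [Omega^l = sum_k Im (T_k + 1)], saturated with respect to
   [1 + v^-2]. Over [C[v, v^-1]] the unsaturated quotient has torsion: if
   [i_k = i_(k+1)] lie in [1-n, ..., 0] then [T_k + 1] multiplies [ot i] by
   [1 + v^-2], but [ot i] itself need not lie in the sum of the images. Only
   once this torsion is killed do the wedges with strictly decreasing indices
   form a basis. *)
Definition omega_sat (u : M) : Prop :=
  exists (m : nat) (w : 'I_l -> M),
    (1 + vpow C (- 2)) ^+ m *: u = \sum_(k < l | (k.+1 < l)%N) (T k (w k) + w k).

Definition is_wedge_quotient : Prop :=
  (forall z, exists u, pi u = z) /\ forall u, pi u = 0 <-> omega_sat u.

Definition wedge (i : Zl l) : L := pi (ot i).

Definition ket (lam : Zl l) : L := wedge (lam + rho l).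

(* The number of pairs [r < s] with [j_r], [j_s] not congruent mod [n]. *)
Definition alpha (n : nat) (j : Zl l) : nat :=
  #|[set p : 'I_l * 'I_l | (p.1 < p.2)%N && (j p.1 != j p.2 %[mod n])%Z]|.

Record is_wedge_bar (n : nat) (psi : L -> L) : Prop := IsWedgeBar {
  wb_add : forall z z', psi (z + z') = psi z + psi z';
  wb_scale : forall (a : A) z, psi (a *: z) = lbar a *: psi z;
  wb_invol : forall z, psi (psi z) = z;
  wb_wedge : forall j, strictly_decreasing j ->
    psi (wedge j) =
      ((-1) ^+ (l * l.-1)./2 * vpow C (alpha n j)%:Z) *: wedge (reverse j) }.

(* [z] lies in the sum of the [D |mu>], [mu] a partition with [mu < lam]. *)
Definition in_lower (D : A -> Prop) (lam : Zl l) (z : L) : Prop :=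
  exists c : {malg A[Zl l]},
    (forall mu, mu \in msupp c -> [/\ is_part mu, dom_lt mu lam & D c@_mu]) /\
    z = lcomb ket c.

(* With [D = @vneg C] (resp. [@vpos C]), [b lam] is [b^-_lam] (resp.
   [b^+_lam]) for every partition [lam]; other values of [b] are unspecified. *)
Definition is_canonical_basis (psi : L -> L) (D : A -> Prop)
    (b : Zl l -> L) : Prop :=
  forall lam, is_part lam ->
    psi (b lam) = b lam /\ in_lower D lam (b lam - ket lam).

End Wedges.

(* Main.v *)
(* Let [H_w = v^(l(w)) T_w], let [i] lie in the alcove, and let [theta] be
   Bernstein's morphism from the lattice to the Hecke algebra. Sending the tensor
   indexed by [a + n mu], with [a] in the box [1-n, 0]^l, to
   [v^(inv a) F_a theta(mu)], where [F_a] is the sum of the [v^(-l(z)) H_z] over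
   the [z] in [S_l] with [(i)z = a], turns the operator [T_k] into right
   multiplication by [v^-1 H_(s_k)]. Multiplying further on the right by the
   antisymmetrizer of [S_l] kills [Omega^l] and turns [psi] into the bar
   involution, up to a power of [v]. A [psi]-invariant combination of the wedges
   thus gives an element of the Hecke algebra on which [H_s] acts by [v^-1] on the
   left for [s] in [S_i] and by [-v] on the right for [s] in [S_l], which is bar
   invariant up to a power of [v], and whose coefficients at the representatives
   of minimal length of [S_i \ W], [W] the extended affine Weyl group, are the
   coordinates of the combination. By comparing the coefficients of maximal
   length, such an element is zero as soon as its coordinates all lie in
   [v^-1 C[v^-1]], or all in [v C[v]]. It is therefore the product of the
   symmetrizer of [S_i] and [C_x] in case (a), and, up to normalization, the
   product of [C'_x] and the antisymmetrizer of [S_l] in case (b), with [x] now of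
   maximal length in [S_i x]. *)

Require Import Defs.
From mathcomp Require Import all_boot all_order all_algebra all_fingroup.
From mathcomp Require Import finmap monalg complex.
From mathcomp Require Import boolp classical_sets cardinality fsbigop reals.
From mathcomp Require Import zify ring.

Set Implicit Arguments.
Unset Strict Implicit.
Unset Printing Implicit Defensive.

Import Order.TTheory GRing.Theory Num.Theory.
Local Open Scope ring_scope.

Section LaurentFacts.
Variable C : comNzRingType.
Implicit Types (p q : laurent C) (j k : int).
Local Notation v := (vpow C).

Lemma vpowD j k : v (j + k) = v j * v k.
Proof. by rewrite /vpow [RHS]laurent_mulUU mulr1. Qed.

Lemma vpow0 : v 0 = 1. Proof. by []. Qed.

Lemma vpowVr k : v k * v (- k) = 1. Proof. by rewrite -vpowD subrr. Qed.
Lemma vpowVl k : v (- k) * v k = 1. Proof. by rewrite -vpowD addNr. Qed.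

Lemma vpowX k m : v k ^+ m = v (k * m%:Z).
Proof.
elim: m => [|m IH]; first by rewrite expr0 mulr0.
by rewrite exprS IH -vpowD; congr (v _); lia.
Qed.

Lemma mcoeff_mulUl (a : C) j p k : ((<< a *g j >> : laurent C) * p)@_k = a * p@_(k - j).
Proof.
rewrite [in LHS](_ : _ * p = laurent_mul << a *g j >> p) //.
rewrite (laurent_mulw msuppU_le (fsubset_refl _)) big_seq_fset1 raddf_sum /=.
under eq_bigr do rewrite mcoeffUU mcoeffU.
case: (msuppP p (k - j)) => [kp|nkp].
  rewrite (big_fsetD1 (k - j)) //= subrKC eqxx mulr1n big1_fset ?addr0 // => i.
  rewrite !inE => /andP[/eqP nE _] _; case: (j + i =P k) => //= E.
  by case: nE; rewrite -E addrAC subrr add0r.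
rewrite mulr0 big_seq big1 // => i ip; case: (j + i =P k) => // E.
by move: nkp; rewrite -E addrAC subrr add0r ip.
Qed.

Lemma mcoeff_vpowM j p k : (v j * p)@_k = p@_(k - j).
Proof. by rewrite mcoeff_mulUl mul1r. Qed.

Lemma mcoeff_lbar p k : (lbar p)@_k = p@_(- k).
Proof.
rewrite /lbar raddf_sum /=.
case: (msuppP p (- k)) => [kp|nkp].
  rewrite (big_fsetD1 (- k)) //= mcoeffU opprK eqxx mulr1n big1_fset ?addr0 // => i.
  rewrite !inE => /andP[/eqP nE _] _; rewrite mcoeffU; case: (- i =P k) => //= E.
  by case: nE; rewrite -E opprK.
rewrite big_seq big1 // => i ip; rewrite mcoeffU; case: (- i =P k) => // E.
by move: nkp; rewrite -E opprK ip.
Qed.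

Lemma lbarD p q : lbar (p + q) = lbar p + lbar q.
Proof. by apply/malgP => k; rewrite mcoeffD !mcoeff_lbar mcoeffD. Qed.

Lemma lbar0 : lbar (0 : laurent C) = 0.
Proof. by apply/malgP => k; rewrite mcoeff_lbar !mcoeff0. Qed.

Lemma lbarN p : lbar (- p) = - lbar p.
Proof. by apply/malgP => k; rewrite mcoeffN !mcoeff_lbar mcoeffN. Qed.

Lemma lbar_sum (I : Type) (r : seq I) (F : I -> laurent C) :
  lbar (\sum_(i <- r) F i) = \sum_(i <- r) lbar (F i).
Proof. exact: (big_morph _ lbarD lbar0). Qed.

Lemma lbarU (a : C) k : lbar (<< a *g k >> : laurent C) = << a *g - k >>.
Proof.
by apply/malgP => j; rewrite mcoeff_lbar !mcoeffU -eqr_oppLR.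
Qed.

Lemma lbar_vpow k : lbar (v k) = v (- k).
Proof. exact: lbarU. Qed.

Lemma lbar1 : lbar (1 : laurent C) = 1.
Proof. by rewrite -vpow0 lbar_vpow oppr0. Qed.

Lemma lbar_bool (c : bool) : lbar (c%:R : laurent C) = c%:R.
Proof. by case: c; [exact: lbar1|exact: lbar0]. Qed.

Lemma lbarM p q : lbar (p * q) = lbar p * lbar q.
Proof.
rewrite [p]monalgE mulr_suml !lbar_sum mulr_suml; apply: eq_bigr => i _.
apply/malgP => k; rewrite mcoeff_lbar lbarU !mcoeff_mulUl mcoeff_lbar.
by congr (_ * _@__); lia.
Qed.

Lemma lbarX p m : lbar (p ^+ m) = lbar p ^+ m.
Proof. by elim: m => [|m IH]; rewrite ?lbar1 // !exprS lbarM IH. Qed.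

Lemma lbar_sign m : lbar ((-1 : laurent C) ^+ m) = (-1) ^+ m.
Proof. by rewrite lbarX lbarN lbar1. Qed.

Lemma vnegP p : vneg p <-> forall k, 0 <= k -> p@_k = 0.
Proof.
split=> [h k k0|h k]; first by case: msuppP => // /h; lia.
by rewrite -mcoeff_neq0 => /eqP pk; rewrite ltNge; apply/negP => /h.
Qed.

Lemma vposP p : vpos p <-> forall k, k <= 0 -> p@_k = 0.
Proof.
split=> [h k k0|h k]; first by case: msuppP => // /h; lia.
by rewrite -mcoeff_neq0 => /eqP pk; rewrite ltNge; apply/negP => /h.
Qed.

Lemma lbar_vneg p : vneg (lbar p) <-> vpos p.
Proof.
rewrite vnegP vposP; split=> h k k0.
  by have := h (- k); rewrite mcoeff_lbar opprK; apply; lia.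
by rewrite mcoeff_lbar h //; lia.
Qed.

(* [D] is one of the two halves [v C[v]], [v^-1 C[v^-1]] of
   [C[v, v^-1]], of which only the following closure properties matter. *)
Record half_space (D : laurent C -> Prop) : Prop := HalfSpace {
  hs0 : D 0;
  hsD : forall p q, D p -> D q -> D (p + q);
  hsN : forall p, D p -> D (- p);
  hs_bar : forall p, D p -> lbar p = p -> p = 0 }.

Lemma half_vneg : half_space (@vneg C).
Proof.
split=> [|p q|p|p]; rewrite !vnegP.
- by move=> k _; rewrite mcoeff0.
- by move=> hp hq k k0; rewrite mcoeffD hp // hq // addr0.
- by move=> hp k k0; rewrite mcoeffN hp // oppr0.
- move=> hp E; apply/malgP => k; rewrite mcoeff0.
  case: (lerP 0 k) => [/hp //|k0]; rewrite -E mcoeff_lbar hp //; lia.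
Qed.

Lemma half_vpos : half_space (@vpos C).
Proof.
split=> [|p q|p|p]; rewrite !vposP.
- by move=> k _; rewrite mcoeff0.
- by move=> hp hq k k0; rewrite mcoeffD hp // hq // addr0.
- by move=> hp k k0; rewrite mcoeffN hp // oppr0.
- move=> hp E; apply/malgP => k; rewrite mcoeff0.
  case: (lerP k 0) => [/hp //|k0]; rewrite -E mcoeff_lbar hp //; lia.
Qed.

Lemma half_sum (D : laurent C -> Prop) (hD : half_space D) (I : Type) (r : seq I)
    (Q : pred I) F : (forall i, Q i -> D (F i)) -> D (\sum_(i <- r | Q i) F i).
Proof. by move=> h; apply: big_ind => //; [apply: hs0|apply: hsD]. Qed.

Lemma half_sign (D : laurent C -> Prop) (hD : half_space D) m p :
  D p -> D ((-1) ^+ m * p).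
Proof.
by rewrite -signr_odd; case: (odd m) => h; rewrite ?expr1 ?mulN1r ?mul1r //; apply: hsN.
Qed.

Lemma vneg_vpowM k p : k <= 0 -> vneg p -> vneg (v k * p).
Proof.
move=> k0 /vnegP h; apply/vnegP => j j0; rewrite mcoeff_vpowM h //; lia.
Qed.

Lemma vpos_vpowM k p : 0 <= k -> vpos p -> vpos (v k * p).
Proof.
move=> k0 /vposP h; apply/vposP => j j0; rewrite mcoeff_vpowM h //; lia.
Qed.

Lemma vpos_vpow k : 0 < k -> vpos (v k).
Proof.
by move=> k0; apply/vposP => j j0; rewrite mcoeffU; case: eqP => //; lia.
Qed.

Lemma vpow2_regular k p : k != 0 -> (1 + v k) * p = 0 -> p = 0.
Proof.
wlog k0 : k / 0 < k => [W kn E|_ E].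
  case: (ltrP 0 k) => [/W|kle]; first exact.
  apply: (W (- k)); [lia|lia|].
  have : v (- k) * ((1 + v k) * p) = 0 by rewrite E mulr0.
  by rewrite mulrA mulrDr mulr1 vpowVl addrC => ->.
have rec j : p@_j = - p@_(j - k).
  have /(congr1 (mcoeff j)) := E.
  rewrite mulrDl mul1r mcoeffD mcoeff_vpowM mcoeff0 => /eqP.
  by rewrite addr_eq0 => /eqP.
have step m j : p@_j = 0 -> p@_(j + k * m%:Z) = 0.
  elim: m => [|m IH] h; first by rewrite mulr0 addr0.
  by rewrite rec (_ : _ - k = j + k * m%:Z); [rewrite IH ?oppr0|lia].
have [B hB] : exists B, forall j, j <= B -> p@_j = 0.
  have [B hB] : exists B, forall j, j \in enum_fset (msupp p) -> B < j.
    elim: (enum_fset _) => [|a s [B hB]]; first by exists 0.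
    exists (Num.min B (a - 1)) => j; rewrite inE => /predU1P[->|/hB]; lia.
  exists B => j jB; case: msuppP => // /hB; lia.
apply/malgP => j; rewrite mcoeff0.
have [m hm] : exists m : nat, j - k * m%:Z <= B.
  by exists `|j - B|%N; nia.
by have := step m _ (hB _ hm); rewrite subrK.
Qed.

Lemma vpos_at_q (P : {poly int}) N :
  ((size P).-1.*2 < N)%N -> vpos (v N%:Z * at_q C P).
Proof.
move=> h; rewrite /at_q horner_poly mulr_sumr.
apply: (half_sum half_vpos) => i _; rewrite /= vpowX mulrCA -vpowD.
rewrite (_ : intr _ * _ = v (N%:Z + -2 * (i : nat)%:Z) *~ P`_i); last first.
  by rewrite mulrzl.
have iP := ltn_ord i.
apply/vposP => j j0; rewrite raddfMz /= mcoeffU; case: eqP => [E|_]; last exact: mul0rz.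
have {}E : N%:Z + - (2%N * i)%N%:Z = j by rewrite -E PoszM mulNr.
by exfalso; move: (nat_of_ord i) iP E => m; move: (size P) h => s; lia.
Qed.

End LaurentFacts.

(** * The length function *)

Section Length.
Variable l : nat.
Implicit Types (w x y : affS l) (u z : 'S_l) (a b j k r s : 'I_l) (c : int).

(* Window notation: extended by [hat w (r + l k) = hat w r + l k], the map [hat w]
   is a permutation of the integers, and [hat (x * y) = hat x \o hat y]. *)
Definition hat w r : int := ((w.1^-1)%g r : nat)%:Z + l%:Z * w.2 r.

Definition disp w r s : int :=
  w.2 r - w.2 s + ((w.1^-1)%g s < (w.1^-1)%g r)%N%:Z.

(* [`|disp w r s|] counts the affine hyperplanes [e_r - e_s = k] that separate the
   fundamental alcove from its image; [alen] is the length, see [lenE]. *)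
Definition alen w : nat :=
  (\sum_(p : 'I_l * 'I_l | (p.1 < p.2)%N) `|disp w p.1 p.2|)%N.

Lemma disp_le w (r s : 'I_l) c : r != s ->
  (disp w r s <= c) = (hat w r < hat w s + l%:Z * c).
Proof.
move=> rs; rewrite /disp /hat.
have : (w.1^-1)%g r != (w.1^-1)%g s by rewrite (inj_eq perm_inj).
move: ((w.1^-1)%g r) ((w.1^-1)%g s) => p q; rewrite -val_eqE /= => pq.
have := ltn_ord p; have := ltn_ord q.
move: (w.2 r) (w.2 s) (nat_of_ord p) (nat_of_ord q) pq => m m' {}p {}q pq ql pl.
have [h|[h|h]] : m - m' - c <= -1 \/ m - m' - c = 0 \/ 1 <= m - m' - c by lia.
- have E : l%:Z * (m - m' - c) <= - l%:Z by nia.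
  have -> : (p%:Z + l%:Z * m < q%:Z + l%:Z * m' + l%:Z * c) = true by lia.
  by case: ltnP => _ /=; lia.
- have E : l%:Z * (m - m' - c) = 0 by rewrite h mulr0.
  have -> : (p%:Z + l%:Z * m < q%:Z + l%:Z * m' + l%:Z * c) = (p < q)%N by lia.
  by case: (ltnP q p) => h' /=; lia.
- have E : l%:Z * (m - m' - c) >= l%:Z by nia.
  have -> : (p%:Z + l%:Z * m < q%:Z + l%:Z * m' + l%:Z * c) = false by lia.
  by case: ltnP => _ /=; lia.
Qed.

Lemma disp_anti w (r s : 'I_l) : r != s -> disp w s r = 1 - disp w r s.
Proof.
move=> rs; rewrite /disp.
have : (w.1^-1)%g r != (w.1^-1)%g s by rewrite (inj_eq perm_inj).
by rewrite -val_eqE /=; lia.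
Qed.

Lemma disp_le0 w (r s : 'I_l) : r != s -> (disp w r s <= 0) = (hat w r < hat w s).
Proof. by move=> /(disp_le w 0) ->; rewrite mulr0 addr0. Qed.

Lemma hat_inj w (r s : 'I_l) : hat w r = hat w s -> r = s.
Proof.
move=> E; apply/eqP; apply: contraT => rs.
have := disp_le0 w rs; have := disp_anti w rs.
have := disp_le0 w (_ : s != r); rewrite eq_sym rs E ltxx => /(_ isT).
lia.
Qed.

Lemma sum_pairs_perm (V : nmodType) (f : 'I_l -> 'I_l -> V) u :
  \sum_(p : 'I_l * 'I_l | (p.1 < p.2)%N) f ((u^-1)%g p.1) ((u^-1)%g p.2) =
  \sum_(p : 'I_l * 'I_l | (p.1 < p.2)%N)
     if (u p.1 < u p.2)%N then f p.1 p.2 else f p.2 p.1.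
Proof.
pose h (p : 'I_l * 'I_l) := (u p.1, u p.2).
pose sw (p : 'I_l * 'I_l) := (p.2, p.1).
have hb : bijective h.
  by exists (fun p => ((u^-1)%g p.1, (u^-1)%g p.2)) => [[]|[]] * /=;
    rewrite /h /= ?permK ?permKV.
have sb : bijective sw by exists sw => [[]|[]].
rewrite (reindex h) /=; last exact: onW_bij.
under eq_bigr do rewrite !permK.
rewrite (bigID (fun p : 'I_l * 'I_l => p.1 < p.2)%N) /= [RHS](bigID (fun p => u p.1 < u p.2)%N) /=.
congr (_ + _).
  by apply: eq_big => [p|p /andP[h1 h2]]; rewrite 1?andbC // h1.
rewrite (reindex sw) /=; last exact: onW_bij.
apply: eq_big => [[p q] /=|[p q] /= /andP[h1 h2]].
  rewrite -!leqNgt; case: (eqVneq p q) => [->|]; first by rewrite !ltnn.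
  move=> pq; have : u p != u q by rewrite (inj_eq perm_inj).
  by move: pq; rewrite -!val_eqE /=; lia.
by rewrite ltnNge (ltnW h1).
Qed.

Definition ninv u : nat := (\sum_(p : 'I_l * 'I_l | (p.1 < p.2)%N) (u p.2 < u p.1))%N.

Lemma fin_affM (u z : 'S_l) : fin_aff (u * z)%g = (fin_aff u * fin_aff z)%g.
Proof.
by congr pair; apply/ffunP => k; rewrite !ffunE addr0.
Qed.

Lemma fin_aff1 : fin_aff 1%g = 1%g :> affS l. Proof. by []. Qed.

Lemma fin_affV u : fin_aff (u^-1)%g = (fin_aff u)^-1%g.
Proof.
by rewrite -[LHS]mulg1 -(mulgV (fin_aff u)) mulgA -fin_affM mulVg mul1g.
Qed.

Lemma hat_mul x y r : hat (x * y)%g r = hat x ((y.1^-1)%g r) + l%:Z * y.2 r.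
Proof. by rewrite /hat /= invMg permM !ffunE mulrDr addrA. Qed.

Lemma hat_fin x u r : hat (x * fin_aff u)%g r = hat x ((u^-1)%g r).
Proof. by rewrite hat_mul /= ffunE mulr0 addr0. Qed.

Lemma hat_fin1 u r : hat (fin_aff u) r = ((u^-1)%g r : nat)%:Z.
Proof. by rewrite /hat /= ffunE mulr0 addr0. Qed.

Lemma disp_fin x u (r s : 'I_l) :
  disp (x * fin_aff u)%g r s = disp x ((u^-1)%g r) ((u^-1)%g s).
Proof. by rewrite /disp /= invMg !permM !ffunE !addr0. Qed.

Lemma alen_mul_fin x u : alen (x * fin_aff u)%g =
  (\sum_(p : 'I_l * 'I_l | (p.1 < p.2)%N)
     if (u p.1 < u p.2)%N then `|disp x p.1 p.2| else `|disp x p.2 p.1|)%N.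
Proof.
rewrite /alen -(sum_pairs_perm (fun a b => `|disp x a b|%N)).
by apply: eq_bigr => p _; rewrite disp_fin.
Qed.

Lemma alen_plus x u :
  (forall a b, (a < b)%N -> (u b < u a)%N -> hat x a < hat x b) ->
  alen (x * fin_aff u)%g = (alen x + ninv u)%N.
Proof.
move=> h; rewrite alen_mul_fin /alen /ninv -big_split /=.
apply: eq_bigr => -[a b] /= ab; have nab : a != b by rewrite -val_eqE /=; lia.
have := h _ _ ab; have : u a != u b by rewrite (inj_eq perm_inj).
rewrite -(disp_le0 x nab) (disp_anti x nab) -val_eqE /=.
by case: ltngtP => //= _ _ hh; (try have := hh isT); lia.
Qed.

Lemma alen1 : alen 1%g = 0%N.
Proof.
rewrite /alen big1 // => -[a b] /= ab.
rewrite /disp /= !ffunE invg1 !perm1; lia.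
Qed.

Lemma alen_fin u : alen (fin_aff u) = ninv u.
Proof.
rewrite -[fin_aff u]mul1g alen_plus ?alen1 // => a b ab _.
by rewrite /hat /= !ffunE invg1 !perm1; lia.
Qed.

Lemma alen_minus x u :
  (forall a b, (a < b)%N -> (u b < u a)%N -> hat x b < hat x a) ->
  (alen (x * fin_aff u)%g + ninv u)%N = alen x.
Proof.
move=> h; rewrite alen_mul_fin /alen /ninv -big_split /=.
apply: eq_bigr => -[a b] /= ab; have nab : b != a by rewrite -val_eqE /=; lia.
have := h _ _ ab; have : u a != u b by rewrite (inj_eq perm_inj) eq_sym.
rewrite -(disp_le0 x nab) (disp_anti x nab) -val_eqE /=.
by case: ltngtP => //= _ _ hh; (try have := hh isT); lia.
Qed.

Lemma tperm_adj_inv j k a b : k = j.+1 :> nat -> (a < b)%N ->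
  (tperm j k b < tperm j k a)%N -> a = j /\ b = k.
Proof.
move=> kj; case: tpermP => [->|->|/eqP bj /eqP bk];
  case: tpermP => [->|->|/eqP aj /eqP ak]; move=> ab h; split=> //;
  exfalso; move: ab h; rewrite -?val_eqE /=; try lia;
  try (move: aj ak); try (move: bj bk); rewrite -!val_eqE /=; lia.
Qed.

Lemma ninv_tperm j k : k = j.+1 :> nat -> ninv (tperm j k) = 1%N.
Proof.
move=> kj; rewrite /ninv (bigD1 (j, k)) /=; last by rewrite kj.
rewrite tpermL tpermR big1 => [|[a b] /= /andP[ab nab]]; first by rewrite kj ltnSn.
case: ltnP => // h; have [E1 E2] := tperm_adj_inv kj ab h.
by rewrite E1 E2 eqxx in nab.
Qed.

Lemma alen_fin_simple w j k : k = j.+1 :> nat ->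
  if hat w j < hat w k then alen (w * fin_aff (tperm j k))%g = (alen w).+1
  else alen w = (alen (w * fin_aff (tperm j k))%g).+1.
Proof.
move=> kj; case: ifP => h.
  rewrite alen_plus ?ninv_tperm ?addn1 // => a b ab inv.
  by have [-> ->] := tperm_adj_inv kj ab inv.
rewrite -[LHS](alen_minus (u := tperm j k)) ?ninv_tperm ?addn1 // => a b ab inv.
have [-> ->] := tperm_adj_inv kj ab inv.
rewrite lt_neqAle leNgt h andbT; apply/eqP => /hat_inj E.
by move: kj; rewrite E; lia.
Qed.

Definition s0_elt j k : affS l := (tperm j k, delta k - delta j).

Lemma alen_s0 w j k : j = 0%N :> nat -> k.+1 = l -> (j < k)%N ->
  (alen (w * s0_elt j k)%g + absz (disp w j k) = alen w + absz (disp w j k + 1)%R)%N.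
Proof.
move=> j0 kl jk; set t := tperm j k; set e : Zl l := delta k - delta j.
have ee r : e r = (r == k)%:Z - (r == j)%:Z by rewrite !ffunE; case: (r == k); case: (r == j).
pose f a b : nat := absz (disp w a b + e (t a) - e (t b))%R.
have -> : alen (w * s0_elt j k)%g =
  (\sum_(p : 'I_l * 'I_l | (p.1 < p.2)%N)
     if (t p.1 < t p.2)%N then f p.1 p.2 else f p.2 p.1)%N.
  rewrite /alen -(sum_pairs_perm f); apply: eq_bigr => -[a b] _ /=.
  have m2 r : (w * s0_elt j k)%g.2 r = w.2 ((t^-1)%g r) + e r by rewrite !ffunE.
  rewrite /f !permKV /disp !m2 /= invMg !permM -/t.
  by congr absz; ring.
have nkj : k != j by rewrite -val_eqE /=; lia.
have ej : e j = -1 by rewrite ee eqxx eq_sym (negPf nkj).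
have ek : e k = 1 by rewrite ee eqxx (negPf nkj).
have eo r : r != j -> r != k -> e r = 0 by move=> rj rk; rewrite ee (negPf rj) (negPf rk).
have tj : t j = k by exact: tpermL.
have tk : t k = j by exact: tpermR.
have to r : r != j -> r != k -> t r = r by move=> rj rk; apply: tpermD; rewrite eq_sym.
rewrite /alen (bigD1 (j, k)) //= [in RHS](bigD1 (j, k)) //=.
rewrite addnAC [RHS]addnAC; congr (_ + _)%N; last first.
  apply: eq_bigr => -[a b] /= /andP[ab]; rewrite xpair_eqE negb_and => nab.
  have nba : a != b by rewrite -val_eqE /=; lia.
  have al := ltn_ord a; have bl := ltn_ord b.
  rewrite /f (disp_anti w nba); move: (disp w a b) => d.
  have kb : k != b -> (b < k)%N by rewrite -val_eqE /=; lia.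
  have ja : j != a -> (j < a)%N by rewrite -val_eqE /=; lia.
  have bj : b != j by rewrite -val_eqE /=; lia.
  have ak : a != k by rewrite -val_eqE /=; lia.
  case: (eqVneq a j) nab ab => [-> /= bk jb|aj _ ab].
    rewrite tj (to b) // ek (eo b) // ltnNge (ltnW (kb _)) 1?eq_sym //=; lia.
  rewrite (to a) //; case: (eqVneq b k) ab => [-> ak'|bk ab].
    rewrite tk ltnNge (ltnW (ja _)) 1?eq_sym //= ej (eo a) //; lia.
  by rewrite to // ab !eo //; congr absz; lia.
rewrite /f (disp_anti w (_ : j != k)) 1?eq_sym // tj tk ltnNge (ltnW jk) /= ej ek.
lia.
Qed.

End Length.

Section Reflections.
Variable l : nat.
Implicit Types (w x y t : affS l) (u z : 'S_l) (a b j k r s : 'I_l) (c : int).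

Lemma chain_rel (e : rel 'I_l) a b : transitive e -> (a < b)%N ->
  (forall j k, k = j.+1 :> nat -> (a <= j)%N -> (k <= b)%N -> e j k) -> e a b.
Proof.
move=> tr ab adj.
have [d bE] : exists d, b = (a + d.+1)%N :> nat by exists (b - a).-1; lia.
elim: d b bE ab adj => [|d IH] b bE ab adj; first by apply: adj => //; lia.
have b'l : (a + d.+1 < l)%N by have := ltn_ord b; lia.
apply: (tr (Ordinal b'l)).
  by apply: IH => //= [|j k kj aj kb]; [lia|apply: adj => //; lia].
by apply: adj => //=; lia.
Qed.

Definition refl a b c : affS l :=
  (tperm a b, [ffun r => c * ((r == a)%:Z - (r == b)%:Z)]).

Lemma refl_sym a b c : refl a b c = refl b a (- c).
Proof.
by congr pair; [exact: tpermC|apply/ffunP => r; rewrite !ffunE; ring].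
Qed.

Lemma refl_conj a b c w :
  (refl a b c ^ w)%g = refl (w.1 a) (w.1 b) (c + w.2 (w.1 a) - w.2 (w.1 b)).
Proof.
case: w => z m; rewrite /conjg /refl; congr pair; first by rewrite /= -tpermJ conjgE.
apply/ffunP => r /=; rewrite !ffunE /= !invMg !invgK !permM tpermV.
have -> : z (tperm a b ((z^-1)%g r)) = tperm (z a) (z b) r.
  by rewrite -tpermJ -{2}(permKV z r) permJ.
have E (d : 'I_l) : ((z^-1)%g r == d) = (r == z d).
  by rewrite -(inj_eq (@perm_inj _ z)) permKV.
rewrite !E; case: tpermP => [->|->|/eqP ra /eqP rb].
- rewrite eqxx (inj_eq perm_inj); case: eqVneq => [->|_] /=; ring.
- rewrite eqxx (inj_eq perm_inj); case: eqVneq => [->|_] /=; ring.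
- by rewrite (negPf ra) (negPf rb) /=; ring.
Qed.

Definition window w a : int := (w.1 a : nat)%:Z - l%:Z * w.2 (w.1 a).

Lemma tperm_eq_cases a b j k : a != b -> tperm a b = tperm j k ->
  (a = j /\ b = k) \/ (a = k /\ b = j).
Proof.
move=> ab E.
have Ea : tperm j k a = b by rewrite -E tpermL.
have Eb : tperm j k b = a by rewrite -E tpermR.
move: Ea Eb ab; case: (tpermP j k a) => [-> -> _ _|-> -> _ _|_ _ -> _].
- by left.
- by right.
- by rewrite eqxx.
Qed.

Lemma simple_reflE a b c : a != b ->
  simple_refl (refl a b c) <-> `|b%:Z - a%:Z + l%:Z * c| = 1.
Proof.
move=> ab; have al := ltn_ord a; have bl := ltn_ord b.
have ba : (b == a) = false by rewrite eq_sym (negPf ab).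
have ab' : (a == b) = false by rewrite (negPf ab).
split=> [[[j [k [kj [Et /ffunP/(_ a)]]]]|[j [k [j0 kl jk [Et /ffunP/(_ a)]]]]]|].
- rewrite !ffunE eqxx ab' => c0; have {c0}-> : c = 0 by lia.
  by case: (tperm_eq_cases ab Et) => -[-> ->]; lia.
- case: (tperm_eq_cases ab Et) => -[Ea Eb]; rewrite -Ea -Eb !ffunE ?eqxx ?ab' ?ba /= => Ec.
    have {Ec}-> : c = -1 by lia.
    rewrite Ea Eb; lia.
  have {Ec}-> : c = 1 by lia.
  rewrite Ea Eb; lia.
- move=> h; have nab : a != b :> nat by rewrite val_eqE.
  have [c0|[c1|c1]] : c = 0 \/ c = 1 \/ c = -1 by nia.
  + rewrite c0 mulr0 addr0 in h; left.
    have [E|E] : b = a.+1 :> nat \/ a = b.+1 :> nat by lia.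
      exists a, b; split=> //; congr pair; apply/ffunP => r; rewrite !ffunE c0; ring.
    exists b, a; split=> //; rewrite c0 refl_sym; congr pair.
    by apply/ffunP => r; rewrite !ffunE; ring.
  + rewrite c1 mulr1 in h; right; exists b, a; split; [lia|lia|lia|].
    rewrite c1 refl_sym; congr pair; apply/ffunP => r; rewrite !ffunE.
    by case: (r == b); case: (r == a).
  + rewrite c1 in h; right; exists a, b; split; [lia|lia|lia|].
    rewrite c1; congr pair; apply/ffunP => r; rewrite !ffunE.
    by case: (r == b); case: (r == a).
Qed.

Lemma simple_refl_refl t : simple_refl t -> exists a b c, a != b /\ t = refl a b c.
Proof.
case=> [[j [k [kj ->]]]|[j [k [j0 kl jk ->]]]].
- exists j, k, 0; split; first by rewrite -val_eqE /=; lia.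
  by congr pair; apply/ffunP => r; rewrite !ffunE; ring.
- exists j, k, (-1); split; first by rewrite -val_eqE /=; lia.
  congr pair; apply/ffunP => r; rewrite !ffunE.
  by case: (r == k); case: (r == j).
Qed.

Lemma simple_conj a b c w : a != b ->
  simple_refl (refl a b c ^ w)%g <-> `|window w b - window w a + l%:Z * c| = 1.
Proof.
move=> ab; rewrite refl_conj simple_reflE ?(inj_eq perm_inj) // /window.
by rewrite (_ : _ + l%:Z * _ = (w.1 b : nat)%:Z - l%:Z * w.2 (w.1 b)
  - ((w.1 a : nat)%:Z - l%:Z * w.2 (w.1 a)) + l%:Z * c) //; ring.
Qed.

Lemma simple_fin j k : k = j.+1 :> nat -> simple_refl (fin_aff (tperm j k)).
Proof. by move=> kj; left; exists j, k. Qed.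

Definition shift w := exists c, forall r, hat w r = c + (r : nat)%:Z.

Lemma window_hat w a : hat w (w.1 a) = (a : nat)%:Z + l%:Z * w.2 (w.1 a).
Proof. by rewrite /hat permK. Qed.

Lemma shiftE w : shift w <-> exists c, forall r, window w r = (r : nat)%:Z - c.
Proof.
split=> -[c h]; exists c => r.
  by have := h (w.1 r); rewrite window_hat /window; lia.
have := h ((w.1^-1)%g r); rewrite /window /hat permKV; lia.
Qed.

Lemma alen0_shift w : alen w = 0%N -> shift w.
Proof.
move=> L0.
have d0 r s : (r < s)%N -> disp w r s = 0.
  move=> rs; apply/eqP; rewrite -absz_eq0 -leqn0 -L0 /alen.
  by rewrite (bigD1 (r, s)) //= leq_addr.
have hlt r s : (r < s)%N -> hat w r < hat w s.
  by move=> rs; rewrite -disp_le0 ?d0 // -val_eqE /=; lia.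
have hw r s : (r < s)%N -> hat w s < hat w r + l%:Z.
  move=> rs; have rs' : r != s by rewrite -val_eqE /=; lia.
  have := disp_le w (-1) rs'; rewrite d0 // => /esym/negbT.
  have : hat w r != hat w s - l%:Z.
    rewrite /hat; apply/eqP => E.
    have zr := ltn_ord ((w.1^-1)%g r); have zs := ltn_ord ((w.1^-1)%g s).
    have : (w.1^-1)%g r != (w.1^-1)%g s by rewrite (inj_eq perm_inj).
    move: E zr zs; move: ((w.1^-1)%g r) ((w.1^-1)%g s) (w.2 r) (w.2 s) => p q m m'.
    move=> E pl ql; rewrite -val_eqE /= => pq.
    have [h|[h|h]] : m - m' + 1 <= -1 \/ m - m' + 1 = 0 \/ 1 <= m - m' + 1 by lia.
    - have : l%:Z * (m - m' + 1) <= - l%:Z by nia.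
      by lia.
    - have : l%:Z * (m - m' + 1) = 0 by rewrite h mulr0.
      lia.
    - have : l%:Z * (m - m' + 1) >= l%:Z by nia.
      by lia.
  by lia.
have [l0|lpos] := posnP l; first by exists 0 => r; have := ltn_ord r; rewrite {2}l0.
pose o := Ordinal lpos; pose p := rev_ord o; have pE : p = l.-1 :> nat by rewrite /= subn1.
exists (hat w o) => r.
have lb (q s : 'I_l) : (q <= s)%N -> hat w q + (s%:Z - q%:Z) <= hat w s.
  rewrite leq_eqVlt => /predU1P[/val_inj ->|qs]; first lia.
  pose e (i i' : 'I_l) := hat w i + (i'%:Z - i%:Z) <= hat w i'.
  have tr : transitive e by move=> y x z; rewrite /e; lia.
  apply: (chain_rel (e := e)) => // j k kj _ _; rewrite /e.
  by have := hlt j k; rewrite kj ltnSn => /(_ isT); lia.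
have rl := ltn_ord r; have := lb o r (leq0n _); have := lb r p.
have -> : (r <= p)%N by lia.
move=> /(_ isT); have [l1|l1] := leqP l 1.
  have -> : r = o by apply: val_inj => /=; lia.
  rewrite /=; lia.
have := hw o p; have -> : (o < p)%N by rewrite pE /=; lia.
move=> /(_ isT); rewrite pE /=; lia.
Qed.

Lemma shift_alen0 w : shift w -> alen w = 0%N.
Proof.
case=> c h; rewrite /alen big1 // => -[r s] /= rs.
have nrs : r != s by rewrite -val_eqE /=; lia.
have rl := ltn_ord r; have sl := ltn_ord s.
have := disp_le w 0 nrs; have := disp_le w (-1) nrs; rewrite !h.
have -> : (c + r%:Z < c + s%:Z + l%:Z * 0) = true by lia.
have -> : (c + r%:Z < c + s%:Z + l%:Z * -1) = false by lia.
lia.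
Qed.

Lemma shift_window w a b : shift w -> window w b - window w a = b%:Z - a%:Z.
Proof. by move=> /shiftE[c h]; rewrite !h; lia. Qed.

Lemma shiftV w : shift w -> shift (w^-1)%g.
Proof.
move=> [c h]; apply/shiftE; exists (- c) => r; rewrite /window /= !ffunE /=.
rewrite invgK permKV; have := h r; rewrite /hat; lia.
Qed.

Lemma shift_simple w t : shift w -> simple_refl t -> simple_refl (t ^ w)%g.
Proof.
move=> sw ht; have [a [b [c [ab E]]]] := simple_refl_refl ht.
by move: ht; rewrite E simple_conj // simple_reflE // shift_window.
Qed.

Lemma shift_length0 w : shift w -> length0 w.
Proof.
move=> sw t; split=> [|h]; first exact: shift_simple.
by rewrite -[t](conjgK w); apply: shift_simple => //; apply: shiftV.
Qed.

Lemma length0_shift w : length0 w -> shift w.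
Proof.
move=> h; apply/shiftE.
have adj j k : k = j.+1 :> nat -> window w k <= window w j + 1.
  move=> kj; have jk : j != k by rewrite -val_eqE /=; lia.
  have := (h (refl j k 0)).1; rewrite simple_conj // simple_reflE // mulr0 !addr0.
  by rewrite kj => H; have := H ltac:(lia); lia.
have lb (q s : 'I_l) : (q <= s)%N -> window w s <= window w q + (s%:Z - q%:Z).
  rewrite leq_eqVlt => /predU1P[/val_inj ->|qs]; first lia.
  pose e (i i' : 'I_l) := window w i' <= window w i + (i'%:Z - i%:Z).
  have tr : transitive e by move=> y x z; rewrite /e; lia.
  apply: (chain_rel (e := e)) => // j k kj _ _; rewrite /e.
  by have := adj j k kj; lia.
have [l0|lpos] := posnP l; first by exists 0 => r; have := ltn_ord r; rewrite {2}l0.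
pose o := Ordinal lpos; pose p := rev_ord o; have pE : p = l.-1 :> nat by rewrite /= subn1.
exists (- window w o) => r.
have rl := ltn_ord r; have := lb o r (leq0n _); have := lb r p.
have -> : (r <= p)%N by lia.
move=> /(_ isT); have [l1|l1] := leqP l 1.
  have -> : r = o by apply: val_inj => /=; lia.
  rewrite /=; lia.
have nE : o != p by rewrite -val_eqE /=; lia.
have := (h (refl o p (-1))).1; rewrite simple_conj // simple_reflE // pE /=.
by move=> H; have := H ltac:(lia); lia.
Qed.

Lemma length0P w : length0 w <-> alen w = 0%N.
Proof.
split=> [/length0_shift/shift_alen0|/alen0_shift/shift_length0] //.
Qed.

End Reflections.

Section WordLength.
Variable l : nat.
Implicit Types (w x y t om : affS l) (u z : 'S_l) (a b j k r s : 'I_l) (c : int).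

Lemma alen_simple w t : simple_refl t ->
  alen (w * t)%g = (alen w).+1 \/ alen w = (alen (w * t)%g).+1.
Proof.
case=> [[j [k [kj ->]]]|[j [k [j0 kl jk ->]]]].
  by have := alen_fin_simple w kj; case: ifP => _; [left|right].
have := alen_s0 w j0 kl jk; rewrite -[(tperm j k, _)]/(s0_elt j k); lia.
Qed.

Lemma alen_descent w : (0 < alen w)%N ->
  exists2 t, simple_refl t & alen w = (alen (w * t)%g).+1.
Proof.
move=> Lw; apply: contrapT => nd.
have {}nd t : simple_refl t -> alen (w * t)%g = (alen w).+1.
  by move=> st; case: (alen_simple w st) => // E; case: nd; exists t.
have adj j k : k = j.+1 :> nat -> hat w j < hat w k.
  move=> kj; have := alen_fin_simple w kj; case: ifP => // _.
  by rewrite (nd _ (simple_fin kj)); lia.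
have mono r s : (r < s)%N -> hat w r < hat w s.
  move=> rs; apply: (chain_rel (e := fun a b => hat w a < hat w b)) => //.
    by move=> y x z; apply: lt_trans.
  by move=> j k kj _ _; apply: adj.
move: Lw; rewrite /alen big1 // => -[r s] /= rs.
have nrs : r != s by rewrite -val_eqE /=; lia.
have lpos : (0 < l)%N by have := ltn_ord r; lia.
pose o := Ordinal lpos; pose p := rev_ord o; have pE : p = l.-1 :> nat by rewrite /= subn1.
have sl := ltn_ord s.
have op : (o < p)%N by rewrite pE /=; lia.
have nop : o != p by rewrite -val_eqE /=; lia.
have kl : p.+1 = l by rewrite pE; lia.
have := nd (s0_elt o p) (or_intror _); rewrite {}/s0_elt.
have := alen_s0 w (erefl : o = 0%N :> nat) kl op; rewrite /s0_elt.
move=> E H; have {H} := H ltac:(by exists o, p).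
have := disp_le w (-1) nop; have := disp_le w (-1) nrs; have := disp_le0 w nrs.
rewrite mono //.
have : hat w o <= hat w r.
  by have [->//|/mono/ltW//] : r = o \/ (o < r)%N by case: (posnP r) => [r0|]; [left; apply: val_inj|right].
have : hat w s <= hat w p.
  have [->//|/mono/ltW//] : s = p \/ (s < p)%N.
  by case: (ltnP s p) => sp; [right|left; apply: val_inj => /=; lia].
lia.
Qed.

Lemma simple_sq t : simple_refl t -> (t * t)%g = 1%g.
Proof.
move=> st; have [a [b [c [ab ->]]]] := simple_refl_refl st.
congr pair; first by rewrite tperm2.
apply/ffunP => r; rewrite !ffunE /= tpermV ?ffunE.
by case: tpermP => [->|->|/eqP ra /eqP rb];
  rewrite ?eqxx ?(negPf ab) ?(negPf ra) ?(negPf rb) 1?eq_sym ?(negPf ab) /=; ring.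
Qed.

Lemma word_alen w (r : nat) : word_length w r -> (alen w <= r)%N.
Proof.
case=> om [ss [hom hss <- ->]] {w r}.
elim/last_ind: ss hss => [|ss t IH] hss.
  by rewrite big_nil mulg1 (length0P om).1.
rewrite -cats1 big_cat big_seq1 mulgA size_cat addn1.
have {}IH := IH (fun x hs => hss x ltac:(by rewrite mem_rcons inE hs orbT)).
have := alen_simple (om * \prod_(x <- ss) x)%g (hss t ltac:(by rewrite mem_rcons inE eqxx)).
move=> H; have {H}H : (alen (om * \prod_(x <- ss) x * t)%g <= (size ss).+1)%N by lia.
exact: H.
Qed.

Lemma alen_word w : word_length w (alen w).
Proof.
have [m] := ubnP (alen w); elim: m => // m IH in w *; rewrite ltnS => wm.
have [L0|/alen_descent[t st E]] := posnP (alen w).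
  exists w, [::]; split=> //; first exact/length0P.
  by rewrite big_nil mulg1.
have [|om [ss [hom hss sz wE]]] := IH (w * t)%g; first by lia.
exists om, (rcons ss t); split=> //.
- by move=> s; rewrite mem_rcons inE => /predU1P[->//|/hss].
- by rewrite size_rcons sz -E.
- by rewrite -cats1 big_cat big_seq1 mulgA -wE -mulgA simple_sq ?mulg1.
Qed.

Lemma lenE w : len w = alen w.
Proof.
rewrite /len; set A := [set r | _]%classic.
have [h1 h2] : A (xget 0%N A).
  apply: xgetPex; exists (alen w); split=> [|r wr]; [exact: alen_word|exact: word_alen wr].
apply/eqP; rewrite eqn_leq; apply/andP; split; [exact/h2/alen_word|exact: word_alen h1].
Qed.

Lemma len_word w : word_length w (len w).
Proof. by rewrite lenE; apply: alen_word. Qed.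

Lemma len_le w (r : nat) : word_length w r -> (len w <= r)%N.
Proof. by rewrite lenE; apply: word_alen. Qed.

Lemma length0E om : length0 om <-> len om = 0%N.
Proof. by rewrite lenE; apply: length0P. Qed.

Lemma length0M x y : length0 x -> length0 y -> length0 (x * y)%g.
Proof. move=> hx hy t; rewrite conjgM; have [h1 h2] := hx t; have [h3 h4] := hy (t ^ x)%g.
by split=> [/h1/h3|/h4/h2]. Qed.

Lemma length0V x : length0 x -> length0 (x^-1)%g.
Proof.
by move=> h t; have := h (t ^ x^-1)%g; rewrite conjgKV => -[h1 h2]; split.
Qed.

Lemma len1 : len (1 : affS l)%g = 0%N.
Proof. by rewrite lenE alen1. Qed.

Lemma conj_prod om (ss : seq (affS l)) :
  ((\prod_(x <- ss) x) ^ om = \prod_(x <- [seq y ^ om | y <- ss]) x)%g.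
Proof.
elim: ss => [|x ss IH]; first by rewrite !big_nil conj1g.
by rewrite /= !big_cons conjMg IH.
Qed.

Lemma lenM0 om w : length0 om -> len (w * om)%g = len w.
Proof.
have le om' w' : length0 om' -> (len (w' * om')%g <= len w')%N.
  move=> h; apply: len_le; have [om1 [ss [h1 hss sz {1}->]]] := len_word w'.
  exists (om1 * om')%g, [seq (y ^ om')%g | y <- ss]; split.
  - exact: length0M.
  - by move=> x /mapP[y /hss sy ->]; apply/(h y).1.
  - by rewrite size_map.
  - by rewrite -conj_prod conjgE !mulgA mulgK.
move=> h; apply/eqP; rewrite eqn_leq le //=.
by have := le _ (w * om)%g (length0V h); rewrite mulgK.
Qed.

Lemma simpleV t : simple_refl t -> (t^-1)%g = t.
Proof. by move=> /simple_sq E; rewrite -[LHS]mulg1 -E mulKg. Qed.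

Lemma len_inv w : len (w^-1)%g = len w.
Proof.
have le w' : (len (w'^-1)%g <= len w')%N.
  have [om [ss [h hss sz {1}->]]] := len_word w'.
  rewrite invMg lenM0; last exact: length0V.
  apply: len_le; exists 1%g, (rev ss); split.
  - by apply/length0E; rewrite len1.
  - by move=> x; rewrite mem_rev => /hss.
  - by rewrite size_rev.
  rewrite mul1g {sz}; elim: ss hss => [|x ss IH] hss; first by rewrite !big_nil invg1.
  rewrite rev_cons big_cons invMg IH => [|y hy]; last by apply: hss; rewrite inE hy orbT.
  rewrite (simpleV (hss x ltac:(by rewrite inE eqxx))).
  by rewrite -cats1 big_cat big_seq1.
by apply/eqP; rewrite eqn_leq le /=; have := le (w^-1)%g; rewrite invgK.
Qed.

Lemma len_simple w t : simple_refl t ->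
  len (w * t)%g = (len w).+1 \/ len w = (len (w * t)%g).+1.
Proof. by rewrite !lenE; apply: alen_simple. Qed.

Lemma len_simpleL w t : simple_refl t ->
  len (t * w)%g = (len w).+1 \/ len w = (len (t * w)%g).+1.
Proof.
move=> st; have := len_simple (w^-1)%g st.
by rewrite -(len_inv (t * w)%g) invMg (simpleV st) len_inv.
Qed.

Lemma affS_ind (Q : affS l -> Prop) :
  (forall om, length0 om -> Q om) ->
  (forall w t, simple_refl t -> len (w * t)%g = (len w).+1 -> Q w -> Q (w * t)%g) ->
  forall w, Q w.
Proof.
move=> h0 hS w; have [m] := ubnP (len w); elim: m => // m IH in w *; rewrite ltnS => wm.
have [L0|] := posnP (len w); first by apply/h0/length0E.
rewrite lenE => /alen_descent[t st]; rewrite -!lenE => E.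
have -> : w = (w * t * t)%g by rewrite -mulgA simple_sq ?mulg1.
apply: hS => //; first by rewrite -mulgA simple_sq ?mulg1.
by apply: IH; lia.
Qed.

Lemma len_finM x u :
  (forall a b, (a < b)%N -> (u b < u a)%N -> hat x a < hat x b) ->
  len (x * fin_aff u)%g = (len x + len (fin_aff u))%N.
Proof. by move=> h; rewrite !lenE alen_fin alen_plus. Qed.

Lemma len_finB x u :
  (forall a b, (a < b)%N -> (u b < u a)%N -> hat x b < hat x a) ->
  (len (x * fin_aff u)%g + len (fin_aff u))%N = len x.
Proof. by move=> h; rewrite !lenE alen_fin alen_minus. Qed.

Lemma len_fin_simple w j k : k = j.+1 :> nat ->
  if hat w j < hat w k then len (w * fin_aff (tperm j k))%g = (len w).+1
  else len w = (len (w * fin_aff (tperm j k))%g).+1.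
Proof. by rewrite !lenE; apply: alen_fin_simple. Qed.

Lemma len_fin_asc w j k : k = j.+1 :> nat ->
  (len (w * fin_aff (tperm j k))%g = (len w).+1) <-> hat w j < hat w k.
Proof. by move=> kj; have := len_fin_simple w kj; case: ifP => _ //; split=> //; lia. Qed.

Lemma len_fin_desc w j k : k = j.+1 :> nat ->
  (len w = (len (w * fin_aff (tperm j k))%g).+1) <-> hat w k < hat w j.
Proof.
move=> kj; have := len_fin_simple w kj; case: ifP => h E; split=> //.
- by lia.
- by move=> h'; move: (lt_trans h h'); rewrite ltxx.
- move=> _; rewrite lt_neqAle leNgt h andbT; apply/eqP => /hat_inj jk.
  by move: kj; rewrite jk; lia.
Qed.

Definition weakly_inc (i : Zl l) := forall j k : 'I_l, (j <= k)%N -> i j <= i k.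

Section Parabolic.
Variables (i : Zl l) (hi : weakly_inc i).

Lemma stab_inv u a b : place_perm i u = i -> (a < b)%N -> (u b < u a)%N -> i a = i b.
Proof.
move=> /ffunP su ab inv; have ua := su (u a); have ub := su (u b).
rewrite !ffunE !permK in ua ub.
by apply/eqP; rewrite eq_le hi ?(ltnW ab) //= ua ub hi // ltnW.
Qed.

Lemma place_permM (i' : Zl l) u z : place_perm i' (u * z)%g = place_perm (place_perm i' u) z.
Proof. by apply/ffunP => k; rewrite !ffunE invMg permM. Qed.

Lemma place_perm1 (i' : Zl l) : place_perm i' 1%g = i'.
Proof. by apply/ffunP => k; rewrite !ffunE invg1 perm1. Qed.

Lemma place_permV u : place_perm i u = i -> place_perm i (u^-1)%g = i.
Proof. by move=> {1}<-; rewrite -place_permM mulgV place_perm1. Qed.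

Lemma place_perm_tperm (i' : Zl l) j k : i' j = i' k -> place_perm i' (tperm j k) = i'.
Proof.
by move=> E; apply/ffunP => r; rewrite !ffunE tpermV; case: tpermP => // ->.
Qed.

Lemma block_chain (f : 'I_l -> int) a b :
  (forall j k, k = j.+1 :> nat -> i j = i k -> f j < f k) ->
  (a < b)%N -> i a = i b -> f a < f b.
Proof.
move=> adj ab E; apply: (chain_rel (e := fun a b => f a < f b)) => //.
  by move=> y x z; apply: lt_trans.
move=> j k kj aj kb; apply: adj => //.
by apply/eqP; rewrite eq_le hi /= ?kj // (le_trans (hi kb)) // -E hi.
Qed.

Lemma no_inv_eq1 u : (forall a b, (a < b)%N -> (u a < u b)%N) -> u = 1%g.
Proof.
move=> h; have uK : forall r, (u^-1)%g r = r.
  have L0 : alen (fin_aff u) = 0%N.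
    rewrite alen_fin /ninv big1 // => -[a b] /= /h; lia.
  have [c hc] := alen0_shift L0.
  have E r : ((u^-1)%g r : nat)%:Z = c + (r : nat)%:Z by rewrite -hc hat_fin1.
  move=> r; apply: val_inj; have := E r => /=.
  have lpos : (0 < l)%N by have := ltn_ord r; lia.
  have := E (Ordinal lpos); have := E (rev_ord (Ordinal lpos)) => /=.
  have := ltn_ord ((u^-1)%g (rev_ord (Ordinal lpos))); rewrite subn1.
  by move=> /=; lia.
by apply/permP => r; rewrite perm1 -{1}(uK r) permKV.
Qed.

Lemma parabolic_ind (Q : 'S_l -> Prop) : Q 1%g ->
  (forall u j k, k = j.+1 :> nat -> i j = i k -> place_perm i u = i ->
     len (fin_aff (u * tperm j k)%g) = (len (fin_aff u)).+1 ->
     Q u -> Q (u * tperm j k)%g) ->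
  forall u, place_perm i u = i -> Q u.
Proof.
move=> Q1 QS u; have [m] := ubnP (len (fin_aff u)); elim: m => // m IH in u *.
rewrite ltnS => um su.
case: (pselect (forall j k, k = j.+1 :> nat -> i j = i k ->
  hat (fin_aff u) j < hat (fin_aff u) k)) => [asc|].
  have -> // : u = 1%g.
  rewrite -[u]invgK (no_inv_eq1 (u := (u^-1)%g)) ?invg1 // => a b ab.
  rewrite ltnNge leq_eqVlt; apply/negP => /predU1P[/val_inj/perm_inj E|inv].
    by rewrite E ltnn in ab.
  have := block_chain asc ab (stab_inv (place_permV su) ab inv).
  by rewrite !hat_fin1; lia.
move=> /existsNP[j] /existsNP[k] /not_implyP[kj] /not_implyP[ij] nasc.
have := len_fin_simple (fin_aff u) kj; case: ifP => // _; rewrite -fin_affM => E.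
have -> : u = (u * tperm j k * tperm j k)%g by rewrite -mulgA tperm2 mulg1.
have su' : place_perm i (u * tperm j k) = i by rewrite place_permM su place_perm_tperm.
apply: QS => //; first by rewrite -mulgA tperm2 mulg1.
by apply: IH => //; lia.
Qed.

Lemma len_stab_mul u y : place_perm i u = i ->
  (forall j k, k = j.+1 :> nat -> i j = i k -> hat (y^-1)%g j < hat (y^-1)%g k) ->
  len (fin_aff u * y)%g = (len (fin_aff u) + len y)%N.
Proof.
move=> su hy; rewrite -len_inv invMg -fin_affV len_finM.
  by rewrite fin_affV !len_inv addnC.
move=> a b ab inv; apply: block_chain => //.
exact: stab_inv (place_permV su) ab inv.
Qed.

Lemma len_stab_sub u u0 : place_perm i u = i ->
  (forall a b, (a < b)%N -> i a = i b -> (u0 b < u0 a)%N) ->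
  (len (fin_aff (u * u0)%g) + len (fin_aff u))%N = len (fin_aff u0).
Proof.
move=> su hu0; rewrite -[len (fin_aff u0)]len_inv -[len (fin_aff (u * u0)%g)]len_inv.
rewrite -[len (fin_aff u)]len_inv -!fin_affV invMg fin_affM len_finB //.
move=> a b ab inv; rewrite !hat_fin1 invgK.
by have := hu0 _ _ ab (stab_inv (place_permV su) ab inv); lia.
Qed.

End Parabolic.
End WordLength.

Lemma mulrn_intE (c : int) n : c *+ n = n%:Z * c.
Proof. by rewrite -mulr_natl natz. Qed.

(** * Translations and the action on weights *)

Section Dominant.
Variable l : nat.
Implicit Types (w x y t om : affS l) (u z : 'S_l) (a b j k r s : 'I_l) (m : Zl l).

Definition tr m : affS l := (1%g, m).
Definition weakly_dec m := forall j k : 'I_l, (j <= k)%N -> m k <= m j.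

Lemma fin_tr u m : (fin_aff u * tr m)%g = (u, m).
Proof.
congr pair; first by rewrite /= mulg1.
by apply/ffunP => r; rewrite !ffunE add0r.
Qed.

Lemma tr_fin m u : (tr m * fin_aff u)%g = (u, place_perm m u).
Proof.
by congr pair; [rewrite /= mul1g|apply/ffunP => r; rewrite !ffunE addr0].
Qed.

Lemma trD m m' : (tr m * tr m')%g = tr (m + m').
Proof.
congr pair; first by rewrite /= mulg1.
by apply/ffunP => r; rewrite !ffunE invg1 perm1.
Qed.

Lemma tr0 : tr 0 = 1%g. Proof. by []. Qed.

Lemma trV m : (tr m)^-1%g = tr (- m).
Proof.
by rewrite -[LHS]mulg1 -tr0 -(subrr m) -trD mulKg.
Qed.

Lemma hat_tr m r : hat (tr m) r = (r : nat)%:Z + l%:Z * m r.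
Proof. by rewrite /hat /= invg1 perm1. Qed.

Lemma disp_dec u m r s : weakly_dec m -> (r < s)%N ->
  disp (u, m) r s = disp (tr m) r s + disp (fin_aff u) r s /\
  0 <= disp (tr m) r s /\ 0 <= disp (fin_aff u) r s.
Proof.
move=> dm rs; have := dm _ _ (ltnW rs).
rewrite /disp /= invg1 !perm1 !ffunE (ltnNge s r) (ltnW rs) /=.
by case: (_ < _)%N => /=; lia.
Qed.

Lemma len_dec u m : weakly_dec m -> len (u, m) = (len (fin_aff u) + len (tr m))%N.
Proof.
move=> dm; rewrite !lenE /alen -big_split; apply: eq_bigr => -[r s] /= rs.
by have [-> [h1 h2]] := disp_dec u dm rs; lia.
Qed.

Lemma len_trD m m' : weakly_dec m -> weakly_dec m' ->
  len (tr (m + m')) = (len (tr m) + len (tr m'))%N.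
Proof.
move=> dm dm'; rewrite !lenE /alen -big_split; apply: eq_bigr => -[r s] /= rs.
have := dm _ _ (ltnW rs); have := dm' _ _ (ltnW rs).
by rewrite /disp /= !ffunE invg1 !perm1 (ltnNge s r) (ltnW rs) /=; lia.
Qed.

Lemma len_tr_tperm m j k : k = j.+1 :> nat -> weakly_dec m -> m j = m k + 1 ->
  (len (tr (place_perm m (tperm j k) + m)%R) + 2 = len (tr m) + len (tr m))%N.
Proof.
move=> kj dm mjk; set t := tperm j k.
have tV : (t^-1)%g = t by exact: tpermV.
have dp : weakly_dec (place_perm m t + m).
  have jk' : j != k by rewrite -val_eqE /=; lia.
  move=> r s rs; rewrite !ffunE tV.
  have adj (p q : 'I_l) : (p < q)%N -> m (t q) + m q <= m (t p) + m p.
    have A := dm k q; have B := dm p j; have D := dm p q; move: A B D; rewrite /t.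
    case: (tpermP j k p) => [->|->|/eqP pj /eqP pk];
      case: tpermP => [->|->|/eqP qj /eqP qk];
      try move: pj; try move: pk; try move: qj; try move: qk; rewrite -?val_eqE /= ?kj; lia.
  by move: rs; rewrite leq_eqVlt => /predU1P[/val_inj ->//|/adj].
pose S (m' : Zl l) : int := \sum_(p : 'I_l * 'I_l | (p.1 < p.2)%N) (m' p.1 - m' p.2).
have lenS m' : weakly_dec m' -> (len (tr m'))%:Z = S m'.
  move=> dm'; rewrite lenE /alen (big_morph Posz PoszD (erefl _)).
  apply: eq_bigr => -[r s] /= rs; have := dm' _ _ (ltnW rs).
  by rewrite /disp /= invg1 !perm1 (ltnNge s r) (ltnW rs) /=; lia.
have SD : S (place_perm m t + m) = S m + S m - 2.
  have -> : S (place_perm m t + m) = S (place_perm m t) + S m.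
    by rewrite /S -big_split; apply: eq_bigr => p _; rewrite !ffunE /=; lia.
  suff -> : S (place_perm m t) = S m - 2 by lia.
  have -> : S (place_perm m t) = \sum_(p : 'I_l * 'I_l | (p.1 < p.2)%N)
      if (t p.1 < t p.2)%N then m p.1 - m p.2 else m p.2 - m p.1.
    rewrite -(sum_pairs_perm (fun a b => m a - m b)).
    by apply: eq_bigr => p _; rewrite !ffunE.
  have jk : (j < k)%N by rewrite kj.
  rewrite /S (bigD1 (j, k)) //= [in RHS](bigD1 (j, k)) //= /t tpermL tpermR.
  rewrite ltnNge (ltnW jk) /= mjk [X in _ + X = _](_ : _ =
    \sum_(p : 'I_l * 'I_l | (p.1 < p.2)%N && (p != (j, k))) (m p.1 - m p.2)).
    by ring.
  apply: eq_bigr => -[a b] /= /andP[ab nab].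
  case: ltnP => //; rewrite leq_eqVlt => /predU1P[/val_inj/perm_inj E|h].
    by move: ab; rewrite E ltnn.
  by have [Ea Eb] := tperm_adj_inv kj ab h; rewrite Ea Eb eqxx in nab.
have := lenS _ dp; have := lenS _ dm; rewrite SD; lia.
Qed.

Definition w0 : 'S_l := perm (@rev_ord_inj l).

Lemma w0E r : w0 r = rev_ord r. Proof. by rewrite permE. Qed.

Lemma w0V : (w0^-1)%g = w0.
Proof.
by rewrite -[LHS]mulg1 (_ : 1 = w0 * w0)%g ?mulKg //; apply/permP => r; rewrite permM !w0E rev_ordK perm1.
Qed.

Lemma place_perm_w0 (i : Zl l) : place_perm i w0 = reverse i.
Proof. by apply/ffunP => r; rewrite !ffunE w0V w0E. Qed.

Lemma w0_anti a b : (a < b)%N -> (w0 b < w0 a)%N.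
Proof. by move=> ab; rewrite !w0E /=; have := ltn_ord b; lia. Qed.

Lemma len_w0 : len (fin_aff w0) = (l * l.-1)./2.
Proof.
rewrite lenE alen_fin /ninv.
under eq_bigr => p h do rewrite (w0_anti h).
rewrite -(pair_big_dep xpredT (fun a b : 'I_l => a < b)%N (fun _ _ => 1%N)) /=.
rewrite (exchange_big_dep xpredT) //= -bin2 -bin2_sum big_mkord.
apply: eq_bigr => b _; rewrite (big_ord_narrow (ltnW (ltn_ord b))) /=.
by rewrite sum1_card card_ord.
Qed.

Lemma len_tr_fin_inc m u : (forall a b, (a <= b)%N -> m a <= m b) ->
  len (tr m * fin_aff u)%g = (len (tr m) + len (fin_aff u))%N.
Proof.
move=> im; apply: len_finM => a b ab _; rewrite !hat_tr.
by have := im _ _ (ltnW ab); nia.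
Qed.

Lemma hat_tr_lt m j k : k = j.+1 :> nat -> m j = m k -> hat (tr m) j < hat (tr m) k.
Proof. by move=> kj E; rewrite !hat_tr E kj; lia. Qed.

Lemma hat_tr_gt m j k : m k < m j -> hat (tr m) k < hat (tr m) j.
Proof. by move=> E; rewrite !hat_tr; have := ltn_ord k; have := ltn_ord j; nia. Qed.

End Dominant.

Section Action.
Variables (l n : nat).
Hypothesis hn : (0 < n)%N.
Implicit Types (w x y t om : affS l) (u z : 'S_l) (a b k r s : 'I_l) (i j m : Zl l).

Lemma aff_actM i x y : aff_act n i (x * y)%g = aff_act n (aff_act n i x) y.
Proof.
apply/ffunP => r; rewrite !(ffunMnE, ffunE) /= invMg permM.
by rewrite mulrnDl addrA.
Qed.

Definition box_rep (j : Zl l) : Zl l := [ffun k => - ((- j k) %% n%:Z)%Z].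
Definition box_quo (j : Zl l) : Zl l := [ffun k => - ((- j k) %/ n%:Z)%Z].

Definition in_box i := forall k, 1 - n%:Z <= i k <= 0.

Lemma box_eq j : j = box_rep j + box_quo j *+ n.
Proof.
apply/ffunP => k; rewrite !(ffunMnE, ffunE).
by rewrite {1}[j k](_ : _ = - - j k) ?opprK // (divz_eq (- j k) n%:Z); lia.
Qed.

Lemma box_rep_in j : in_box (box_rep j).
Proof.
move=> k; rewrite !ffunE; have := modz_ge0 (- j k) (_ : n%:Z != 0).
have := ltz_pmod (- j k) (_ : 0 < n%:Z); lia.
Qed.

Lemma box_uniq i i' m m' : in_box i -> in_box i' ->
  i + m *+ n = i' + m' *+ n -> i = i' /\ m = m'.
Proof.
move=> hi hi' E; have key k : i k = i' k /\ m k = m' k.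
  have := congr1 (fun f : Zl l => f k) E; rewrite !(ffunMnE, ffunE).
  have := hi k; have := hi' k; move: (i k) (i' k) (m k) (m' k) => p q c d.
  rewrite !mulrn_intE => h h' E'.
  have En : n%:Z * (c - d) = q - p by rewrite mulrBr; lia.
  have [cd|[cd|cd]] : c - d <= -1 \/ c - d = 0 \/ 1 <= c - d by lia.
  - have : n%:Z * (c - d) <= - n%:Z by nia.
    by lia.
  - by rewrite cd mulr0 in En; split; lia.
  - have : n%:Z * (c - d) >= n%:Z by nia.
    by lia.
by split; apply/ffunP => k; have [] := key k.
Qed.

Lemma place_perm_box i u : in_box i -> in_box (place_perm i u).
Proof. by move=> h k; rewrite !ffunE. Qed.

Section Alcove.
Variables (i : Zl l) (hi : in_alcove n i).

Let iinc : weakly_inc i. Proof. by case: hi. Qed.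
Let ibox : in_box i. Proof. by case: hi. Qed.

Lemma aff_act_eqE y j : aff_act n i y = j <->
  place_perm i y.1 = box_rep j /\ y.2 = box_quo j.
Proof.
split=> [E|[E1 E2]]; last by rewrite /aff_act E1 E2 -box_eq.
by apply: box_uniq; [apply: place_perm_box|apply: box_rep_in|rewrite -box_eq].
Qed.

Lemma stabE w : stab n i w <-> exists2 u, place_perm i u = i & w = fin_aff u.
Proof.
split=> [E|[u su ->]]; last by rewrite /stab /aff_act su mul0rn addr0.
have [] : place_perm i w.1 = i /\ w.2 = 0.
  by apply: box_uniq => //; [exact: place_perm_box|rewrite mul0rn addr0].
by case: w {E} => u m /= su ->; exists u.
Qed.

Lemma act_lt y r s : aff_act n i y r < aff_act n i y s -> hat y r < hat y s.
Proof.
case: y => z m; rewrite /hat !(ffunMnE, ffunE) /= !mulrn_intE.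
have := ibox ((z^-1)%g r); have := ibox ((z^-1)%g s).
have := @iinc ((z^-1)%g s) ((z^-1)%g r).
have := ltn_ord ((z^-1)%g r); have := ltn_ord ((z^-1)%g s).
move: ((z^-1)%g r) ((z^-1)%g s) => p q.
move: (m r) (m s) (i p) (i q) => c d ip iq ql pl h1 h2 h3 h4.
have [cd|[cd|cd]] : c - d <= -1 \/ c - d = 0 \/ 1 <= c - d by lia.
- have : l%:Z * (c - d) <= - l%:Z by nia.
  by lia.
- have E : c = d by lia.
  by case: (leqP q p) h1 => [h /(_ isT)|h _]; rewrite E in h4 *; lia.
- by exfalso; nia.
Qed.

Lemma act_le y r s : hat y r < hat y s -> aff_act n i y r <= aff_act n i y s.
Proof.
move=> h; rewrite leNgt; apply/negP => /act_lt h'.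
by move: (lt_trans h h'); rewrite ltxx.
Qed.

End Alcove.

Lemma ex_alcove (j : Zl l) : exists i u, in_alcove n i /\ place_perm i u = box_rep j.
Proof.
move: (box_rep j) (box_rep_in j) => a abox.
have [u hu] : exists u : 'S_l, weakly_inc (place_perm a u).
  pose t := [tuple a k | k < l]; pose s := [tuple of sort <=%R t].
  have /tuple_permP[p pE] : perm_eq s t by rewrite perm_sort.
  have sE k : nth 0 s k = a (p k).
    by rewrite pE nth_mktuple tnth_mktuple.
  exists (p^-1)%g => r r' rr'; rewrite !ffunE invgK -!sE.
  have st : sorted <=%R s by apply: sort_sorted; apply: le_total.
  apply: (sorted_leq_nth le_trans le_refl) => //; rewrite inE size_tuple //.
exists (place_perm a u), (u^-1)%g; split.
  by split=> //; apply: place_perm_box.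
by rewrite -place_permM mulgV place_perm1.
Qed.

End Action.

Section Bruhat.
Variable l : nat.
Implicit Types (w x y t : affS l) (a b k r s : 'I_l).

Definition trans_sum w : int := \sum_k w.2 k.

Lemma trans_sumM x y : trans_sum (x * y)%g = trans_sum x + trans_sum y.
Proof.
rewrite /trans_sum [\sum_k x.2 k](reindex_inj (@perm_inj _ (y.1^-1)%g)) /= -big_split /=.
by apply: eq_bigr => k _; rewrite !ffunE.
Qed.

Lemma trans_sumV x : trans_sum (x^-1)%g = - trans_sum x.
Proof.
have : trans_sum (x * x^-1)%g = 0 by rewrite mulgV /trans_sum big1 // => k _; rewrite ffunE.
by rewrite trans_sumM; lia.
Qed.

Lemma trans_sum_refl t : is_reflection t -> trans_sum t = 0.
Proof.
case=> s [w [/simple_refl_refl[a [b [c [ab ->]]]] ->]].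
suff E : trans_sum (refl a b c) = 0 by rewrite conjgE !trans_sumM trans_sumV E; lia.
rewrite /trans_sum /=; under eq_bigr do rewrite ffunE.
have S1 d : \sum_(r : 'I_l) (r == d)%:Z = 1.
  by rewrite (bigD1 d) //= eqxx big1 ?addr0 // => k /negPf ->.
by rewrite -mulr_sumr sumrB !S1 subrr mulr0.
Qed.

Lemma bruhat_trans_sum y x : bruhat y x -> trans_sum y = trans_sum x.
Proof.
elim=> // [{}y {}x [[t [rt ->]] _]|]; last by move=> ? ? ? _ -> _ ->.
by rewrite trans_sumM (trans_sum_refl rt) addr0.
Qed.

Lemma bruhat_len y x : bruhat y x -> y = x \/ (len y < len x)%N.
Proof.
elim=> [{}y {}x [_ h]|{}x|x' y' z' _ h1 _ h2]; [by right|by left|].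
case: h1 => [->|h1]; case: h2 => [<-|h2]; try by [left|right].
by right; lia.
Qed.

Lemma len_bound w r s : `|w.2 r - w.2 s| <= (len w)%:Z + 1.
Proof.
wlog rs : r s / (r < s)%N => [W|].
  case: (ltngtP r s) => [/W//|/W|/val_inj ->]; first by rewrite distrC.
  by rewrite subrr normr0; lia.
have : (absz (disp w r s) <= len w)%N.
  by rewrite lenE /alen (bigD1 (r, s)) //= leq_addr.
by rewrite /disp; case: (_ < _)%N => /=; lia.
Qed.

Lemma bruhat_finite x : finite_set [set y | bruhat y x].
Proof.
have [l0|lpos] := posnP l.
  apply: (@sub_finite_set _ _ [set x]%classic); last exact: finite_set1.
  move=> y _ /=; case: x y => [z m] [z' m']; congr pair.
    by apply/permP => r; have := ltn_ord r; rewrite {2}l0.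
  by apply/ffunP => r; have := ltn_ord r; rewrite {2}l0.
pose B := (`|trans_sum x| + (len x).+1)%N.
pose f (p : 'S_l * {ffun 'I_l -> 'I_(B.*2.+1)}) : affS l :=
  (p.1, [ffun r => (p.2 r : nat)%:Z - B%:Z]).
apply: (@sub_finite_set _ _ (f @` setT)%classic); last first.
  exact/finite_image/finite_finset.
move=> y yx /=.
have hB r : `|y.2 r| <= B%:Z.
  have E : l%:Z * y.2 r = trans_sum y + \sum_k (y.2 r - y.2 k).
    rewrite sumrB sumr_const card_ord /trans_sum addrC subrK.
    by rewrite mulrn_intE.
  have h : `|\sum_k (y.2 r - y.2 k)| <= l%:Z * (len x).+1%:Z.
    apply: le_trans (ler_norm_sum _ _ _) _.
    rewrite (_ : l%:Z * _ = \sum_(k < l) (len x).+1%:Z).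
      apply: ler_sum => k _; apply: le_trans (len_bound _ _ _) _.
      by case: (bruhat_len yx) => [->|]; lia.
    by rewrite sumr_const card_ord mulrn_intE.
  rewrite (bruhat_trans_sum yx) in E; rewrite /B; nia.
exists (y.1, [ffun r => inord `|(y.2 r + B%:Z)%R|%N]) => //.
rewrite /f /= [RHS]surjective_pairing; congr pair; apply/ffunP => r; rewrite !ffunE.
move: (y.2 r) (hB r) => c h; clearbody B.
have E : (`|(c + B%:Z)%R| < B.*2.+1)%N by lia.
by rewrite inordK //; lia.
Qed.

End Bruhat.

Section FreeBasis.
Variables (C : comNzRingType) (I : choiceType) (M : lmodType (laurent C)) (f : I -> M).
Local Notation A := (laurent C).
Implicit Types (c d : {malg A[I]}) (u : M) (i : I) (a : A).

Lemma lcombw (N : lmodType A) (g : I -> N) c (D : {fset I}) : (msupp c `<=` D)%fset ->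
  lcomb g c = \sum_(i <- D) c@_i *: g i.
Proof.
move=> le; rewrite /lcomb (big_fset_incl _ le) // => i _ /mcoeff_outdom ->.
by rewrite scale0r.
Qed.

Section Lcomb.
Variables (N : lmodType A) (g : I -> N).

Lemma lcombD c d : lcomb g (c + d) = lcomb g c + lcomb g d.
Proof.
rewrite (lcombw g (msuppD_le c d)) (lcombw g (fsubsetUl (msupp c) (msupp d))).
rewrite (lcombw g (fsubsetUr (msupp c) (msupp d))) -big_split.
by apply: eq_bigr => i _; rewrite mcoeffD scalerDl.
Qed.

Lemma lcombZ a c : lcomb g (a *: c) = a *: lcomb g c.
Proof.
rewrite (lcombw g (msuppZ_le a c)) /lcomb scaler_sumr.
by apply: eq_bigr => i _; rewrite mcoeffZ scalerA.
Qed.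

Lemma lcombU i a : lcomb g << a *g i >> = a *: g i.
Proof. by rewrite (lcombw g msuppU_le) big_seq_fset1 mcoeffUU. Qed.

Lemma lcomb0 : lcomb g 0 = 0.
Proof. by rewrite /lcomb msupp0 big_seq_fset0. Qed.

Lemma lcomb_sum (J : Type) (r : seq J) (Q : pred J) (F : J -> {malg A[I]}) :
  lcomb g (\sum_(j <- r | Q j) F j) = \sum_(j <- r | Q j) lcomb g (F j).
Proof. exact: (big_morph _ lcombD lcomb0). Qed.

End Lcomb.

Hypothesis hf : is_free_basis f.

Definition bcoord u : {malg A[I]} := projT1 (cid (hf u)).

Lemma bcoordK u : lcomb f (bcoord u) = u.
Proof. by rewrite /bcoord; case: cid => c /= [->]. Qed.

Lemma lcomb_bcoord c : bcoord (lcomb f c) = c.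
Proof. by rewrite /bcoord; case: cid => d /= [E]; apply. Qed.

Definition cf i u : A := (bcoord u)@_i.

Lemma bcoordD u w : bcoord (u + w) = bcoord u + bcoord w.
Proof. by rewrite -{1}(bcoordK u) -{1}(bcoordK w) -lcombD lcomb_bcoord. Qed.

Lemma bcoordZ a u : bcoord (a *: u) = a *: bcoord u.
Proof. by rewrite -{1}(bcoordK u) -lcombZ lcomb_bcoord. Qed.

Lemma bcoord_basis i : bcoord (f i) = << 1 *g i >>.
Proof. by rewrite -[f i]scale1r -lcombU lcomb_bcoord. Qed.

Lemma cfD i u w : cf i (u + w) = cf i u + cf i w.
Proof. by rewrite /cf bcoordD mcoeffD. Qed.

Lemma cfZ i a u : cf i (a *: u) = a * cf i u.
Proof. by rewrite /cf bcoordZ mcoeffZ. Qed.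

Lemma cf0 i : cf i 0 = 0.
Proof. by rewrite -(scale0r 0) cfZ mul0r. Qed.

Lemma cfN i u : cf i (- u) = - cf i u.
Proof. by rewrite -scaleN1r cfZ mulN1r. Qed.

Lemma cf_basis i j : cf i (f j) = (j == i)%:R.
Proof. by rewrite /cf bcoord_basis mcoeffU. Qed.

Lemma cf_ext u w : (forall i, cf i u = cf i w) -> u = w.
Proof. by move=> h; rewrite -(bcoordK u) -(bcoordK w); congr lcomb; apply/malgP. Qed.

Lemma cf_expand u : u = \sum_(i <- msupp (bcoord u)) cf i u *: f i.
Proof. by rewrite -{1}(bcoordK u). Qed.

Lemma basis_ind (Q : M -> Prop) : Q 0 -> (forall u w, Q u -> Q w -> Q (u + w)) ->
  (forall a u, Q u -> Q (a *: u)) -> (forall i, Q (f i)) -> forall u, Q u.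
Proof.
by move=> Q0 QD QZ Qf u; rewrite (cf_expand u); apply: big_ind => // i _; apply: QZ.
Qed.

Definition fext (N : lmodType A) (g : I -> N) u : N := lcomb g (bcoord u).

Lemma fextD (N : lmodType A) (g : I -> N) u w : fext g (u + w) = fext g u + fext g w.
Proof. by rewrite /fext bcoordD lcombD. Qed.

Lemma fextZ (N : lmodType A) (g : I -> N) a u : fext g (a *: u) = a *: fext g u.
Proof. by rewrite /fext bcoordZ lcombZ. Qed.

Lemma fext_basis (N : lmodType A) (g : I -> N) i : fext g (f i) = g i.
Proof. by rewrite /fext bcoord_basis lcombU scale1r. Qed.

End FreeBasis.

(** * The Hecke algebra and its bar involution *)

Section Hecke.
Variables (C : comNzRingType) (l : nat).
Local Notation A := (laurent C).
Local Notation v := (vpow C).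
Variables (H : algType A) (TH : affS l -> H) (hH : is_iwahori_hecke TH).
Implicit Types (w x y t om : affS l) (u z : 'S_l) (g h : H) (a p : A).

(* With this normalization, [(Hn s - v^-1) (Hn s + v) = 0]. *)
Definition Hn w : H := locked (fun w => v (len w)%:Z *: TH w) w.

Lemma HnE w : Hn w = v (len w)%:Z *: TH w.
Proof. by rewrite /Hn -lock. Qed.

Lemma Hn1 : Hn 1%g = 1.
Proof. by rewrite !HnE len1 vpow0 scale1r (ih_one hH). Qed.

Lemma HnM x y : len (x * y)%g = (len x + len y)%N -> Hn x * Hn y = Hn (x * y)%g.
Proof.
move=> E; rewrite !HnE -scalerAl -scalerAr scalerA -vpowD (ih_mul hH E) E.
by congr (v _ *: _).
Qed.

Definition qz : A := v (-1) - v 1.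

Lemma qzE : qz = v (-1) - v 1. Proof. by []. Qed.

Lemma Hn_quad t : simple_refl t -> Hn t * Hn t = 1 + qz *: Hn t.
Proof.
move=> st; have lt1 : len t = 1%N.
  have := len_simple 1%g st; rewrite mul1g len1.
  by case=> //.
have := ih_quad hH st; rewrite mulrDl mul1r mulrBr -scalerAr mulr1; set q := v (-2) => E.
have {E} : TH t * TH t = q%:A + (q *: TH t - TH t).
  rewrite -[RHS]add0r -E -!addrA [_ + (q%:A + _)]addrA addNr add0r.
  by rewrite [TH t + _]addrC subrK addNr addr0.
rewrite !HnE lt1 -scalerAl -scalerAr => ->.
rewrite !scalerDr !scalerN !scalerA /qz mulrBl scalerBl -!vpowD.
by rewrite scale1r addrA.
Qed.
End Hecke.

Local Opaque laurent_mul lbar vpow fgadd fgopp fgzero.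

Lemma sg_aux (R : comNzRingType) (s d p q : R) :
  s * (p + - d * q) = - (- s * p + d * (s * q)).
Proof. ring. Qed.

Section HeckeBar.
Variables (C : comNzRingType) (l : nat).
Local Notation A := (laurent C).
Local Notation v := (vpow C).
Local Notation qz := (qz C).
Variables (H : algType A) (TH : affS l -> H) (hH : is_iwahori_hecke TH).
Local Notation Hn := (Hn TH).
Implicit Types (w x y t om : affS l) (u z : 'S_l) (g h : H) (a p : A).

Lemma TH_Hn w : TH w = v (- (len w)%:Z) *: Hn w.
Proof. by rewrite HnE scalerA vpowVl scale1r. Qed.

Definition ch y h : A :=
  locked (fun y h => v (- (len y)%:Z) * cf (ih_basis hH) y h) y h.

Lemma chE y h : ch y h = v (- (len y)%:Z) * cf (ih_basis hH) y h.
Proof. by rewrite /ch -lock. Qed.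

Lemma chD y g h : ch y (g + h) = ch y g + ch y h.
Proof. by rewrite !chE cfD mulrDr. Qed.

Lemma chZ y a h : ch y (a *: h) = a * ch y h.
Proof. by rewrite !chE cfZ mulrCA. Qed.

Lemma ch0 y : ch y 0 = 0.
Proof. by rewrite chE cf0 mulr0. Qed.

Lemma chN y h : ch y (- h) = - ch y h.
Proof. by rewrite !chE cfN mulrN. Qed.

Lemma ch_sum (J : Type) (r : seq J) (Q : pred J) (F : J -> H) y :
  ch y (\sum_(j <- r | Q j) F j) = \sum_(j <- r | Q j) ch y (F j).
Proof. exact: (big_morph _ (chD y) (ch0 y)). Qed.

Lemma ch_Hn y x : ch y (Hn x) = (x == y)%:R.
Proof.
rewrite chE HnE cfZ cf_basis; case: eqVneq => [->|_]; last by rewrite !mulr0.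
by rewrite mulr1 vpowVl.
Qed.

Lemma ch_ext g h : (forall y, ch y g = ch y h) -> g = h.
Proof.
move=> E; apply: (cf_ext (hf := ih_basis hH)) => y.
have := congr1 (fun p => v (len y)%:Z * p) (E y).
by rewrite !chE !mulrA vpowVr !mul1r.
Qed.

Lemma ch_expand h :
  h = \sum_(y <- msupp (bcoord (ih_basis hH) h)) ch y h *: Hn y.
Proof.
rewrite {1}(cf_expand (ih_basis hH) h); apply: eq_bigr => y _.
by rewrite chE HnE scalerA mulrAC vpowVl mul1r.
Qed.

Lemma ch_supp y h : ch y h != 0 -> y \in msupp (bcoord (ih_basis hH) h).
Proof.
rewrite -mcoeff_neq0; apply: contraNneq => E.
by rewrite chE /cf E mulr0.
Qed.

Lemma Hn_ind (Q : H -> Prop) : Q 0 -> (forall g h, Q g -> Q h -> Q (g + h)) ->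
  (forall a h, Q h -> Q (a *: h)) -> (forall w, Q (Hn w)) -> forall h, Q h.
Proof.
by move=> Q0 QD QZ Qf h; rewrite (ch_expand h); apply: big_ind => // w _; apply: QZ.
Qed.

Lemma ex_top h : h <> 0 ->
  exists y, ch y h != 0 /\ forall x, ch x h != 0 -> (len x <= len y)%N.
Proof.
move=> h0; set S := msupp (bcoord (ih_basis hH) h).
have [y0 y0h] : exists y, ch y h != 0.
  apply: contrapT => /forallNP hn; apply: h0; apply: ch_ext => y; rewrite ch0.
  by apply/eqP; apply: contrapT => /negP/hn.
have [y yh ymax] : exists2 y, ch y h != 0 & forall x, x \in enum_fset S ->
    ch x h != 0 -> (len x <= len y)%N.
  elim: (enum_fset S) => [|a s [y yh ymax]]; first by exists y0.
  have [ah|ah] := eqVneq (ch a h) 0.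
    exists y => // x; rewrite inE => /predU1P[->|/ymax //]; by rewrite ah eqxx.
  have [ay|ya] := leqP (len a) (len y).
    by exists y => // x; rewrite inE => /predU1P[->|/ymax //].
  exists a => // x; rewrite inE => /predU1P[->|/ymax xy /xy] //; lia.
by exists y; split=> // x xh; apply: ymax => //; apply: ch_supp.
Qed.

Lemma len_simple1 t : simple_refl t -> len t = 1%N.
Proof. by move=> st; have := len_simple 1%g st; rewrite mul1g len1; case. Qed.

Definition dr t w : A := if (len (w * t)%g < len w)%N then qz else 0.
Definition dl t w : A := if (len (t * w)%g < len w)%N then qz else 0.

Lemma Hn_asc w t : simple_refl t -> len (w * t)%g = (len w).+1 -> Hn w * Hn t = Hn (w * t)%g.
Proof. by move=> st E; apply: HnM => //; rewrite E (len_simple1 st) addn1. Qed.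

Lemma Hn_ascL w t : simple_refl t -> len (t * w)%g = (len w).+1 -> Hn t * Hn w = Hn (t * w)%g.
Proof. by move=> st E; apply: (HnM hH); rewrite E (len_simple1 st). Qed.

Lemma HnS w t : simple_refl t -> Hn w * Hn t = Hn (w * t)%g + dr t w *: Hn w.
Proof.
move=> st; rewrite /dr; case: (len_simple w st) => E.
  by rewrite E ltnNge leqnSn /= scale0r addr0 Hn_asc.
rewrite E leqnn.
have wE : w = (w * t * t)%g by rewrite -mulgA simple_sq ?mulg1.
have -> : Hn w = Hn (w * t)%g * Hn t by rewrite Hn_asc -?wE.
by rewrite -mulrA (Hn_quad hH st) mulrDr mulr1 -scalerAr.
Qed.

Lemma HnSL w t : simple_refl t -> Hn t * Hn w = Hn (t * w)%g + dl t w *: Hn w.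
Proof.
move=> st; rewrite /dl; case: (len_simpleL w st) => E.
  by rewrite E ltnNge leqnSn /= scale0r addr0 Hn_ascL.
rewrite E leqnn.
have wE : w = (t * (t * w))%g by rewrite mulgA simple_sq ?mul1g.
have -> : Hn w = Hn t * Hn (t * w)%g by rewrite Hn_ascL -?wE.
by rewrite mulrA (Hn_quad hH st) mulrDl mul1r -scalerAl.
Qed.

Lemma ch_mulS y h t : simple_refl t ->
  ch y (h * Hn t) = ch (y * t)%g h + dr t y * ch y h.
Proof.
move=> st; elim/Hn_ind: h => [|g h IHg IHh|a h IH|w].
- by rewrite mul0r !ch0 mulr0 addr0.
- by rewrite mulrDl !chD IHg IHh mulrDr addrACA.
- by rewrite -scalerAl !(chZ _ a) IH; ring.
rewrite HnS // chD chZ !ch_Hn.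
have -> : ((w * t)%g == y) = (w == (y * t)%g).
  by apply/eqP/eqP => [<-|->]; rewrite -mulgA simple_sq ?mulg1.
by case: (eqVneq w y) => [->//|_]; rewrite !mulr0.
Qed.

Lemma ch_mulSL y h t : simple_refl t ->
  ch y (Hn t * h) = ch (t * y)%g h + dl t y * ch y h.
Proof.
move=> st; elim/Hn_ind: h => [|g h IHg IHh|a h IH|w].
- by rewrite mulr0 !ch0 mulr0 addr0.
- by rewrite mulrDr !chD IHg IHh mulrDr addrACA.
- by rewrite -scalerAr !(chZ _ a) IH; ring.
rewrite HnSL // chD chZ !ch_Hn.
have -> : ((t * w)%g == y) = (w == (t * y)%g).
  by apply/eqP/eqP => [<-|->]; rewrite mulgA simple_sq ?mul1g.
by case: (eqVneq w y) => [->//|_]; rewrite !mulr0.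
Qed.

Lemma HnM0 w om : length0 om -> Hn w * Hn om = Hn (w * om)%g.
Proof. by move=> h; apply: HnM => //; rewrite lenM0 // (length0E om).1 ?addn0. Qed.

Lemma lbar_qz : lbar qz = - qz.
Proof. by rewrite /qz lbarD lbarN !lbar_vpow opprB opprK. Qed.

Section Bar.
Variables (b : H -> H) (hb : is_hecke_bar TH b).

Lemma bD g h : b (g + h) = b g + b h. Proof. exact: (hb_add hb). Qed.
Lemma bZ a h : b (a *: h) = lbar a *: b h. Proof. exact: (hb_scale hb). Qed.
Lemma b0 : b 0 = 0. Proof. by have := bZ 0 0; rewrite lbar0 !scale0r. Qed.
Lemma bN h : b (- h) = - b h. Proof. by rewrite -scaleN1r bZ lbarN lbar1 scaleN1r. Qed.
Lemma b_sum (J : Type) (r : seq J) (Q : pred J) (F : J -> H) :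
  b (\sum_(j <- r | Q j) F j) = \sum_(j <- r | Q j) b (F j).
Proof. exact: (big_morph _ bD b0). Qed.

Lemma bHnV w : b (Hn w) * Hn (w^-1)%g = 1.
Proof.
rewrite !HnE bZ lbar_vpow len_inv -scalerAl -scalerAr scalerA vpowVl scale1r.
by have [] := hb_T hb w.
Qed.

Lemma HnVb w : Hn (w^-1)%g * b (Hn w) = 1.
Proof.
rewrite !HnE bZ lbar_vpow len_inv -scalerAl -scalerAr scalerA vpowVr scale1r.
by have [] := hb_T hb w.
Qed.

Lemma bHn_eq w g : g * Hn (w^-1)%g = 1 -> b (Hn w) = g.
Proof. by move=> E; rewrite -[LHS]mul1r -E -mulrA HnVb mulr1. Qed.

Lemma bHn_simple t : simple_refl t -> b (Hn t) = Hn t - qz%:A.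
Proof.
move=> st; apply: bHn_eq; rewrite (simpleV st) mulrBl (Hn_quad hH st).
by rewrite -scalerAl mul1r addrK.
Qed.

Lemma bHn_length0 om : length0 om -> b (Hn om) = Hn om.
Proof. by move=> h; apply: bHn_eq; rewrite HnM0 ?mulgV ?(Hn1 hH) //; apply: length0V. Qed.

Lemma bHnM x y : len (x * y)%g = (len x + len y)%N ->
  b (Hn (x * y)%g) = b (Hn x) * b (Hn y).
Proof.
move=> E; apply: bHn_eq; rewrite invMg -(HnM hH); last by rewrite -invMg !len_inv E addnC.
by rewrite mulrA -(mulrA (b (Hn x))) bHnV mulr1 bHnV.
Qed.

Lemma b_mulS h t : simple_refl t -> b (h * Hn t) = b h * b (Hn t).
Proof.
move=> st; have lt := len_simple1 st; elim/Hn_ind: h => [|g h IHg IHh|a h IH|w].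
- by rewrite mul0r b0 mul0r.
- by rewrite mulrDl !bD IHg IHh mulrDl.
- by rewrite -scalerAl !bZ IH -scalerAl.
case: (len_simple w st) => E.
  have L : len (w * t)%g = (len w + len t)%N by rewrite E lt addn1.
  by rewrite Hn_asc // bHnM.
have wE : w = (w * t * t)%g by rewrite -mulgA simple_sq ?mulg1.
rewrite HnS // /dr {1}E leqnn bD bZ lbar_qz.
have -> : b (Hn w) = b (Hn (w * t)%g) * b (Hn t).
  have L : len (w * t * t)%g = (len (w * t)%g + len t)%N by rewrite -wE lt addn1.
  by rewrite {1}wE bHnM.
have sq : b (Hn t) * b (Hn t) = 1 - qz *: b (Hn t).
  rewrite (bHn_simple st) mulrBl [Hn t * _]mulrBr (Hn_quad hH st) -scalerAr mulr1 addrK.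
  by rewrite -scalerAl mul1r.
by rewrite -mulrA sq mulrBr mulr1 -scalerAr scaleNr.
Qed.

Lemma bM g h : b (g * h) = b g * b h.
Proof.
elim/Hn_ind: h => [|h1 h2 IH1 IH2|a h IH|w].
- by rewrite mulr0 b0 mulr0.
- by rewrite mulrDr !bD IH1 IH2 mulrDr.
- by rewrite -scalerAr !bZ IH -scalerAr.
elim/affS_ind: w => [om hom|w t st E IH].
  elim/Hn_ind: g => [|h1 h2 IH1 IH2|a h IH|w].
  - by rewrite mul0r b0 mul0r.
  - by rewrite mulrDl !bD IH1 IH2 mulrDl.
  - by rewrite -scalerAl !bZ IH -scalerAl.
  have L : len (w * om)%g = (len w + len om)%N by rewrite lenM0 // (length0E om).1 ?addn0.
  by rewrite HnM0 // bHnM.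
by rewrite -Hn_asc // mulrA b_mulS // IH -mulrA -b_mulS.
Qed.

Lemma ch_bHn y w : (len w <= len y)%N -> ch y (b (Hn w)) = (w == y)%:R.
Proof.
elim/affS_ind: w y => [om hom|w t st E IH] y; first by rewrite bHn_length0 // ch_Hn.
rewrite E => wy; rewrite -Hn_asc // bM (bHn_simple st) mulrBr -scalerAr mulr1.
rewrite chD chN chZ ch_mulS // (IH y) ?(ltnW wy) //.
have -> : (w == y) = false by apply/eqP => E'; rewrite E' ltnn in wy.
rewrite !mulr0 oppr0 !addr0.
case: (len_simple y st) => Ey.
  rewrite IH; last by rewrite Ey; lia.
  have -> : (w == (y * t)%g) = false by apply/eqP => E'; rewrite E' Ey in wy; lia.
  by case: eqVneq => // E'; move: Ey; rewrite -E' -mulgA simple_sq ?mulg1 // E; lia.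
rewrite IH; last by lia.
have -> // : (w == (y * t)%g) = ((w * t)%g == y).
by apply/eqP/eqP => [->|<-]; rewrite -mulgA simple_sq ?mulg1.
Qed.

Lemma ch_bar y h : (forall x, ch x h != 0 -> (len x <= len y)%N) ->
  ch y (b h) = lbar (ch y h).
Proof.
move=> top; rewrite {1}(ch_expand h) b_sum ch_sum.
rewrite [in RHS](ch_expand h) [in RHS]ch_sum lbar_sum; apply: eq_bigr => x _.
rewrite bZ !chZ lbarM; have [->|/top le] := eqVneq (ch x h) 0; first by rewrite lbar0 !mul0r.
by rewrite (ch_bHn le) ch_Hn lbar_bool.
Qed.

(* The semilinear automorphism [Hn y |-> (-1)^(len y) Hn y], which exchanges the
   two Kazhdan-Lusztig bases up to sign. *)
Definition sg h : H := locked (fun h => \sum_(y <- msupp (bcoord (ih_basis hH) h))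
  ((-1) ^+ len y * lbar (ch y h)) *: Hn y) h.

Lemma ch_sg y h : ch y (sg h) = (-1) ^+ len y * lbar (ch y h).
Proof.
rewrite /sg -lock ch_sum; have [yS|yS] := boolP (y \in msupp (bcoord (ih_basis hH) h)).
  rewrite (big_fsetD1 y) //= chZ ch_Hn eqxx mulr1 big1_fset ?addr0 // => x.
  by rewrite !inE => /andP[/negPf xy _] _; rewrite chZ ch_Hn xy mulr0.
have -> : ch y h = 0 by apply/eqP; apply: contraNT yS => /ch_supp.
rewrite lbar0 mulr0 big_seq big1 // => x xS; rewrite chZ ch_Hn.
by case: eqVneq => [E|_]; rewrite ?mulr0 //; move: yS; rewrite -E xS.
Qed.

Lemma sgD g h : sg (g + h) = sg g + sg h.
Proof.
by apply: ch_ext => y; rewrite chD (ch_sg y g) (ch_sg y h) (ch_sg y (g + h)) chD lbarD mulrDr.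
Qed.

Lemma sgZ a h : sg (a *: h) = lbar a *: sg h.
Proof.
apply: ch_ext => y; rewrite chZ (ch_sg y h) (ch_sg y (a *: h)) chZ lbarM.
exact: mulrCA.
 Qed.

Lemma sg0 : sg 0 = 0.
Proof. by have := sgZ 0 0; rewrite lbar0 !scale0r. Qed.

Lemma sgN h : sg (- h) = - sg h.
Proof. by rewrite -scaleN1r sgZ lbarN lbar1 scaleN1r. Qed.

Lemma sg_Hn w : sg (Hn w) = (-1) ^+ len w *: Hn w.
Proof.
apply: ch_ext => y; rewrite ch_sg chZ ch_Hn lbar_bool.
by case: eqVneq => [->|_] //; rewrite !mulr0.
Qed.

Lemma sg_mulS h t : simple_refl t -> sg (h * Hn t) = - (sg h * Hn t).
Proof.
move=> st; apply: ch_ext => y; rewrite chN (ch_sg y (h * Hn t)) !(ch_mulS _ _ st).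
rewrite (ch_sg y h) (ch_sg (y * t)%g h) lbarD lbarM.
have -> : lbar (dr t y) = - dr t y.
  by rewrite /dr; case: ifP => _; rewrite ?lbar_qz // lbar0 oppr0.
have -> : (-1) ^+ len (y * t)%g = - (-1) ^+ len y :> A.
  by case: (len_simple y st) => [->|E]; rewrite ?exprS ?mulN1r //; rewrite E exprS mulN1r opprK.
exact: sg_aux.
Qed.

Lemma b_sg h : b (sg h) = sg (b h).
Proof.
elim/Hn_ind: h => [|h1 h2 IH1 IH2|a h IH|w].
- by rewrite sg0 b0 sg0.
- by rewrite sgD !bD IH1 IH2 sgD.
- by rewrite sgZ !bZ IH sgZ.
rewrite sg_Hn bZ lbar_sign.
elim/affS_ind: w => [om hom|w t st E IH].
  by rewrite bHn_length0 // sg_Hn.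
rewrite -Hn_asc // bM (bHn_simple st) mulrBr -scalerAr mulr1 sgD sg_mulS // sgN sgZ lbar_qz.
by rewrite scaleNr opprK -IH E exprS mulN1r scaleNr scalerBr -scalerAl opprB addrC scalerA mulrC -scalerA.
Qed.

End Bar.
End HeckeBar.

Section Parab.
Variables (C : comNzRingType) (l : nat).
Local Notation A := (laurent C).
Local Notation v := (vpow C).
Local Notation qz := (qz C).
Variables (H : algType A) (TH : affS l -> H) (hH : is_iwahori_hecke TH).
Local Notation Hn := (Hn TH).
Local Notation ch := (ch hH).
Implicit Types (w x y t om : affS l) (u z : 'S_l) (g h : H) (a p : A).

Section Stab.
Variables (i : Zl l) (hi : weakly_inc i).

Lemma Hn_fin_asc u (j k : 'I_l) : k = j.+1 :> nat ->
  len (fin_aff (u * tperm j k)%g) = (len (fin_aff u)).+1 ->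
  Hn (fin_aff (u * tperm j k)%g) = Hn (fin_aff u) * Hn (fin_aff (tperm j k)).
Proof.
by move=> kj; rewrite fin_affM => E; rewrite (Hn_asc hH (simple_fin kj) E).
Qed.

Lemma eigen_right (c : A) h :
  (forall j k : 'I_l, k = j.+1 :> nat -> i j = i k ->
     h * Hn (fin_aff (tperm j k)) = c *: h) ->
  forall u, place_perm i u = i -> h * Hn (fin_aff u) = c ^+ len (fin_aff u) *: h.
Proof.
move=> hs; apply: (parabolic_ind hi) => [|u j k kj ij su E IH].
  by rewrite fin_aff1 len1 (Hn1 hH) mulr1 scale1r.
by rewrite E (Hn_fin_asc kj E) mulrA IH -scalerAl hs // scalerA exprSr.
Qed.

Lemma eigen_left (c : A) h :
  (forall j k : 'I_l, k = j.+1 :> nat -> i j = i k ->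
     Hn (fin_aff (tperm j k)) * h = c *: h) ->
  forall u, place_perm i u = i -> Hn (fin_aff u) * h = c ^+ len (fin_aff u) *: h.
Proof.
move=> hs; apply: (parabolic_ind hi) => [|u j k kj ij su E IH].
  by rewrite fin_aff1 len1 (Hn1 hH) mul1r scale1r.
by rewrite E (Hn_fin_asc kj E) -mulrA hs // -scalerAr IH scalerA exprS.
Qed.

Lemma ch_stab_mul y :
  (forall j k : 'I_l, k = j.+1 :> nat -> i j = i k -> hat (y^-1)%g j < hat (y^-1)%g k) ->
  forall u, place_perm i u = i ->
  forall h, ch y (Hn (fin_aff u) * h) = ch ((fin_aff u)^-1 * y)%g h.
Proof.
move=> hy; apply: (parabolic_ind hi) => [|u j k kj ij su E IH] h.
  by rewrite fin_aff1 (Hn1 hH) mul1r invg1 mul1g.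
have st := simple_fin kj.
rewrite (Hn_fin_asc kj E) -mulrA IH (ch_mulSL hH _ _ st) fin_affM invMg (simpleV st) -mulgA.
have su' : place_perm i (u * tperm j k)%g = i.
  by rewrite place_permM su place_perm_tperm.
have := len_stab_mul hi (place_permV su') hy; have := len_stab_mul hi (place_permV su) hy.
rewrite !fin_affV !len_inv E fin_affM invMg (simpleV st) -mulgA => E1 E2.
by rewrite /dl E2 E1 ltnNge leq_add2r leqnSn mul0r addr0.
Qed.

Variables (c c' : A).
Hypothesis (cc' : c * c' = 1) (cq : c - c' = qz).

Definition par_sum : H :=
  \sum_(u : 'S_l | place_perm i u == i) c ^+ len (fin_aff u) *: Hn (fin_aff u).

Definition stabb w := (w.2 == 0) && (place_perm i w.1 == i).

Lemma stabbP w : reflect (exists2 u, place_perm i u = i & w = fin_aff u) (stabb w).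
Proof.
apply: (iffP andP) => [[/eqP E /eqP su]|[u su ->]]; last by rewrite eqxx su eqxx.
by exists w.1 => //; rewrite /fin_aff -E -surjective_pairing.
Qed.

Lemma ch_par_sum y : ch y par_sum = if stabb y then c ^+ len y else 0.
Proof.
rewrite /par_sum ch_sum; under eq_bigr => u _ do rewrite chZ ch_Hn.
case: stabbP => [[u su ->]|ns].
  rewrite (bigD1 u) /= ?su // !eqxx mulr1 big1 ?addr0 // => u' /andP[_ u'u].
  case: eqP => [[E]|_]; last by rewrite mulr0.
  by rewrite E eqxx in u'u.
rewrite big1 // => u /eqP su; case: eqP => [E|_]; last by rewrite mulr0.
by case: ns; exists u.
Qed.

Lemma c_sq : c * c = 1 + qz * c.
Proof. by rewrite -cq mulrBl [c' * _]mulrC cc' addrCA subrr addr0. Qed.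

Lemma par_sum_aux n : c ^+ n + qz * c ^+ n.+1 = c * c ^+ n.+1.
Proof. by rewrite exprS [RHS]mulrA c_sq [RHS]mulrDl mul1r mulrA. Qed.

Lemma par_sum_right (j k : 'I_l) : k = j.+1 :> nat -> i j = i k ->
  par_sum * Hn (fin_aff (tperm j k)) = c *: par_sum.
Proof.
move=> kj ij; have st := simple_fin kj; apply: (ch_ext (hH := hH)) => y.
rewrite (ch_mulS hH _ _ st) chZ !ch_par_sum.
have -> : stabb (y * fin_aff (tperm j k))%g = stabb y.
  have imp w : stabb w -> stabb (w * fin_aff (tperm j k))%g.
    move=> /stabbP[u su ->]; apply/stabbP; exists (u * tperm j k)%g; last by rewrite fin_affM.
    by rewrite place_permM su place_perm_tperm.
  apply/idP/idP => /imp //; by rewrite -mulgA simple_sq ?mulg1.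
case: ifP => _; last by rewrite !mulr0 addr0.
rewrite /dr; case: (len_simple y st) => E.
  by rewrite E ltnNge leqnSn mul0r addr0 exprS.
by rewrite E ltnSn par_sum_aux.
Qed.

Lemma par_sum_left (j k : 'I_l) : k = j.+1 :> nat -> i j = i k ->
  Hn (fin_aff (tperm j k)) * par_sum = c *: par_sum.
Proof.
move=> kj ij; have st := simple_fin kj; apply: (ch_ext (hH := hH)) => y.
rewrite (ch_mulSL hH _ _ st) chZ !ch_par_sum.
have -> : stabb (fin_aff (tperm j k) * y)%g = stabb y.
  have imp w : stabb w -> stabb (fin_aff (tperm j k) * w)%g.
    move=> /stabbP[u su ->]; apply/stabbP; exists (tperm j k * u)%g; last by rewrite fin_affM.
    by rewrite place_permM place_perm_tperm.
  apply/idP/idP => /imp //; by rewrite mulgA simple_sq ?mul1g.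
case: ifP => _; last by rewrite !mulr0 addr0.
rewrite /dl; case: (len_simpleL y st) => E.
  by rewrite E ltnNge leqnSn mul0r addr0 exprS.
by rewrite E ltnSn par_sum_aux.
Qed.

Variable u0 : 'S_l.
Hypothesis (su0 : place_perm i u0 = i)
  (du0 : forall a b : 'I_l, (a < b)%N -> i a = i b -> (u0 b < u0 a)%N).

Lemma len_u0 u : place_perm i u = i ->
  len (fin_aff u0) = (len (fin_aff (u * u0)%g) + len (fin_aff u))%N.
Proof. by move=> su; rewrite (len_stab_sub hi su du0). Qed.

Section Bar.
Variables (b : H -> H) (hb : is_hecke_bar TH b).
Hypothesis (bc : lbar c = c').

Lemma bHn_cancel x y : len y = (len x + len (x * y)%g)%N ->
  b (Hn x) * Hn y = Hn (x * y)%g.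
Proof.
move=> E; have <- : Hn (x^-1)%g * Hn (x * y)%g = Hn y.
  by rewrite (HnM hH) mulKg // len_inv.
by rewrite mulrA (bHnV hb) mul1r.
Qed.

Lemma bar_par_sum : b par_sum = c' ^+ (2 * len (fin_aff u0)) *: par_sum.
Proof.
set L := len (fin_aff u0).
have E1 : b par_sum * Hn (fin_aff u0) = c' ^+ L *: par_sum.
  rewrite /par_sum (b_sum hb) mulr_suml scaler_sumr.
  rewrite [RHS](reindex_inj (mulIg u0)) /=; apply: eq_big => [u|u /eqP su].
    apply/eqP/eqP => [su|su]; first by rewrite place_permM su.
    by rewrite -[u](mulgK u0) place_permM su place_permV.
  have lu := len_u0 su.
  rewrite (bZ hb) lbarX bc -scalerAl bHn_cancel -fin_affM; last by rewrite lu addnC.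
  rewrite scalerA /L lu exprD; congr (_ *: _).
  by rewrite mulrAC -exprMn [c' * c]mulrC cc' expr1n mul1r.
have E2 : par_sum * Hn (fin_aff u0) = c ^+ L *: par_sum.
  by apply: eigen_right => // j k; apply: par_sum_right.
have {}E2 : par_sum = c' ^+ L *: (par_sum * Hn (fin_aff u0)).
  by rewrite E2 scalerA -exprMn [c' * c]mulrC cc' expr1n scale1r.
have inv : Hn (fin_aff u0) * b (Hn (fin_aff u0^-1)%g) = 1.
  have {1}-> : fin_aff u0 = (fin_aff (u0^-1)%g)^-1%g by rewrite -fin_affV invgK.
  exact: HnVb.
rewrite -[LHS]mulr1 -inv mulrA E1 {1}E2 -!scalerAl -mulrA inv mulr1.
by rewrite scalerA -exprD mul2n -addnn.
Qed.
End Bar.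
End Stab.

Lemma ex_u0 (i : Zl l) : weakly_inc i -> exists2 u0 : 'S_l, place_perm i u0 = i &
  forall a b : 'I_l, (a < b)%N -> i a = i b -> (u0 b < u0 a)%N.
Proof.
move=> hi; pose S := [pred u : 'S_l | place_perm i u == i].
have S1 : S 1%g by rewrite /= place_perm1.
case: (@arg_maxnP _ 1%g S (fun u => len (fin_aff u)) S1) => u /eqP su umax.
exists u => // a b ab iab.
suff : - ((u a : nat)%:Z) < - ((u b : nat)%:Z) by lia.
apply: (block_chain hi (f := fun r => - ((u r : nat)%:Z))) ab iab => j k kj ij.
have := len_fin_simple (fin_aff u)^-1%g kj; rewrite -fin_affV !hat_fin1 invgK.
case: ifP => [h E|h _]; last first.
  have : u j != u k by rewrite (inj_eq perm_inj) -val_eqE /= kj; lia.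
  by rewrite -val_eqE /=; lia.
have := umax (tperm j k * u)%g.
rewrite /= place_permM (place_perm_tperm ij) su eqxx => /(_ isT).
rewrite -len_inv -fin_affV invMg tpermV fin_affM E fin_affV len_inv /=; lia.
Qed.

Lemma ninv_u0 (i : Zl l) u0 : weakly_inc i -> place_perm i u0 = i ->
  (forall a b : 'I_l, (a < b)%N -> i a = i b -> (u0 b < u0 a)%N) ->
  len (fin_aff u0) = (\sum_(p : 'I_l * 'I_l | (p.1 < p.2)%N) (i p.1 == i p.2))%N.
Proof.
move=> hi su du; rewrite lenE alen_fin /ninv; apply: eq_bigr => -[a b] /= ab.
congr (nat_of_bool _); apply/idP/eqP => [|/du -> //]; exact: stab_inv.
Qed.

End Parab.

Lemma upper_aux (R : comNzRingType) (U V p q : R) :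
  V * U = 1 -> p - V * q = - V * (q - U * p).
Proof. by move=> E; rewrite mulrBr mulrA !mulNr E mul1r opprK addrC. Qed.

(** * Kazhdan-Lusztig elements *)

Section KL.
Variables (C : comNzRingType) (l : nat).
Local Notation A := (laurent C).
Local Notation v := (vpow C).
Local Notation qz := (qz C).
Variables (H : algType A) (TH : affS l -> H) (hH : is_iwahori_hecke TH).
Local Notation Hn := (Hn TH).
Local Notation ch := (ch hH).
Implicit Types (w x y t om : affS l) (u z : 'S_l) (g h : H) (a p : A).

Lemma weakly_inc0 : weakly_inc (0 : Zl l).
Proof. by move=> j k _; rewrite !ffunE. Qed.

Lemma place_perm0 u : place_perm (0 : Zl l) u = 0.
Proof. by apply/ffunP => k; rewrite !ffunE. Qed.

Lemma len_mul_inc y u : (forall j k : 'I_l, k = j.+1 :> nat -> hat y j < hat y k) ->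
  len (y * fin_aff u)%g = (len y + len (fin_aff u))%N.
Proof.
move=> hy; apply: len_finM => a b ab _; apply: (block_chain weakly_inc0) => // [j k kj _|]; first exact: hy.
by rewrite !ffunE.
Qed.

Lemma ch_mul_inc y : (forall j k : 'I_l, k = j.+1 :> nat -> hat y j < hat y k) ->
  forall u h, ch y (h * Hn (fin_aff u)) = ch (y * (fin_aff u)^-1)%g h.
Proof.
move=> hy u.
suff Q : forall u', place_perm (0 : Zl l) u' = 0 -> forall h,
    ch y (h * Hn (fin_aff u'^-1%g)) = ch (y * fin_aff u')%g h.
  by move=> h; rewrite -{1}[u]invgK Q ?place_perm0 // fin_affV.
apply: (parabolic_ind weakly_inc0) => [|{}u j k kj ij su E IH] h.
  by rewrite invg1 fin_aff1 (Hn1 hH) mulr1 mulg1.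
have st := simple_fin kj.
have E' : Hn (fin_aff (u * tperm j k)^-1%g) = Hn (fin_aff (tperm j k)) * Hn (fin_aff u^-1%g).
  rewrite invMg tpermV fin_affM (Hn_ascL hH st) // -len_inv invMg (simpleV st).
  by rewrite -!fin_affV invgK -fin_affM E fin_affV len_inv.
rewrite E' mulrA IH (ch_mulS hH _ _ st) fin_affM mulgA /dr.
rewrite -mulgA -fin_affM !len_mul_inc // E.
by rewrite ltnNge leq_add2l leqnSn /= mul0r addr0.
Qed.

Variables (P : affS l -> affS l -> {poly int}).
Hypothesis P1 : forall x, P x x = 1.
Hypothesis P0 : forall y x, ~ bruhat y x -> P y x = 0.
Hypothesis Pdeg : forall y x, bruhat y x -> y <> x ->
  ((size (P y x)).-1.*2 < len x - len y)%N.
Variables (b : H -> H) (hb : is_hecke_bar TH b).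
Local Notation Cp := (kl_elt TH P).
Hypothesis bCp : forall x, b (Cp x) = Cp x.

Lemma at_q0 : at_q C 0 = 0.
Proof. by rewrite /at_q map_poly0 horner0. Qed.

Lemma at_q1 : at_q C 1 = 1.
Proof. by rewrite /at_q rmorph1 hornerC. Qed.

Lemma ch_Cp y x : ch y (Cp x) = v ((len x)%:Z - (len y)%:Z) * at_q C (P y x).
Proof.
rewrite /kl_elt fsbig_finite; last exact: bruhat_finite.
rewrite chZ ch_sum /= vpowD -mulrA; congr (_ * _).
have term w : ch y (at_q C (P w x) *: TH w) = at_q C (P w x) * (v (- (len w)%:Z) * (w == y)%:R).
  by rewrite TH_Hn !chZ ch_Hn.
under eq_bigr => w _ do rewrite term.
have memS w : reflect (bruhat w x) (w \in fset_set [set w | bruhat w x]%classic).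
  rewrite in_fset_set; last exact: bruhat_finite.
  by apply: (iffP idP); rewrite inE.
have [yx|nyx] := pselect (bruhat y x); last first.
  rewrite (P0 nyx) at_q0 mulr0 big_seq big1 // => w /memS wx.
  by case: eqVneq => [E|_]; [case: nyx; rewrite -E|rewrite !mulr0].
rewrite (big_fsetD1 y) /=; last exact/memS.
rewrite eqxx mulr1 mulrC big1_fset ?addr0 // => w.
by rewrite !inE => /andP[/negPf -> _] _; rewrite !mulr0.
Qed.

Lemma ch_Cp_self x : ch x (Cp x) = 1.
Proof. by rewrite ch_Cp subrr vpow0 mul1r P1 at_q1. Qed.

Lemma ch_Cp_vpos y x : y <> x -> vpos (ch y (Cp x)).
Proof.
move=> yx; rewrite ch_Cp; have [le|nle] := pselect (bruhat y x); last first.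
  by rewrite (P0 nle) at_q0 mulr0; apply: (hs0 (half_vpos C)).
have [//|lt] := bruhat_len le.
rewrite (_ : _ - _ = (len x - len y)%N%:Z); last by lia.
by apply: vpos_at_q; apply: Pdeg.
Qed.

(* For a bar invariant [D], e.g. [Cp x * Hn t - v^-1 Cp x] with [f y = y t], the
   coefficients of [D] along the elements lowered by [f] lie in [v C[v]]; the one
   of largest length is moreover bar invariant, hence zero. *)
Lemma bar_descent_eq0 x (f : affS l -> affS l) (D : H) :
  involutive f -> (forall y, len (f y) = (len y).+1 \/ len y = (len (f y)).+1) ->
  (len (f x) < len x)%N -> b D = D ->
  (forall y, ch y D = ch (f y) (Cp x) +
     (if (len (f y) < len y)%N then qz else 0) * ch y (Cp x) - v (-1) * ch y (Cp x)) ->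
  D = 0.
Proof.
move=> ff lf xf bDD chDE; apply: contrapT => D0.
have lowerD y : (len (f y) < len y)%N -> ch y D = ch (f y) (Cp x) - v 1 * ch y (Cp x).
  by move=> yt; rewrite chDE yt qzE mulrBl addrA addrAC addrK.
have upperD y : (len y < len (f y))%N -> ch y D = - v (-1) * ch (f y) D.
  move=> yt; rewrite (lowerD (f y)); last by rewrite ff.
  rewrite chDE ff ltnNge (ltnW yt) mul0r addr0.
  exact: (upper_aux _ _ (vpowVl C 1)).
have [y [yD ytop]] := ex_top hH D0.
have yt : (len (f y) < len y)%N.
  case: (lf y) => E; last by rewrite E.
  have yyt : (len y < len (f y))%N by rewrite E.
  have : ch (f y) D != 0.
    by apply: contraNneq yD => E'; rewrite (upperD _ yyt) E' mulr0.
  by move=> /ytop; rewrite E ltnn.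
move/negP: yD; apply; apply/eqP; apply: (hs_bar (half_vpos C)).
  rewrite lowerD //; apply: (hsD (half_vpos C)).
    by apply: ch_Cp_vpos => E; move: xf; rewrite -E ff; lia.
  apply: (hsN (half_vpos C)); have [->|] := pselect (y = x).
    by rewrite ch_Cp_self mulr1; apply: vpos_vpow.
  by move=> /ch_Cp_vpos h; apply: vpos_vpowM.
by rewrite -(ch_bar hb ytop) bDD.
Qed.

Lemma Cp_right x t : simple_refl t -> (len (x * t)%g < len x)%N ->
  Cp x * Hn t = v (-1) *: Cp x.
Proof.
move=> st xt; apply/eqP; rewrite -subr_eq0; apply/eqP.
apply: (bar_descent_eq0 (x := x) (f := fun y => (y * t)%g)) => // [y|y||y].
- by rewrite -mulgA simple_sq ?mulg1.
- exact: len_simple.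
- rewrite (bD hb) (bN hb) (bZ hb) (bM hH hb) bCp (bHn_simple hH hb st) lbar_vpow.
  by rewrite opprK mulrBr -scalerAr mulr1 -addrA -opprD -scalerDl qzE subrK.
- by rewrite chD chN chZ (ch_mulS hH _ _ st).
Qed.

Lemma Cp_left x t : simple_refl t -> (len (t * x)%g < len x)%N ->
  Hn t * Cp x = v (-1) *: Cp x.
Proof.
move=> st xt; apply/eqP; rewrite -subr_eq0; apply/eqP.
apply: (bar_descent_eq0 (x := x) (f := fun y => (t * y)%g)) => // [y|y||y].
- by rewrite mulgA simple_sq ?mul1g.
- exact: len_simpleL.
- rewrite (bD hb) (bN hb) (bZ hb) (bM hH hb) bCp (bHn_simple hH hb st) lbar_vpow.
  by rewrite opprK mulrBl -scalerAl mul1r -addrA -opprD -scalerDl qzE subrK.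
- by rewrite chD chN chZ (ch_mulSL hH _ _ st).
Qed.

Definition Cm x : H := (-1) ^+ len x *: sg hH (Cp x).

Lemma bCm x : b (Cm x) = Cm x.
Proof. by rewrite /Cm (bZ hb) lbar_sign (b_sg hH hb) bCp. Qed.

Lemma ch_Cm y x : ch y (Cm x) = (-1) ^+ len x * ((-1) ^+ len y * lbar (ch y (Cp x))).
Proof. by rewrite /Cm chZ ch_sg. Qed.

Lemma Cm_right x t : simple_refl t -> (len (x * t)%g < len x)%N ->
  Cm x * Hn t = - v 1 *: Cm x.
Proof.
move=> st xt; rewrite /Cm -scalerAl scalerA mulrC -scalerA; congr (_ *: _).
have := sg_mulS hH (Cp x) st; rewrite (Cp_right st xt) sgZ lbar_vpow opprK => E.
by rewrite scaleNr E opprK.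
Qed.

Lemma ch_Cm_self x : ch x (Cm x) = 1.
Proof. by rewrite ch_Cm ch_Cp_self lbar1 mulr1 -expr2 sqrr_sign. Qed.

Lemma ch_Cm_vneg y x : y <> x -> vneg (ch y (Cm x)).
Proof.
move=> yx; rewrite ch_Cm; apply: (half_sign (half_vneg C)); apply: (half_sign (half_vneg C)).
by apply/lbar_vneg; apply: ch_Cp_vpos.
Qed.

End KL.

(** * The Bernstein presentation *)

Section Bernstein.
Variables (C : comNzRingType) (l : nat).
Local Notation A := (laurent C).
Variables (H : algType A) (TH : affS l -> H) (hH : is_iwahori_hecke TH).
Local Notation Hn := (Hn TH).
Variables (b : H -> H) (hb : is_hecke_bar TH b).
Implicit Types (w x y t : affS l) (u z : 'S_l) (g h : H) (m mu nu lam : Zl l).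

(* [Ei m] is the inverse of [Ed m], since [b (Hn w)] is that of [Hn w^-1]. *)
Definition Ed m : H := Hn (tr m).
Definition Ei m : H := b (Hn (tr (- m))).

Lemma EdK m : Ed m * Ei m = 1.
Proof.
rewrite /Ed /Ei; have {1}-> : tr m = (tr (- m))^-1%g by rewrite trV opprK.
exact: HnVb.
Qed.

Lemma EiK m : Ei m * Ed m = 1.
Proof.
rewrite /Ed /Ei; have {1}-> : tr m = (tr (- m))^-1%g by rewrite trV opprK.
exact: bHnV.
Qed.

Lemma weakly_decD mu nu : weakly_dec mu -> weakly_dec nu -> weakly_dec (mu + nu).
Proof. by move=> h1 h2 j k jk; rewrite !ffunE lerD ?h1 ?h2. Qed.

Lemma weakly_dec0 : weakly_dec (0 : Zl l).
Proof. by move=> j k _; rewrite !ffunE. Qed.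

Lemma EdD mu nu : weakly_dec mu -> weakly_dec nu -> Ed mu * Ed nu = Ed (mu + nu).
Proof. by move=> h1 h2; rewrite /Ed (HnM hH) trD // len_trD. Qed.

Lemma inv_uniq (x y z : H) : x * y = 1 -> y * z = 1 -> x = z.
Proof. by move=> h1 h2; rewrite -[x]mulr1 -h2 mulrA h1 mul1r. Qed.

Lemma EiD mu nu : weakly_dec mu -> weakly_dec nu -> Ei mu * Ei nu = Ei (mu + nu).
Proof.
move=> h1 h2; apply: inv_uniq (EdK (mu + nu)).
by rewrite addrC -EdD // mulrA -(mulrA (Ei mu)) EiK mulr1 EiK.
Qed.

Lemma comm_inv (x y xi : H) : xi * x = 1 -> x * xi = 1 -> x * y = y * x -> xi * y = y * xi.
Proof.
move=> h1 h2 c; rewrite -[LHS]mulr1 -h2 mulrA -(mulrA xi) -c.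
by rewrite (mulrA xi) h1 mul1r.
Qed.

Lemma EiEd mu nu : weakly_dec mu -> weakly_dec nu -> Ei mu * Ed nu = Ed nu * Ei mu.
Proof.
move=> h1 h2; apply: comm_inv (EiK mu) (EdK mu) _.
by rewrite !EdD // addrC.
Qed.

Definition dom_shift lam : Zl l :=
  [ffun k : 'I_l => ((\sum_r absz (lam r))%N.*2)%:Z * (l%:Z - (k : nat)%:Z)].

Lemma dom_shift_dec lam : weakly_dec (dom_shift lam) /\ weakly_dec (lam + dom_shift lam).
Proof.
have sk r : (absz (lam r) <= \sum_r absz (lam r))%N.
  by rewrite (bigD1 r) //= leq_addr.
split=> j k jk; rewrite !ffunE.
  by apply: ler_wpM2l; lia.
case: (eqVneq j k) => [->//|njk]; have {njk}jk : (j < k)%N.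
  by rewrite ltn_neqAle jk andbT val_eqE.
have := sk j; have := sk k; move: (\sum_r _)%N => S h1 h2.
have -> : S.*2%:Z * (l%:Z - j%:Z) = S.*2%:Z * (l%:Z - k%:Z) + S.*2%:Z * (k%:Z - j%:Z) by ring.
have : S.*2%:Z <= S.*2%:Z * (k%:Z - j%:Z) by apply: ler_peMr; lia.
by move: (_ * (l%:Z - k%:Z)) (_ * (k%:Z - j%:Z)) (lam k) (lam j) h1 h2 => X Y p q; lia.
Qed.

Definition theta lam : H := Ed (lam + dom_shift lam) * Ei (dom_shift lam).

Lemma theta_eq lam mu nu : weakly_dec mu -> weakly_dec nu -> lam = mu - nu ->
  theta lam = Ed mu * Ei nu.
Proof.
move=> h1 h2 E; have [d1 d2] := dom_shift_dec lam; rewrite /theta.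
have EE : Ed (lam + dom_shift lam) * Ed nu = Ed mu * Ed (dom_shift lam).
  by rewrite !EdD // E addrAC subrK.
rewrite -[Ed (lam + dom_shift lam)]mulr1 -(EdK nu) mulrA EE -mulrA EiD //.
by rewrite addrC -EiD // mulrA -(mulrA (Ed mu)) EdK mulr1.
Qed.

Lemma thetaD lam lam' : theta lam * theta lam' = theta (lam + lam').
Proof.
have [d1 d2] := dom_shift_dec lam; have [d3 d4] := dom_shift_dec lam'.
rewrite (theta_eq (lam := lam + lam') (mu := (lam + dom_shift lam) + (lam' + dom_shift lam')) (nu := dom_shift lam + dom_shift lam')).
- rewrite /theta -(EdD d2 d4) -(EiD d1 d3) !mulrA; congr (_ * _).
  by rewrite -!mulrA EiEd.
- by apply: weakly_decD.
- by apply: weakly_decD.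
- by apply/ffunP => k; rewrite !ffunE; ring.
Qed.

Lemma Ei0 : Ei 0 = 1.
Proof. by rewrite -[LHS]mul1r -{1}(Hn1 hH) -tr0 EdK. Qed.

Lemma theta_dec mu : weakly_dec mu -> theta mu = Ed mu.
Proof.
by move=> h; rewrite (theta_eq h weakly_dec0) ?Ei0 ?mulr1 ?subr0.
Qed.

Lemma theta_decN mu : weakly_dec mu -> theta (- mu) = Ei mu.
Proof.
by move=> h; rewrite (theta_eq weakly_dec0 h) ?sub0r // /Ed tr0 (Hn1 hH) mul1r.
Qed.

Lemma theta0 : theta 0 = 1.
Proof. by rewrite theta_dec ?/Ed ?tr0 ?(Hn1 hH) //; exact: weakly_dec0. Qed.

Lemma thetaK lam : theta lam * theta (- lam) = 1.
Proof. by rewrite thetaD subrr theta0. Qed.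

Section Adjacent.
Variables (j k : 'I_l).
Hypothesis kj : k = j.+1 :> nat.
Local Notation s := (fin_aff (tperm j k)).

Lemma len_s : len s = 1%N.
Proof. exact/len_simple1/simple_fin. Qed.

Lemma Ed_comm mu : weakly_dec mu -> mu j = mu k -> Hn s * Ed mu = Ed mu * Hn s.
Proof.
move=> h E; rewrite /Ed (HnM hH) ?(Hn_asc hH) //.
- by rewrite fin_tr tr_fin place_perm_tperm.
- exact: simple_fin.
- by apply/(len_fin_asc _ kj)/hat_tr_lt.
- by rewrite fin_tr len_dec.
Qed.

Lemma theta_comm lam mu nu : weakly_dec mu -> weakly_dec nu -> lam = mu - nu ->
  mu j = mu k -> nu j = nu k -> Hn s * theta lam = theta lam * Hn s.
Proof.
move=> h1 h2 E e1 e2; rewrite (theta_eq h1 h2 E) mulrA Ed_comm // -!mulrA; congr (_ * _).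
by symmetry; apply: comm_inv (EiK nu) (EdK nu) _; rewrite Ed_comm.
Qed.

Definition fund_weight (p : nat) : Zl l := [ffun r : 'I_l => ((r < p)%N : nat)%:Z].

Lemma fund_weight_dec p : weakly_dec (fund_weight p).
Proof. by move=> r q rq; rewrite !ffunE; case: (ltnP q p) => h; case: ltnP => //=; lia. Qed.

Lemma delta_fund_weight (r : 'I_l) : delta r = fund_weight r.+1 - fund_weight r.
Proof.
apply/ffunP => q; rewrite !ffunE ltnS -val_eqE /=.
by case: (ltngtP q r).
Qed.

Lemma theta_delta_comm (r : 'I_l) : r <> j -> r <> k ->
  Hn s * theta (delta r) = theta (delta r) * Hn s.
Proof.
move=> rj rk; apply: (theta_comm (@fund_weight_dec r.+1) (@fund_weight_dec r) (delta_fund_weight r)).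
  rewrite !ffunE kj !ltnS; have : nat_of_ord r <> j by move=> /val_inj.
  by case: (leqP j r); case: ltnP => //=; lia.
rewrite !ffunE kj; have : nat_of_ord r <> k by move=> /val_inj.
rewrite kj; by case: (ltnP j r); case: ltnP => //=; lia.
Qed.

Lemma Hn_s_inv : Hn s * b (Hn s) = 1 /\ b (Hn s) * Hn s = 1.
Proof.
have := HnVb hb s; have := bHnV hb s; rewrite simpleV //; exact: simple_fin.
Qed.

Lemma theta_bernstein : Hn s * theta (delta k) * Hn s = theta (delta j).
Proof.
set p := fund_weight k; have pd : weakly_dec p by exact: fund_weight_dec.
have pjk : p j = p k + 1 by rewrite !ffunE kj ltnSn ltnn.
pose p' := place_perm p (tperm j k) + p.
have p'E : p' = fund_weight k.+1 + fund_weight j.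
  apply/ffunP => r; rewrite !ffunE tpermV kj.
  case: tpermP => [->|->|/eqP rj /eqP rk]; rewrite ?kj ?ltnSn ?ltnn ?ltnS ?leqnn //=.
  - by rewrite leqnSn.
  - by rewrite ltnNge leqnSn.
  - move: rj rk; rewrite -!val_eqE /= kj => rj rk.
    by case: (ltngtP r j) rj => // h _; case: ltngtP rk; lia.
have p'd : weakly_dec p' by rewrite p'E; apply: weakly_decD; apply: fund_weight_dec.
have [si1 si2] := Hn_s_inv.
have len_p := len_tr_tperm kj pd pjk; rewrite -/p' in len_p.
have desc : len (tr p) = (len (tr p * s)%g).+1.
  by apply/(len_fin_desc _ kj)/hat_tr_gt; rewrite pjk; lia.
have Ep : Ed p = Hn (tr p * s)%g * Hn s.
  rewrite (Hn_asc hH (simple_fin kj)) -mulgA simple_sq ?mulg1 //; exact: simple_fin.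
have conj : (tr p * s * tr p)%g = (s * tr p')%g.
  by rewrite tr_fin -fin_tr -mulgA trD.
have lensp : len (s * tr p')%g = (len s + len (tr p'))%N by rewrite fin_tr len_dec.
have key : Hn s * Ed p' = Ed p * b (Hn s) * Ed p.
  rewrite {1}Ep -(mulrA (Hn (tr p * s)%g)) si1 mulr1 /Ed (HnM hH lensp) (HnM hH) conj //.
  by rewrite lensp len_s; lia.
have fwj : weakly_dec (fund_weight j) by exact: fund_weight_dec.
have fjk : fund_weight j j = fund_weight j k by rewrite !ffunE kj ltnn ltnNge leqnSn.
rewrite (theta_eq p'd (weakly_decD pd fwj)); last first.
  by rewrite delta_fund_weight p'E; apply/ffunP => r; rewrite !ffunE; ring.
rewrite (theta_eq pd fwj); last by rewrite delta_fund_weight /p kj.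
rewrite -EiD // !mulrA key -!mulrA (mulrA (Ed p) (Ei p)) EdK mul1r; congr (_ * _).
have c1 : Ei (fund_weight j) * Hn s = Hn s * Ei (fund_weight j).
  by apply: comm_inv (EiK _) (EdK _) _; rewrite Ed_comm.
by rewrite c1 mulrA si2 mul1r.
Qed.

Lemma theta_bernsteinV : Hn s * theta (- delta j) * Hn s = theta (- delta k).
Proof.
have [si1 si2] := Hn_s_inv.
apply: inv_uniq (thetaK (delta k)).
have -> : theta (delta k) = b (Hn s) * theta (delta j) * b (Hn s).
  rewrite -theta_bernstein; move: (theta _) => x.
  by rewrite !mulrA si2 mul1r -mulrA si1 mulr1.
have : theta (- delta j) * theta (delta j) = 1 by rewrite thetaD addNr theta0.
move: (theta _) (theta _) => x y xy.
by rewrite !mulrA -(mulrA _ (Hn s) (b (Hn s))) si1 mulr1 -(mulrA (Hn s)) xy mulr1.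
Qed.

End Adjacent.
End Bernstein.

(** * From the tensor module to the Hecke algebra *)

Lemma scalerC (R : comNzRingType) (V : lmodType R) (p q : R) (m : V) :
  p *: (q *: m) = q *: (p *: m).
Proof. by rewrite !scalerA mulrC. Qed.

Section Psi.
Variables (C : comNzRingType) (l n : nat) (hn : (0 < n)%N).
Local Notation A := (laurent C).
Local Notation v := (vpow C).
Local Notation qz := (qz C).
Variables (H : algType A) (TH : affS l -> H) (hH : is_iwahori_hecke TH).
Local Notation Hn := (Hn TH).
Local Notation ch := (ch hH).
Variables (b : H -> H) (hb : is_hecke_bar TH b).
Local Notation theta := (theta TH b).
Implicit Types (w x y t : affS l) (u z : 'S_l) (g h : H) (a mu nu lam : Zl l).
Variables (i : Zl l) (hi : in_alcove n i).

Let iinc : weakly_inc i. Proof. by case: hi. Qed.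
Let ibox : in_box n i. Proof. by case: hi. Qed.

Definition block_sum a : H :=
  \sum_(z : 'S_l | place_perm i z == a) v (- (len (fin_aff z))%:Z) *: Hn (fin_aff z).

Lemma block_sumE a : block_sum a =
  \sum_(z : 'S_l | place_perm i z == a) v (- (len (fin_aff z))%:Z) *: Hn (fin_aff z).
Proof. by []. Qed.

Definition inF a y := (y.2 == 0) && (place_perm i y.1 == a).

Lemma inFP a w : reflect (exists2 u, place_perm i u = a & w = fin_aff u) (inF a w).
Proof.
apply: (iffP andP) => [[/eqP E /eqP su]|[u su ->]]; last by rewrite eqxx su eqxx.
by exists w.1 => //; rewrite /fin_aff -E -surjective_pairing.
Qed.

Lemma ch_block_sum a y : ch y (block_sum a) = if inF a y then v (- (len y)%:Z) else 0.
Proof.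
rewrite /block_sum ch_sum; under eq_bigr => u _ do rewrite chZ ch_Hn.
case: inFP => [[u su ->]|ns].
  rewrite (bigD1 u) /= ?su // !eqxx mulr1 big1 ?addr0 // => u' /andP[_ u'u].
  case: eqP => [[E]|_]; last by rewrite mulr0.
  by rewrite E eqxx in u'u.
rewrite big1 // => u /eqP su; case: eqP => [E|_]; last by rewrite mulr0.
by case: ns; exists u.
Qed.

Definition ainv a : nat := (\sum_(p : 'I_l * 'I_l | (p.1 < p.2)%N) (a p.2 < a p.1)%R)%N.

Section Adjacent.
Variables (j k : 'I_l).
Hypothesis kj : k = j.+1 :> nat.
Local Notation t := (tperm j k).
Local Notation s := (fin_aff t).

Let st : simple_refl s. Proof. exact: simple_fin. Qed.
Let ss : (s * s)%g = 1%g. Proof. exact: simple_sq. Qed.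

Lemma inF_s a y : inF (place_perm a t) (y * s)%g = inF a y.
Proof.
have imp a' y' : inF a' y' -> inF (place_perm a' t) (y' * s)%g.
  move=> /inFP[u su ->]; apply/inFP; exists (u * t)%g; last by rewrite fin_affM.
  by rewrite place_permM su.
apply/idP/idP => /imp //.
by rewrite -mulgA ss mulg1 -place_permM tperm2 place_perm1.
Qed.

Lemma len_inF a y : inF a y -> a j < a k -> len (y * s)%g = (len y).+1.
Proof.
move=> /inFP[u <- ->]; rewrite !ffunE => lt; apply/(len_fin_asc _ kj).
rewrite !hat_fin1; rewrite ltNge; apply/negP => h; move: lt.
by rewrite ltNge iinc //; lia.
Qed.

Lemma block_sum_lt a : a j < a k -> block_sum a * Hn s = v 1 *: block_sum (place_perm a t).
Proof.
move=> lt; apply: (ch_ext (hH := hH)) => y.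
rewrite (ch_mulS hH _ _ st) chZ !ch_block_sum.
have -> : inF (place_perm a t) y = inF a (y * s)%g.
  by rewrite -(inF_s a (y * s)%g) -mulgA ss mulg1.
case: (boolP (inF a y)) => [ay|nay].
  have -> : inF a (y * s)%g = false.
    apply/negP => ay'; have := len_inF ay lt; have := len_inF ay' lt.
    by rewrite -mulgA ss mulg1; lia.
  by rewrite /dr (len_inF ay lt) ltnNge leqnSn mul0r mulr0 addr0.
rewrite mulr0 addr0; case: ifP => [ay'|_]; last by rewrite mulr0.
have := len_inF ay' lt; rewrite -mulgA ss mulg1 => ->.
by rewrite -vpowD; congr v; lia.
Qed.

Lemma block_sum_eq a : a j = a k -> block_sum a * Hn s = v (-1) *: block_sum a.
Proof.
move=> E; apply: (ch_ext (hH := hH)) => y.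
rewrite (ch_mulS hH _ _ st) chZ !ch_block_sum.
have -> : inF a (y * s)%g = inF a y by rewrite -{1}(place_perm_tperm E) inF_s.
case: ifP => _; last by rewrite !mulr0 addr0.
rewrite /dr; case: (len_simple y st) => El; rewrite El.
  by rewrite ltnNge leqnSn mul0r addr0 -vpowD; congr v; lia.
rewrite ltnSn; have -> : v (- (len (y * s)%g)%:Z) = v 1 * v (- (len (y * s)%g).+1%:Z).
  by rewrite -vpowD; congr v; lia.
by rewrite -mulrDl qzE addrC subrK.
Qed.

Lemma block_sum_gt a : a k < a j -> block_sum a * Hn s = v (-1) *: block_sum (place_perm a t) + qz *: block_sum a.
Proof.
move=> gt; have lt : place_perm a t j < place_perm a t k.
  by rewrite !ffunE tpermV tpermL tpermR.
have E : block_sum a = v (-1) *: (block_sum (place_perm a t) * Hn s).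
  rewrite (block_sum_lt lt) -place_permM tperm2 place_perm1 scalerA vpowVl scale1r //.
rewrite {1}E -scalerAl -mulrA (Hn_quad hH st) mulrDr mulr1 -scalerAr scalerDr.
by rewrite scalerA mulrC -scalerA -E.
Qed.

Lemma ainv_lt a : a j < a k -> ainv (place_perm a t) = (ainv a).+1.
Proof.
move=> lt; have jk : (j < k)%N by rewrite kj.
have -> : ainv (place_perm a t) = (\sum_(p : 'I_l * 'I_l | (p.1 < p.2)%N)
    if (t p.1 < t p.2)%N then (a p.2 < a p.1)%R : nat else (a p.1 < a p.2)%R : nat)%N.
  rewrite -(sum_pairs_perm (fun p q => (a q < a p)%R : nat)).
  by apply: eq_bigr => p _; rewrite !ffunE.
rewrite /ainv (bigD1 (j, k)) //= [in RHS](bigD1 (j, k)) //= tpermL tpermR.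
rewrite ltnNge (ltnW jk) /= lt [a k < a j]ltNge (ltW lt) /= add0n add1n; congr _.+1.
apply: eq_bigr => -[p q] /= /andP[pq npq].
case: ltnP => //; rewrite leq_eqVlt => /predU1P[/val_inj/perm_inj E|h].
  by move: pq; rewrite E ltnn.
by have [Ea Eb] := tperm_adj_inv kj pq h; rewrite Ea Eb eqxx in npq.
Qed.

End Adjacent.

Variables (M : lmodType A) (ot : Zl l -> M) (hM : is_free_basis ot).
Variables (T X XV : 'I_l -> {linear M -> M}) (hT : is_hecke_action ot T X XV n).

Definition Psi0 j : H := v (ainv (box_rep n j))%:Z *: (block_sum (box_rep n j) * theta (box_quo n j)).
Definition Psi (m : M) : H := locked (fext hM Psi0) m.

Lemma PsiE m : Psi m = fext hM Psi0 m. Proof. by rewrite /Psi -lock. Qed.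
Lemma PsiD m m' : Psi (m + m') = Psi m + Psi m'. Proof. by rewrite !PsiE fextD. Qed.
Lemma PsiZ p m : Psi (p *: m) = p *: Psi m. Proof. by rewrite !PsiE fextZ. Qed.
Lemma Psi_ot j : Psi (ot j) = Psi0 j. Proof. by rewrite PsiE fext_basis. Qed.

Lemma Psi0r : Psi 0 = 0.
Proof. by have := PsiZ 0 0; rewrite !scale0r. Qed.

Lemma box_repD j mu : box_rep n (j + mu *+ n) = box_rep n j /\
  box_quo n (j + mu *+ n) = box_quo n j + mu.
Proof.
apply: (box_uniq hn); [exact: box_rep_in|exact: box_rep_in|].
by rewrite -box_eq // {1}(box_eq hn j) mulrnDl addrA.
Qed.

Lemma box_rep_id a : in_box n a -> box_rep n a = a /\ box_quo n a = 0.
Proof.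
move=> ha; apply: (box_uniq hn) => //; first exact: box_rep_in.
by rewrite -box_eq // mul0rn addr0.
Qed.

Lemma Psi_XV r m : Psi (XV r m) = Psi m * theta (delta r).
Proof.
elim/(basis_ind hM): m => [|m m' IH IH'|p m IH|j].
- by rewrite linear0 Psi0r mul0r.
- by rewrite linearD !PsiD IH IH' mulrDl.
- by rewrite linearZ !PsiZ IH -scalerAl.
rewrite (ha_XV_ot hT) !Psi_ot /Psi0; have [-> ->] := box_repD j (delta r).
by rewrite -scalerAl -mulrA (thetaD hH hb).
Qed.

Lemma Psi_X r m : Psi (X r m) = Psi m * theta (- delta r).
Proof.
have [E _] := ha_XV hT r m.
by rewrite -{2}E Psi_XV -mulrA (thetaK hH hb) mulr1.
Qed.

Section Commute.
Variables (j k : 'I_l).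
Hypothesis kj : k = j.+1 :> nat.
Local Notation t := (tperm j k).
Local Notation s := (fin_aff t).
Local Notation q := (v (-2)).

Definition Sj : H := v (-1) *: Hn s.

Let jl : (j.+1 < l)%N. Proof. by rewrite -kj ltn_ord. Qed.

Lemma Sj_sq : Sj * Sj = (q - 1) *: Sj + q%:A.
Proof.
rewrite /Sj -scalerAl -scalerAr (Hn_quad hH (simple_fin kj)) [LHS]scalerA -vpowD.
have -> : -1 + -1 = -2 :> int by [].
have E : q * qz = (q - 1) * v (-1) by rewrite qzE mulrBr mulrBl mul1r -!vpowD.
by rewrite scalerDr addrC !scalerA E.
Qed.

Lemma T_sq m : T j (T j m) = (q - 1) *: T j m + q *: m.
Proof.
have /eqP := ha_quad hT jl m; rewrite subr_eq0 linearD /= => /eqP E.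
by rewrite -[LHS](addrK (T j m)) E scalerDr scalerBl scale1r addrAC.
Qed.

Definition Ti (m : M) : M := v 2 *: (T j m + (1 - q) *: m).

Lemma TiK m : T j (Ti m) = m.
Proof.
rewrite /Ti linearZ linearD linearZ /= T_sq addrAC -scalerDl.
rewrite [q - 1 + _]addrC -addrA [- q + _]addrA addNr add0r subrr scale0r add0r.
by rewrite scalerA -vpowD scale1r.
Qed.

Lemma TiT m : Ti (T j m) = m.
Proof.
rewrite /Ti T_sq addrAC -scalerDl.
rewrite [q - 1 + _]addrC -addrA [- q + _]addrA addNr add0r subrr scale0r add0r.
by rewrite scalerA -vpowD scale1r.
Qed.

Lemma TiZ p m : Ti (p *: m) = p *: Ti m.
Proof.
by rewrite /Ti linearZ /= (scalerC (1 - q)) -scalerDr scalerC.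
Qed.

Lemma theta_SX (x y : H) : Sj * x * Sj = q *: y -> y * Sj = (q - 1) *: y + Sj * x.
Proof.
move=> E; have {E}-> : y = v 2 *: (Sj * x * Sj) by rewrite E scalerA -vpowD scale1r.
rewrite -scalerAl -(mulrA (Sj * x)) Sj_sq mulrDr -scalerAr scalerDr; congr (_ + _).
  by rewrite scalerC.
by rewrite -scalerAr mulr1 scalerA -vpowD scale1r.
Qed.

Lemma theta_Sj : Sj * theta (- delta j) * Sj = q *: theta (- delta k).
Proof.
by rewrite /Sj -scalerAl -scalerAr -scalerAl (theta_bernsteinV hH hb kj) scalerA -vpowD.
Qed.

Lemma theta_SjV : Sj * theta (delta k) * Sj = q *: theta (delta j).
Proof.
by rewrite /Sj -scalerAl -scalerAr -scalerAl (theta_bernstein hH hb kj) scalerA -vpowD.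
Qed.

Definition comm m := Psi (T j m) = Psi m * Sj.

Lemma commD m m' : comm m -> comm m' -> comm (m + m').
Proof. by rewrite /comm linearD !PsiD mulrDl => -> ->. Qed.

Lemma commZ p m : comm m -> comm (p *: m).
Proof. by rewrite /comm linearZ !PsiZ -scalerAl => ->. Qed.

Lemma comm_T m : comm m -> comm (T j m).
Proof.
move=> h; rewrite /comm T_sq PsiD !PsiZ h -mulrA Sj_sq mulrDr -!scalerAr mulr1.
by [].
Qed.

Lemma comm_Ti m : comm m -> comm (Ti m).
Proof. by move=> h; apply: commZ; apply: commD; [apply: comm_T|apply: commZ]. Qed.

Lemma comm_Xk m : comm m -> comm (X k m).
Proof.
move=> h; have E : X k m = v 2 *: T j (X j (T j m)).
  by rewrite (ha_TXT hT kj) scalerA -vpowD scale1r.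
rewrite /comm Psi_X -mulrA (theta_SX theta_Sj) mulrDr -scalerAr -Psi_X.
rewrite {1}E linearZ /= T_sq scalerDr PsiD; congr (_ + _).
  by rewrite E !PsiZ scalerC.
by rewrite scalerA -vpowD scale1r Psi_X h mulrA.
Qed.

Lemma XVjE m : XV j m = v 2 *: T j (XV k (T j m)).
Proof.
set w := XV k (T j m).
have XE : X j (T j w) = q *: m.
  rewrite -[LHS]TiT (ha_TXT hT kj) TiZ; congr (_ *: _).
  by rewrite /w (ha_XV hT k _).2 TiT.
have := congr1 (XV j) XE; rewrite (ha_XV hT j _).1 linearZ /= => ->.
by rewrite scalerA -vpowD scale1r.
Qed.

Lemma comm_XVj m : comm m -> comm (XV j m).
Proof.
move=> h; rewrite /comm Psi_XV -mulrA (theta_SX theta_SjV) mulrDr -scalerAr -Psi_XV.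
rewrite {1}XVjE linearZ /= T_sq scalerDr PsiD; congr (_ + _).
  by rewrite XVjE !PsiZ scalerC.
by rewrite scalerA -vpowD scale1r Psi_XV h mulrA.
Qed.

Lemma comm_Xj m : comm m -> comm (X j m).
Proof.
move=> h; have -> : X j m = q *: Ti (X k (Ti m)).
  by rewrite -TiZ -(ha_TXT hT kj) TiK TiT.
by apply: commZ; apply: comm_Ti; apply: comm_Xk; apply: comm_Ti.
Qed.

Lemma comm_XVk m : comm m -> comm (XV k m).
Proof.
move=> h; have -> : XV k m = q *: Ti (XV j (Ti m)).
  by rewrite XVjE TiZ scalerA -vpowD scale1r TiT TiK.
by apply: commZ; apply: comm_Ti; apply: comm_XVj; apply: comm_Ti.
Qed.

Lemma comm_X r m : comm m -> comm (X r m).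
Proof.
move=> h; have [->|rj] := pselect (r = j); first exact: comm_Xj.
have [->|rk] := pselect (r = k); first exact: comm_Xk.
rewrite /comm (ha_XT hT jl rj) => [|E]; last by apply: rk; apply: val_inj; rewrite /= kj.
have c : Hn s * theta (- delta r) = theta (- delta r) * Hn s.
  symmetry; apply: (comm_inv (x := theta (delta r))).
  - by rewrite (thetaD hH hb) addNr (theta0 hH hb).
  - exact: thetaK.
  - by rewrite (theta_delta_comm hH hb kj rj rk).
have {}c : Sj * theta (- delta r) = theta (- delta r) * Sj by rewrite /Sj -scalerAl c scalerAr.
by rewrite !Psi_X h -(mulrA (Psi m)) c mulrA.
Qed.

Lemma comm_XV r m : comm m -> comm (XV r m).
Proof.
move=> h; have [->|rj] := pselect (r = j); first exact: comm_XVj.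
have [->|rk] := pselect (r = k); first exact: comm_XVk.
have -> : comm (XV r m) = (Psi (XV r (T j m)) = Psi (XV r m) * Sj).
  rewrite /comm; congr (Psi _ = _).
  rewrite -[LHS](ha_XV hT r _).1 -(ha_XT hT jl rj) ?(ha_XV hT r _).2 // => E.
  by apply: rk; apply: val_inj; rewrite /= kj.
have c : Sj * theta (delta r) = theta (delta r) * Sj.
  by rewrite /Sj -scalerAl (theta_delta_comm hH hb kj rj rk) scalerAr.
by rewrite !Psi_XV h -(mulrA (Psi m)) c mulrA.
Qed.

Lemma comm_box a : in_box n a -> comm (ot a).
Proof.
move=> ha; have [hT1 hT2 hT3] := ha_T_ot hT kj (ha j) (ha k).
have Pa a' : in_box n a' -> Psi (ot a') = v (ainv a')%:Z *: block_sum a'.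
  by move=> h; rewrite Psi_ot /Psi0; have [-> ->] := box_rep_id h; rewrite (theta0 hH hb) mulr1.
have hat := place_perm_box t ha.
rewrite /comm Pa // /Sj -scalerAl -scalerAr.
case: (ltgtP (a j) (a k)) => [lt|gt|E].
- rewrite hT2 // PsiZ Pa // (ainv_lt kj lt) (block_sum_lt kj lt) !scalerA -!vpowD.
  by congr (v _ *: _); lia.
- have lt : place_perm a t j < place_perm a t k by rewrite !ffunE tpermV tpermL tpermR.
  have := ainv_lt kj lt; rewrite -place_permM tperm2 place_perm1 => Ei.
  have e1 : v (-1) * v (ainv (place_perm a t))%:Z = v (ainv a)%:Z * v (-1) * v (-1).
    by rewrite Ei -!vpowD; congr v; lia.
  have e2 : (q - 1) * v (ainv a)%:Z = v (ainv a)%:Z * v (-1) * qz.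
    by rewrite mulrC -mulrA qzE [v (-1) * _]mulrBr -!vpowD.
  by rewrite (hT3 gt) PsiD !PsiZ (Pa _ hat) (Pa _ ha) (block_sum_gt kj gt) !scalerDr !scalerA e1 e2.
- rewrite hT1 // PsiZ Pa // (block_sum_eq kj E) !scalerA -!vpowD.
  by congr (v _ *: _); lia.
Qed.

(* [comm] holds on the box by inspection, and is stable under all [X] and [XV], which
   move [ot] to every weight. *)
Lemma comm_ot m : comm m.
Proof.
elim/(basis_ind hM): m => [|m m'|p m|x].
- by rewrite /comm linear0 Psi0r mul0r.
- exact: commD.
- exact: commZ.
have step r c a : comm (ot a) -> comm (ot (a + [ffun p => c *+ (p == r)] *+ n)).
  move=> ha; pose d (e : int) : Zl l := [ffun p => e *+ (p == r)].
  have dS e : d (e + 1) = d e + delta r.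
    by apply/ffunP => p; rewrite !ffunE; case: (p == r); rewrite ?mulr0n ?addr0.
  have pos m a' : comm (ot a') -> comm (ot (a' + d m%:Z *+ n)).
    move=> ha'; elim: m => [|m IH].
      by rewrite (_ : d 0 = 0) ?mul0rn ?addr0 //; apply/ffunP => p; rewrite !ffunE mul0rn.
    by rewrite -addn1 PoszD dS mulrnDl addrA -(ha_XV_ot hT); apply: comm_XV.
  have neg m a' : comm (ot a') -> comm (ot (a' - d m%:Z *+ n)).
    move=> ha'; elim: m => [|m IH].
      by rewrite (_ : d 0 = 0) ?mul0rn ?subr0 //; apply/ffunP => p; rewrite !ffunE mul0rn.
    rewrite -addn1 PoszD dS mulrnDl opprD addrA.
    set a'' := _ - _ in IH *; rewrite -{}[a''](subrK (delta r *+ n)) in IH.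
    rewrite -(ha_XV_ot hT) in IH; have := comm_X r IH.
    by rewrite (ha_XV hT r _).2.
  have [m [->|->]] : exists m : nat, c = m%:Z \/ c = - m%:Z by exists `|c|%N; lia.
    exact: pos.
  rewrite (_ : [ffun p => - m%:Z *+ (p == r)] = - d m%:Z) ?mulNrn; first exact: neg.
  by apply/ffunP => p; rewrite !ffunE mulNrn.
have all (ps : seq 'I_l) mu a : comm (ot a) ->
    comm (ot (a + (\sum_(r <- ps) [ffun p => mu r *+ (p == r)] : Zl l) *+ n)).
  elim: ps a => [|r ps IH] a ha; first by rewrite big_nil mul0rn addr0.
  by rewrite big_cons mulrnDl addrA; apply: IH; apply: step.
have := all (index_enum 'I_l) (box_quo n x) _ (comm_box (box_rep_in hn x)).
rewrite (_ : \sum_(r <- _) _ = box_quo n x) -?(box_eq hn) //.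
apply/ffunP => p; rewrite sum_ffunE (bigD1 p) //= ffunE eqxx mulr1n big1 ?addr0 // => r.
by rewrite ffunE eq_sym => /negPf ->.
Qed.

End Commute.

End Psi.

Section Wedge.
Variables (C : comNzRingType) (l n : nat) (hn : (0 < n)%N).
Local Notation A := (laurent C).
Local Notation v := (vpow C).
Local Notation qz := (qz C).
Variables (H : algType A) (TH : affS l -> H) (hH : is_iwahori_hecke TH).
Local Notation Hn := (Hn TH).
Local Notation ch := (ch hH).
Variables (b : H -> H) (hb : is_hecke_bar TH b).
Local Notation theta := (theta TH b).
Implicit Types (w x y t : affS l) (u z : 'S_l) (g h : H) (a j mu nu lam : Zl l).

Local Notation c := (- v 1).
Local Notation c' := (- v (-1)).
Local Notation W := (fin_aff (w0 l)).
Local Notation N := (len W).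

Definition antisym : H := par_sum TH (0 : Zl l) c.

Lemma antisym_cc : c * c' = 1.
Proof. by rewrite mulrNN vpowVr. Qed.

Lemma antisym_cq : c - c' = qz.
Proof. by rewrite opprK addrC. Qed.

Lemma antisym_bc : lbar c = c'.
Proof. by rewrite lbarN lbar_vpow. Qed.

Lemma antisym_powN m : c ^+ m = (-1) ^+ m * v m%:Z.
Proof. by rewrite -[- v 1]mulN1r exprMn vpowX mul1r. Qed.

Lemma antisym_left (j k : 'I_l) : k = j.+1 :> nat -> Hn (fin_aff (tperm j k)) * antisym = c *: antisym.
Proof. by move=> kj; apply: (par_sum_left hH antisym_cc antisym_cq kj); rewrite !ffunE. Qed.

Lemma antisym_right (j k : 'I_l) : k = j.+1 :> nat -> antisym * Hn (fin_aff (tperm j k)) = c *: antisym.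
Proof. by move=> kj; apply: (par_sum_right hH antisym_cc antisym_cq kj); rewrite !ffunE. Qed.

Lemma antisym_w0 : Hn W * antisym = c ^+ N *: antisym.
Proof.
apply: (eigen_left hH (@weakly_inc0 l)) (place_perm0 _) => j k kj _; exact: antisym_left.
Qed.

Lemma b_antisym : b antisym = v (- (2 * N)%N%:Z) *: antisym.
Proof.
have e : c' ^+ (2 * N) = v (- (2 * N)%N%:Z).
  by rewrite -[- v (-1)]mulN1r exprMn vpowX exprM sqrrN expr1n expr1n mul1r; congr v; lia.
rewrite /antisym (bar_par_sum hH (@weakly_inc0 l) antisym_cc antisym_cq (u0 := w0 l) _ _ hb antisym_bc) ?e //.
  exact: place_perm0.
by move=> p q pq _; apply: w0_anti.
Qed.

Lemma antisym_eigen_right h u : (h * antisym) * Hn (fin_aff u) = c ^+ len (fin_aff u) *: (h * antisym).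
Proof.
apply: (eigen_right hH (@weakly_inc0 l)) (place_perm0 _) => j k kj _.
by rewrite -mulrA antisym_right // scalerAr.
Qed.

Lemma ch_antisym y h : (forall j k : 'I_l, k = j.+1 :> nat -> hat y k < hat y j) ->
  ch y (h * antisym) = c ^+ N *
    \sum_(u : 'S_l) c ^+ len (fin_aff u) * ch (y * W * (fin_aff u)^-1)%g h.
Proof.
move=> hy.
have hyW (j k : 'I_l) : k = j.+1 :> nat -> hat (y * W)%g j < hat (y * W)%g k.
  move=> kj; rewrite !hat_fin w0V !w0E; apply: hy => /=.
  by have := ltn_ord k; rewrite kj; lia.
have <- : ch (y * W)%g (h * antisym) = \sum_(u : 'S_l) c ^+ len (fin_aff u) * ch (y * W * (fin_aff u)^-1)%g h.
  rewrite /antisym /par_sum mulr_sumr ch_sum; apply: eq_big => [u|u _].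
    by rewrite place_perm0 eqxx.
  by rewrite -scalerAr chZ (ch_mul_inc hH hyW).
by rewrite -chZ -antisym_eigen_right (ch_mul_inc hH hyW) mulgK.
Qed.

Variables (i : Zl l) (hi : in_alcove n i).
Local Notation block_sum := (block_sum TH i).

Let iinc : weakly_inc i. Proof. by case: hi. Qed.
Let ibox : in_box n i. Proof. by case: hi. Qed.

Lemma block_sum_left (j k : 'I_l) a : k = j.+1 :> nat -> i j = i k ->
  Hn (fin_aff (tperm j k)) * block_sum a = v (-1) *: block_sum a.
Proof.
move=> kj ij; have st := simple_fin kj; apply: (ch_ext (hH := hH)) => y.
rewrite (ch_mulSL hH _ _ st) chZ !ch_block_sum.
have -> : inF i a (fin_aff (tperm j k) * y)%g = inF i a y.
  have imp y' : inF i a y' -> inF i a (fin_aff (tperm j k) * y')%g.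
    move=> /inFP[u su ->]; apply/inFP; exists (tperm j k * u)%g; last by rewrite fin_affM.
    by rewrite place_permM place_perm_tperm.
  apply/idP/idP => /imp //; by rewrite mulgA simple_sq ?mul1g.
case: ifP => _; last by rewrite !mulr0 addr0.
rewrite /dl; case: (len_simpleL y st) => El; rewrite El.
  by rewrite ltnNge leqnSn mul0r addr0 -vpowD; congr v; lia.
rewrite ltnSn; set m := len _.
have -> : v (- m%:Z) = v 1 * v (- m.+1%:Z) by rewrite -vpowD; congr v; lia.
by rewrite -mulrDl qzE addrC subrK.
Qed.

Lemma weakly_dec_box j : weakly_dec j -> weakly_dec (box_quo n j).
Proof.
move=> dj p q pq; have := dj p q pq.
have E r : j r = box_rep n j r + n%:Z * box_quo n j r.
  by rewrite {1}(box_eq hn j) [LHS]ffunE ffunMnE mulrn_intE.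
rewrite !E; have := box_rep_in hn j p; have := box_rep_in hn j q.
move: (box_rep n j p) (box_rep n j q) (box_quo n j p) (box_quo n j q).
move=> a1 a2 m1 m2 h1 h2 h3; rewrite leNgt; apply/negP => lt; nia.
Qed.

Variables (M L : lmodType A) (ot : Zl l -> M) (hM : is_free_basis ot).
Variables (T X XV : 'I_l -> {linear M -> M}) (hT : is_hecke_action ot T X XV n).
Variables (pi : {linear M -> L}) (hL : is_wedge_quotient T pi).
Local Notation Psi := (Psi n TH b i hM).

Lemma Psi_T_antisym (j k : 'I_l) m : k = j.+1 :> nat -> Psi (T j m + m) * antisym = 0.
Proof.
move=> kj; rewrite PsiD (comm_ot hn hH hb hi hM hT kj) mulrDl -mulrA /Sj -scalerAl.
by rewrite antisym_left // scalerA mulrN vpowVl scaleN1r mulrN addNr.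
Qed.

Lemma Psi_omega m : pi m = 0 -> Psi m * antisym = 0.
Proof.
case: hL => _ h /h[r [w E]].
have {}E : (1 + v (-2)) ^+ r *: (Psi m * antisym) = 0.
  rewrite scalerAl -PsiZ E; apply: (big_ind (fun m => Psi m * antisym = 0)).
  - by rewrite (Psi0r n TH b i hM) mul0r.
  - by move=> m1 m2 h1 h2; rewrite PsiD mulrDl h1 h2 addr0.
  - by move=> k kl; apply: (@Psi_T_antisym k (Ordinal kl)).
elim: r E => [|r IH]; first by rewrite scale1r.
rewrite exprS -scalerA => E; apply: IH; apply: (ch_ext (hH := hH)) => y.
rewrite ch0; apply: (@vpow2_regular _ (-2)) => //.
by rewrite -chZ E ch0.
Qed.

Lemma Psi_left (j k : 'I_l) m : k = j.+1 :> nat -> i j = i k ->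
  Hn (fin_aff (tperm j k)) * Psi m = v (-1) *: Psi m.
Proof.
move=> kj ij; elim/(basis_ind hM): m => [|m m' IH IH'|p m IH|x].
- by rewrite (Psi0r n TH b i hM) mulr0 scaler0.
- by rewrite PsiD mulrDr IH IH' scalerDr.
- by rewrite PsiZ -scalerAr IH scalerC.
by rewrite Psi_ot /Psi0 -scalerAr mulrA (block_sum_left _ kj ij) -scalerAl scalerC.
Qed.

Lemma ch_block_sum_dom a mu w : weakly_dec mu -> ch w (block_sum a * Ed TH mu) =
  if (place_perm i w.1 == a) && (w.2 == mu) then v (- (len (fin_aff w.1))%:Z) else 0.
Proof.
move=> dm; rewrite block_sumE mulr_suml ch_sum.
have term z : ch w (v (- (len (fin_aff z))%:Z) *: Hn (fin_aff z) * Ed TH mu) =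
    if (w.1 == z) && (w.2 == mu) then v (- (len (fin_aff z))%:Z) else 0.
  rewrite -scalerAl chZ; have -> : Hn (fin_aff z) * Ed TH mu = Hn (z, mu).
    by rewrite /Ed (HnM hH) fin_tr // len_dec.
  have -> : ch w (Hn (z, mu)) = ((w.1 == z) && (w.2 == mu))%:R.
    rewrite ch_Hn; congr (nat_of_bool _)%:R; case: w => w1 w2 /=.
    by apply/eqP/andP => [[-> ->]|[/eqP-> /eqP->]].
  by case: (_ && _); rewrite ?mulr1 ?mulr0.
under eq_bigr => z _ do rewrite term.
case: (place_perm i w.1 =P a) => [E|nE] /=; last first.
  rewrite big1 // => z /eqP zE; case: (w.1 =P z) => //= E.
  by case: nE; rewrite E.
rewrite (bigD1 w.1) /= ?E ?eqxx //= big1 ?addr0 // => z /andP[_ /negPf zw].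
by rewrite eq_sym zw.
Qed.

Lemma Psi_dec j : weakly_dec j ->
  Psi (ot j) = v (ainv (box_rep n j))%:Z *: (block_sum (box_rep n j) * Ed TH (box_quo n j)).
Proof.
by move=> dj; rewrite Psi_ot /Psi0 (theta_dec hH hb) //; apply: weakly_dec_box.
Qed.

Lemma ch_Psi j w : weakly_dec j -> ch w (Psi (ot j)) =
  if aff_act n i w == j
  then v ((ainv (box_rep n j))%:Z - (len (fin_aff w.1))%:Z) else 0.
Proof.
move=> dj; rewrite (Psi_dec dj) chZ ch_block_sum_dom; last exact: weakly_dec_box.
have -> : (aff_act n i w == j) = (place_perm i w.1 == box_rep n j) && (w.2 == box_quo n j).
  by apply/eqP/andP => [/(aff_act_eqE hn hi)[-> ->]|[/eqP E1 /eqP E2]];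
    [rewrite !eqxx|apply/(aff_act_eqE hn hi)].
by case: ifP => _; rewrite ?mulr0 // vpowD.
Qed.

End Wedge.

Lemma compat_aux1 (R : comPzRingType) (p q r s : R) : r * q = 1 ->
  p * (r * (s * q)) = s * p.
Proof. by move=> h; rewrite [s * q]mulrC (mulrA r) h mul1r mulrC. Qed.

Lemma compat_aux2 (R : comPzRingType) (p q s : R) : s * s = 1 ->
  s * p * (s * q) = p * q.
Proof. by move=> h; rewrite mulrACA h mul1r. Qed.

Section Compat.
Variables (C : comNzRingType) (l n : nat) (hn : (0 < n)%N).
Local Notation A := (laurent C).
Local Notation v := (vpow C).
Variables (H : algType A) (TH : affS l -> H) (hH : is_iwahori_hecke TH).
Local Notation Hn := (Hn TH).
Local Notation ch := (ch hH).
Variables (b : H -> H) (hb : is_hecke_bar TH b).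
Local Notation theta := (theta TH b).
Local Notation antisym := (antisym TH).
Local Notation Ed := (Ed TH).
Implicit Types (w x y t : affS l) (u z : 'S_l) (g h : H) (a j mu nu lam : Zl l).

Local Notation W := (fin_aff (w0 l)).
Local Notation N := (len W).

Lemma reverseK : involutive (@reverse l).
Proof. by move=> a; apply/ffunP => k; rewrite !ffunE rev_ordK. Qed.

Lemma w0M z : (z * w0 l * w0 l)%g = z.
Proof. by rewrite -{2}(w0V l) mulgK. Qed.

Lemma len_w0_sub z : N = (len (fin_aff z) + len (fin_aff z * W)%g)%N.
Proof.
rewrite -fin_affM addnC; symmetry.
apply: (len_stab_sub (@weakly_inc0 l)) => [|p q pq _]; first exact: place_perm0.
exact: w0_anti.
Qed.

Lemma w0_tr mu : weakly_dec mu ->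
  Hn W * b (Hn (tr (reverse mu))) = b (Hn (tr mu)) * Hn W.
Proof.
move=> dm.
have E : Hn (tr (reverse mu)) * Hn W = Hn W * Hn (tr mu).
  have lt : len (tr (reverse mu) * W)%g = (len (tr (reverse mu)) + N)%N.
    apply: len_tr_fin_inc => p q pq; rewrite !ffunE; apply: dm => /=.
    by have := ltn_ord p; have := ltn_ord q; lia.
  have e : (tr (reverse mu) * W)%g = (w0 l, mu).
    by rewrite tr_fin place_perm_w0 reverseK.
  have lW : len (W * tr mu)%g = (N + len (tr mu))%N by rewrite fin_tr len_dec.
  by rewrite (HnM hH lt) (HnM hH lW) e fin_tr.
have WV : Hn W * b (Hn W) = 1.
  by have := HnVb hb W; rewrite -fin_affV w0V.
have VW : b (Hn W) * Hn W = 1.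
  by have := bHnV hb W; rewrite -fin_affV w0V.
have {E} := congr1 b E; rewrite !(bM hH hb) => E.
by rewrite -[RHS]mul1r -WV -mulrA (mulrA (b (Hn W))) -E -!mulrA VW mulr1.
Qed.

Variables (i : Zl l) (hi : in_alcove n i).
Local Notation block_sum := (block_sum TH i).

Let iinc : weakly_inc i. Proof. by case: hi. Qed.
Let ibox : in_box n i. Proof. by case: hi. Qed.

Lemma block_sum_rev a : b (block_sum a) * Hn W = v N%:Z *: block_sum (reverse a).
Proof.
rewrite !block_sumE (b_sum hb) mulr_suml scaler_sumr [RHS](reindex_inj (mulIg (w0 l))) /=.
apply: eq_big => [z|z _].
  rewrite -!place_perm_w0 place_permM; apply/eqP/eqP => [-> //|E].
  by rewrite -[z]w0M place_permM place_permM E !place_perm_w0 reverseK.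
rewrite (bZ hb) lbar_vpow opprK -scalerAl (bHn_cancel hH hb (len_w0_sub z)) scalerA.
rewrite -vpowD fin_affM; have := len_w0_sub z.
by move: (Hn _) (len (fin_aff z)) (len (fin_aff z * W)%g) N => h p q r ->; congr (v _ *: _); lia.
Qed.

Lemma box_reverse j : box_rep n (reverse j) = reverse (box_rep n j) /\
  box_quo n (reverse j) = reverse (box_quo n j).
Proof. by split; apply/ffunP => k; rewrite !ffunE. Qed.

Lemma ainv_rev a : (ainv a + ainv (reverse a) =
  \sum_(p : 'I_l * 'I_l | (p.1 < p.2)%N) (a p.1 != a p.2))%N.
Proof.
have -> : ainv (reverse a) = (\sum_(p : 'I_l * 'I_l | (p.1 < p.2)%N) (a p.1 < a p.2)%R)%N.
  rewrite /ainv; transitivity (\sum_(p : 'I_l * 'I_l | (p.1 < p.2)%N)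
    (a ((w0 l)^-1%g p.2) < a ((w0 l)^-1%g p.1))%R)%N.
    by apply: eq_bigr => p _; rewrite !ffunE w0V !w0E.
  rewrite (sum_pairs_perm (fun p q => (a q < a p)%R : nat)); apply: eq_bigr => p pq.
  by rewrite ltnNge (ltnW (w0_anti pq)).
rewrite /ainv -big_split /=; apply: eq_bigr => p _.
by case: ltgtP.
Qed.

Lemma alphaE j : alpha n j = (ainv (box_rep n j) + ainv (reverse (box_rep n j)))%N.
Proof.
rewrite ainv_rev /alpha -sum1_card (eq_bigl (fun p : 'I_l * 'I_l =>
  (p.1 < p.2)%N && (j p.1 != j p.2 %[mod n])%Z)) => [|p]; last by rewrite inE.
rewrite big_mkcondr; apply: eq_bigr => p _ /=; rewrite !ffunE eqr_opp.
have -> : ((- j p.1) %% n == (- j p.2) %% n)%Z = (j p.1 == j p.2 %[mod n])%Z.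
  by rewrite !eqz_mod_dvd opprK addrC -opprB rpredN.
by case: eqP.
Qed.

Lemma alpha_len j u0 z : place_perm i z = box_rep n j -> place_perm i u0 = i ->
  (forall p q : 'I_l, (p < q)%N -> i p = i q -> (u0 q < u0 p)%N) ->
  (alpha n j + len (fin_aff u0))%N = N.
Proof.
move=> E su du; rewrite alphaE ainv_rev -E (ninv_u0 iinc su du).
rewrite (ninv_u0 (@weakly_inc0 l) (u0 := w0 l) (place_perm0 _)) => [|p q pq _]; last exact: w0_anti.
transitivity (\sum_(p : 'I_l * 'I_l | (p.1 < p.2)%N) (i p.1 != i p.2) +
  \sum_(p : 'I_l * 'I_l | (p.1 < p.2)%N) (i p.1 == i p.2))%N.
  congr addn; under eq_bigr => p _ do rewrite !ffunE.
  rewrite (sum_pairs_perm (fun p q => (i p != i q) : nat)); apply: eq_bigr => p _.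
  by case: ifP => // _; rewrite eq_sym.
rewrite -big_split /=; apply: eq_bigr => p _; rewrite !ffunE eqxx.
by case: eqP.
Qed.

Variables (M : lmodType A) (ot : Zl l -> M) (hM : is_free_basis ot).
Local Notation Psi := (Psi n TH b i hM).

Lemma Psi_rev j : weakly_dec j -> Psi (ot (reverse j)) * antisym =
  ((-1) ^+ N * v (ainv (reverse (box_rep n j)))%:Z) *:
     (b (block_sum (box_rep n j) * Ed (box_quo n j)) * antisym).
Proof.
move=> dj; have dq := weakly_dec_box hn dj.
rewrite Psi_ot /Psi0; have [-> ->] := box_reverse j.
move: (box_rep n j) (box_quo n j) dq => a mu dq.
have E1 : theta (reverse mu) = b (Hn (tr (reverse mu))).
  rewrite -{1}[reverse mu]opprK (theta_decN hH hb) ?/Ei ?opprK // => p q pq.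
  rewrite !ffunE lerN2; apply: dq => /=; have := ltn_ord p; have := ltn_ord q; lia.
have E2 : block_sum (reverse a) = v (- N%:Z) *: (b (block_sum a) * Hn W).
  by rewrite block_sum_rev scalerA vpowVl scale1r.
rewrite E1 E2 -!scalerAl -(mulrA (b _)) (w0_tr dq) (bM hH hb) /Ed.
rewrite -!mulrA (antisym_w0 hH) -!scalerAr antisym_powN !scalerA.
have e : v (ainv (reverse a))%:Z * (v (- N%:Z) * ((-1) ^+ N * v N%:Z)) =
   (-1) ^+ N * v (ainv (reverse a))%:Z.
  exact: (compat_aux1 _ _ (vpowVl C N%:Z)).
by rewrite -e -!mulrA.
Qed.

Lemma block_sum_empty a : (forall z, place_perm i z <> a) -> block_sum a = 0.
Proof. by move=> h; rewrite block_sumE big1 // => z /eqP /h. Qed.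

Variable u0 : 'S_l.
Hypothesis (su0 : place_perm i u0 = i)
  (du0 : forall p q : 'I_l, (p < q)%N -> i p = i q -> (u0 q < u0 p)%N).
Local Notation L := (len (fin_aff u0)).

Lemma Psi_compat j : weakly_dec j ->
  ((-1) ^+ (l * l.-1)./2 * v (alpha n j)%:Z) *: (Psi (ot (reverse j)) * antisym) =
  v (4 * N%:Z - 2 * L%:Z) *: b (Psi (ot j) * antisym).
Proof.
move=> dj; rewrite (Psi_rev dj) (Psi_dec hn hH hb i hM dj) -len_w0.
rewrite -scalerAl (bZ hb) lbar_vpow [in RHS](bM hH hb) (b_antisym hn hH hb) -scalerAr !scalerA.
have [[z Ez]|nz] := pselect (exists z, place_perm i z = box_rep n j); last first.
  by rewrite block_sum_empty ?mul0r ?(b0 hb) ?mul0r ?scaler0 // => z Ez; apply: nz; exists z.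
have e1 := alpha_len Ez su0 du0; have e2 := alphaE j.
have -> : (-1) ^+ N * v (alpha n j) * ((-1) ^+ N * v (ainv (reverse (box_rep n j)))) =
   v ((alpha n j)%:Z + (ainv (reverse (box_rep n j)))%:Z).
  by rewrite vpowD; apply: compat_aux2; rewrite -expr2 sqrr_sign.
rewrite -!vpowD; move: (b _ * antisym) e1 e2 => g e1 e2.
congr (v _ *: _); lia.
Qed.

End Compat.

(** * Uniqueness and the coordinates of the canonical bases *)

Section Uniqueness.
Variables (C : comNzRingType) (l n : nat) (hn : (0 < n)%N).
Local Notation A := (laurent C).
Local Notation v := (vpow C).
Local Notation qz := (qz C).
Variables (H : algType A) (TH : affS l -> H) (hH : is_iwahori_hecke TH).
Local Notation Hn := (Hn TH).
Local Notation ch := (ch hH).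
Variables (b : H -> H) (hb : is_hecke_bar TH b).
Implicit Types (w x y t : affS l) (u z : 'S_l) (g h : H) (a j mu nu lam : Zl l).
Variables (i : Zl l) (hi : in_alcove n i).

Let iinc : weakly_inc i. Proof. by case: hi. Qed.
Let ibox : in_box n i. Proof. by case: hi. Qed.

Definition block_min y := forall j k : 'I_l, k = j.+1 :> nat -> i j = i k ->
  hat (y^-1)%g j < hat (y^-1)%g k.

Variable u0 : 'S_l.
Hypothesis (su0 : place_perm i u0 = i)
  (du0 : forall p q : 'I_l, (p < q)%N -> i p = i q -> (u0 q < u0 p)%N).
Local Notation L := (len (fin_aff u0)).

Lemma vV_eq0 k (p : A) : v k * p = 0 -> p = 0.
Proof. by move=> h; rewrite -[p]mul1r -(vpowVl C k) -mulrA h mulr0. Qed.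

Lemma block_min_asc (f : 'I_l -> int) :
  (forall j k : 'I_l, k = j.+1 :> nat -> i j = i k -> f k < f j) ->
  forall j k : 'I_l, k = j.+1 :> nat -> i j = i k -> f ((u0^-1)%g j) < f ((u0^-1)%g k).
Proof.
move=> hf j k kj ij; have si p : i ((u0^-1)%g p) = i p by rewrite -{2}su0 ffunE.
have lt : ((u0^-1)%g k < (u0^-1)%g j)%N.
  rewrite ltnNge leq_eqVlt; apply/negP => /predU1P[/val_inj/perm_inj E|h].
    by move: kj; rewrite E; lia.
  by have := du0 h; rewrite !si !permKV => /(_ ij); lia.
rewrite -ltrN2; apply: (block_chain iinc (f := fun p => - f p)) lt _; last by rewrite !si.
by move=> p q qp ipq; rewrite ltrN2; apply: hf.
Qed.

(* The coefficient of maximal length of [beta] is a power of [v] times the one at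
   the block-minimal element of its [S_i]-coset; bar invariance kills the latter. *)
Lemma eigen_unique (D : A -> Prop) (hD : half_space D) beta :
  (forall j k : 'I_l, k = j.+1 :> nat -> i j = i k ->
     Hn (fin_aff (tperm j k)) * beta = v (-1) *: beta) ->
  (forall j k : 'I_l, k = j.+1 :> nat ->
     beta * Hn (fin_aff (tperm j k)) = - v 1 *: beta) ->
  b beta = v (2 * L%:Z) *: beta ->
  (forall y, block_min y -> strictly_decreasing (aff_act n i y) -> D (ch y beta)) ->
  beta = 0.
Proof.
move=> hl hr bb hc; apply: contrapT => nz.
have [Y [Ynz Ytop]] := ex_top hH nz.
have Yl (j k : 'I_l) : k = j.+1 :> nat -> i j = i k -> hat (Y^-1)%g k < hat (Y^-1)%g j.
  move=> kj ij; have st := simple_fin kj; apply/(len_fin_desc _ kj).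
  have := congr1 (ch Y) (hl j k kj ij); rewrite (ch_mulSL hH _ _ st) chZ /dl.
  have E : len (Y^-1 * fin_aff (tperm j k))%g = len (fin_aff (tperm j k) * Y)%g.
    by rewrite -len_inv invMg invgK (simpleV st).
  rewrite E len_inv; case: (len_simpleL Y st) => // El.
  rewrite El ltnNge leqnSn mul0r addr0 => E'.
  have /Ytop : ch (fin_aff (tperm j k) * Y)%g beta != 0.
    by rewrite E'; apply: contraNneq Ynz => /vV_eq0 ->.
  by rewrite El ltnn.
have Yr (j k : 'I_l) : k = j.+1 :> nat -> len Y = (len (Y * fin_aff (tperm j k))%g).+1.
  move=> kj; have st := simple_fin kj.
  have := congr1 (ch Y) (hr j k kj); rewrite (ch_mulS hH _ _ st) chZ /dr.
  case: (len_simple Y st) => // El.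
  rewrite El ltnNge leqnSn mul0r addr0 => E'.
  have /Ytop : ch (Y * fin_aff (tperm j k))%g beta != 0.
    by rewrite E' mulNr oppr_eq0; apply: contraNneq Ynz => /vV_eq0 ->.
  by rewrite El ltnn.
pose y := ((fin_aff u0)^-1 * Y)%g; pose g := ch y beta.
have YE : Y = (fin_aff u0 * y)%g by rewrite mulKVg.
have ymin : block_min y.
  move=> j k kj ij; rewrite /y invMg invgK !hat_fin.
  exact: (block_min_asc Yl kj ij).
have chy u : place_perm i u = i -> ch (fin_aff u * y)%g beta = v (- (len (fin_aff u))%:Z) * g.
  move=> su; have suV := place_permV su.
  have := ch_stab_mul hH iinc ymin suV beta.
  rewrite -fin_affV invgK => <-.
  by rewrite (eigen_left hH iinc hl suV) chZ fin_affV len_inv vpowX mulN1r.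
have actY : aff_act n i Y = aff_act n i y.
  by rewrite YE aff_actM; congr aff_act; apply/(stabE hn hi); exists u0.
have iYdec : strictly_decreasing (aff_act n i y).
  have adj (j k : 'I_l) : k = j.+1 :> nat -> aff_act n i Y k < aff_act n i Y j.
    move=> kj; have hY := (len_fin_desc Y kj).1 (Yr j k kj).
    have := act_le hn hi hY; rewrite le_eqVlt => /predU1P[/esym E|//]; exfalso.
    set s := fin_aff (tperm j k).
    have Es : aff_act n i (Y * s)%g = aff_act n i Y.
      by rewrite aff_actM {1}/aff_act /= mul0rn addr0 place_perm_tperm.
    have /(stabE hn hi)[u su Eu] : stab n i (Y * s * Y^-1)%g.
      by rewrite /stab aff_actM Es -aff_actM mulgV /aff_act /= mul0rn addr0 place_perm1.
    have EYs : (Y * s)%g = (fin_aff (u * u0)%g * y)%g.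
      by rewrite fin_affM -mulgA -YE -Eu mulgKV.
    have suu : place_perm i (u * u0)%g = i by rewrite place_permM su su0.
    have l1 := len_stab_mul iinc su0 ymin; have l2 := len_stab_mul iinc suu ymin.
    have l3 := Yr j k kj; rewrite -/s EYs l2 YE l1 in l3.
    have st := simple_fin kj.
    have := congr1 (ch (Y * s)%g) (hr j k kj).
    rewrite (ch_mulS hH _ _ st) chZ -mulgA (simple_sq st) mulg1 /dr.
    rewrite -mulgA (simple_sq st) mulg1 (Yr j k kj) -/s [(_ < _)%N]ltnNge leqnSn mul0r addr0.
    rewrite {1}YE EYs !chy // => E'.
    move: Ynz; rewrite YE chy // => /negP; apply; apply/eqP.
    have -> : g = 0; last by rewrite mulr0.
    apply: (@vpow2_regular _ 2) => //; apply: (@vV_eq0 (- L%:Z)).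
    rewrite mulrDl mul1r mulrDr E'.
    have -> : v (- L%:Z) * (v 2 * g) = v 1 * (v (- (len (fin_aff (u * u0)%g))%:Z) * g).
      by rewrite !mulrA -!vpowD; congr (v _ * g); lia.
    by rewrite mulNr addNr.
  move=> j k jk; rewrite -actY -ltrN2.
  apply: (block_chain (@weakly_inc0 l) (f := fun p => - aff_act n i Y p)) jk _; last by rewrite !ffunE.
  by move=> p q qp _; rewrite ltrN2; apply: adj.
have E := ch_bar hb Ytop; rewrite bb chZ YE chy // lbarM lbar_vpow opprK in E.
have gE : lbar g = g.
  have := congr1 (fun p => v (- L%:Z) * p) E; rewrite !mulrA -!vpowD.
  rewrite (_ : _ + _ + _ = 0); last by lia.
  by rewrite addNr !vpow0 !mul1r.
have g0 : g = 0 := hs_bar hD (hc y ymin iYdec) gE.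
by move: Ynz; rewrite YE chy // g0 mulr0 eqxx.
Qed.

End Uniqueness.

Lemma sign_sqr_mul (R : comPzRingType) (p q r : R) : p * p = 1 -> q * q = r ->
  p * q * (p * q) = r.
Proof. by move=> h <-; rewrite mulrACA h mul1r. Qed.

Section BlockMin.
Variables (l : nat) (i : Zl l) (iinc : weakly_inc i).
Implicit Types (y x : affS l) (u z : 'S_l) (j : Zl l).

Lemma strictly_weakly_dec j : strictly_decreasing j -> weakly_dec j.
Proof.
by move=> h p q; rewrite leq_eqVlt => /predU1P[/val_inj ->//|/h/ltW].
Qed.

Lemma block_min_chain y (p q : 'I_l) : block_min i y -> (p < q)%N -> i p = i q ->
  hat (y^-1)%g p < hat (y^-1)%g q.
Proof. by move=> hy; apply: block_chain. Qed.

Lemma block_min_uniq y u : place_perm i u = i -> block_min i y ->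
  block_min i (fin_aff u * y)%g -> u = 1%g.
Proof.
move=> su h1 h2; have si p : i (u p) = i p by rewrite -{1}su ffunE permK.
apply: no_inv_eq1 => p q pq; rewrite ltnNge leq_eqVlt; apply/negP => /predU1P[|].
  by move=> /val_inj/perm_inj E; rewrite E ltnn in pq.
move=> inv; have ipq := stab_inv iinc su pq inv.
have := block_min_chain h2 pq ipq; rewrite invMg -fin_affV !hat_fin invgK.
have := block_min_chain h1 inv; rewrite !si => /(_ (esym ipq)) h /(lt_trans h).
by rewrite ltxx.
Qed.

Lemma ex_block_min y : exists u, place_perm i u = i /\ block_min i (fin_aff u * y)%g.
Proof.
pose S := [pred u : 'S_l | place_perm i u == i].
have S1 : S 1%g by rewrite /= place_perm1.
case: (@arg_minnP _ 1%g S (fun u => len (fin_aff u * y)%g) S1) => u /eqP su umin.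
exists u; split=> // j k kj ij; have st := simple_fin kj.
apply/(len_fin_asc _ kj); have := umin (u * tperm j k)%g.
have := umin (tperm j k * u)%g.
rewrite /= place_permM place_perm_tperm // su eqxx => /(_ isT).
rewrite fin_affM -mulgA => le _.
have E w : len (w^-1 * fin_aff (tperm j k))%g = len (fin_aff (tperm j k) * w)%g.
  by rewrite -len_inv invMg invgK (simpleV st).
rewrite E len_inv; case: (len_simpleL (fin_aff u * y)%g st) => // E'.
by rewrite E' ltnn in le.
Qed.

Lemma ainv_block_min y : block_min i y -> weakly_dec y.2 ->
  len (fin_aff y.1) = ainv (place_perm i y.1).
Proof.
case: y => z m /= hy dm.
rewrite lenE alen_fin /ninv /ainv.
under [in RHS]eq_bigr => p _ do rewrite !ffunE.
rewrite (sum_pairs_perm (fun p q => (i q < i p)%R : nat)).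
apply: eq_bigr => -[p q] /= pq; case: ltngtP => [h|h|/val_inj/perm_inj E].
- case: (boolP (i p < i q)) => //=; rewrite -leNgt => le.
  have ipq : i p = i q by apply/eqP; rewrite eq_le le iinc ?(ltnW pq).
  have := block_min_chain hy pq ipq; rewrite /hat /= !ffunE invgK.
  have := dm _ _ (ltnW h); move: (m _) (m _) => a c; nia.
- by rewrite ltNge iinc // ltnW.
- by rewrite E ltnn in pq.
Qed.

Lemma dec_perm_eq1 j u : strictly_decreasing j -> strictly_decreasing (place_perm j u) ->
  u = 1%g.
Proof.
move=> h1 h2; apply/eqP; rewrite -eq_invg1; apply/eqP; apply: no_inv_eq1 => p q pq.
rewrite ltnNge leq_eqVlt; apply/negP => /predU1P[/val_inj/perm_inj E|/h1].
  by rewrite E ltnn in pq.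
by have := h2 p q pq; rewrite !ffunE => h /(lt_trans h); rewrite ltxx.
Qed.

Lemma part_rho j : is_part j -> strictly_decreasing (j + rho l).
Proof.
move=> [h _] p q pq; rewrite !ffunE; have := h p q (ltnW pq).
by move: (j p) (j q) => e f; move: pq; lia.
Qed.

Lemma len_fin_gt0 u : u <> 1%g -> (0 < len (fin_aff u))%N.
Proof.
move=> nu; rewrite lt0n; apply/eqP; rewrite lenE alen_fin => E; apply: nu.
apply: no_inv_eq1 => p q pq; rewrite ltnNge leq_eqVlt; apply/negP => /predU1P[|inv].
  by move=> /val_inj/perm_inj E'; rewrite E' ltnn in pq.
by move/eqP: E; rewrite /ninv (bigD1 (p, q)) //= inv.
Qed.

End BlockMin.

Section Coefficients.
Variables (C : comNzRingType) (l n : nat) (hn : (0 < n)%N).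
Local Notation A := (laurent C).
Local Notation v := (vpow C).
Variables (H : algType A) (TH : affS l -> H) (hH : is_iwahori_hecke TH).
Local Notation Hn := (Hn TH).
Local Notation ch := (ch hH).
Variables (b : H -> H) (hb : is_hecke_bar TH b).
Local Notation antisym := (antisym TH).
Implicit Types (w x y t : affS l) (u z : 'S_l) (g h : H) (a j mu nu lam : Zl l).
Local Notation W := (fin_aff (w0 l)).
Local Notation N := (len W).
Variables (M L : lmodType A) (ot : Zl l -> M) (hM : is_free_basis ot).
Variables (T X XV : 'I_l -> {linear M -> M}) (hT : is_hecke_action ot T X XV n).
Variables (pi : {linear M -> L}) (hL : is_wedge_quotient T pi).
Variables (psi : L -> L) (hpsi : is_wedge_bar ot pi n psi).
Implicit Types (c : {malg A[Zl l]}).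
Local Notation ket := (ket ot pi).

Definition ot_lift c : M := lcomb (fun mu => ot (mu + rho l)) c.

Lemma pi_lift c : pi (ot_lift c) = lcomb ket c.
Proof.
rewrite /ot_lift /lcomb linear_sum; apply: eq_bigr => mu _; exact: linearZ.
Qed.

Lemma psi_sum (J : Type) (r : seq J) (F : J -> L) :
  psi (\sum_(k <- r) F k) = \sum_(k <- r) psi (F k).
Proof.
apply: (big_morph psi (wb_add hpsi)).
by have := wb_scale hpsi 0 0; rewrite lbar0 !scale0r.
Qed.

Section Orbit.
Variables (i : Zl l) (hi : in_alcove n i).
Local Notation Psi := (Psi n TH b i hM).

Let iinc : weakly_inc i. Proof. by case: hi. Qed.
Let ibox : in_box n i. Proof. by case: hi. Qed.

Lemma Psi_sum (J : Type) (r : seq J) (F : J -> M) :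
  Psi (\sum_(k <- r) F k) = \sum_(k <- r) Psi (F k).
Proof. exact: (big_morph _ (PsiD n TH b i hM) (Psi0r n TH b i hM)). Qed.

Lemma ch_Psi_antisym y j : block_min i y -> strictly_decreasing (aff_act n i y) ->
  strictly_decreasing j ->
  ch y (Psi (ot j) * antisym) = v (2 * N%:Z) * (aff_act n i y == j)%:R.
Proof.
move=> hy dy dj.
have hyd (p q : 'I_l) : q = p.+1 :> nat -> hat y q < hat y p.
  by move=> pq; apply: (act_lt hn hi); apply: dy; rewrite pq.
rewrite (ch_antisym hn hH _ hyd).
under eq_bigr => u _ do rewrite (ch_Psi hn hH hb hi hM _ (strictly_weakly_dec dj)) !aff_actM.
rewrite (bigD1 (w0 l)) //= big1 ?addr0 => [|u nu]; last first.
  case: eqP => [E|_]; last by rewrite mulr0.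
  move/negP: nu; case; apply/eqP; apply: (mulIg (u^-1)%g).
  rewrite mulgV; symmetry; apply: (dec_perm_eq1 dy).
  by rewrite -fin_affV -aff_actM -fin_affM /aff_act /= mul0rn addr0 in E; rewrite E.
rewrite -!aff_actM mulgK mulgV mulg1; case: (aff_act n i y =P j) => [E|_]; last by rewrite !mulr0.
have [e1 e2] := (aff_act_eqE hn hi y j).1 E.
rewrite (ainv_block_min iinc hy); last by rewrite e2; apply/weakly_dec_box/strictly_weakly_dec.
rewrite e1 subrr vpow0 !mulr1 antisym_powN; apply: sign_sqr_mul; first by rewrite -expr2 sqrr_sign.
by rewrite -vpowD; congr v; lia.
Qed.

Lemma Psi_lift c : Psi (ot_lift c) = \sum_(mu <- msupp c) c@_mu *: Psi (ot (mu + rho l)).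
Proof. by rewrite /ot_lift /lcomb Psi_sum; apply: eq_bigr => mu _; rewrite PsiZ. Qed.

Definition wvec c : H := v (- (2 * N%:Z)) *: (Psi (ot_lift c) * antisym).

Lemma ch_wvec y c : block_min i y -> strictly_decreasing (aff_act n i y) ->
  (forall mu, mu \in msupp c -> is_part mu) ->
  ch y (wvec c) = c@_(aff_act n i y - rho l).
Proof.
move=> hy dy hc; rewrite /wvec chZ Psi_lift mulr_suml ch_sum.
have term mu : mu \in msupp c -> ch y (c@_mu *: Psi (ot (mu + rho l)) * antisym) =
    v (2 * N%:Z) * (if mu == aff_act n i y - rho l then c@_mu else 0).
  move=> /hc /part_rho dm; rewrite -scalerAl chZ (ch_Psi_antisym hy dy dm) mulrCA; congr (_ * _).
  have -> : (aff_act n i y == mu + rho l) = (mu == aff_act n i y - rho l).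
    by apply/eqP/eqP => ->; rewrite ?addrK ?subrK.
  by case: eqP => _; rewrite ?mulr1 ?mulr0.
rewrite big_seq; under eq_bigr => mu hmu do rewrite (term mu hmu).
rewrite -big_seq -mulr_sumr mulrA vpowVl mul1r.
set nu := _ - _; case: (boolP (nu \in msupp c)) => [h|h].
  rewrite (bigD1_seq nu) ?fset_uniq //= eqxx big1 ?addr0 // => k /negPf -> //.
rewrite (mcoeff_outdom h) big_seq big1 // => k hk; case: eqP => // E.
by rewrite E (negPf h) in hk.
Qed.

Lemma wvec_eq c c' : lcomb ket c = lcomb ket c' -> wvec c = wvec c'.
Proof.
move=> E; rewrite /wvec; congr (_ *: _).
apply/eqP; rewrite -subr_eq0 -mulrBl; apply/eqP.
have -> : Psi (ot_lift c) - Psi (ot_lift c') = Psi (ot_lift c - ot_lift c').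
  by rewrite PsiD -scaleN1r PsiZ scaleN1r.
by apply: (Psi_omega hn hH hb hi hM hT hL); rewrite linearB !pi_lift E /= subrr.
Qed.

Lemma wvec_left c (j k : 'I_l) : k = j.+1 :> nat -> i j = i k ->
  Hn (fin_aff (tperm j k)) * wvec c = v (-1) *: wvec c.
Proof.
move=> kj ij; rewrite /wvec -scalerAr mulrA (Psi_left hn hH b hM _ kj ij) -scalerAl.
exact: scalerC.
Qed.

Lemma wvec_right c (j k : 'I_l) : k = j.+1 :> nat ->
  wvec c * Hn (fin_aff (tperm j k)) = - v 1 *: wvec c.
Proof.
move=> kj; rewrite /wvec -scalerAl -mulrA (antisym_right hH kj) -scalerAr.
exact: scalerC.
Qed.

Variable u0 : 'S_l.
Hypothesis (su0 : place_perm i u0 = i)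
  (du0 : forall p q : 'I_l, (p < q)%N -> i p = i q -> (u0 q < u0 p)%N).
Local Notation L0 := (len (fin_aff u0)).

Lemma b_wvec c : (forall mu, mu \in msupp c -> is_part mu) ->
  psi (lcomb ket c) = lcomb ket c -> b (wvec c) = v (2 * L0%:Z) *: wvec c.
Proof.
move=> hc fix_c.
pose e mu : A := (-1) ^+ (l * l.-1)./2 * v (alpha n (mu + rho l))%:Z.
pose u' : M := \sum_(mu <- msupp c) (lbar c@_mu * e mu) *: ot (reverse (mu + rho l)).
have piu' : pi u' = lcomb ket c.
  rewrite -[RHS]fix_c /lcomb psi_sum /u' linear_sum big_seq [RHS]big_seq.
  apply: eq_bigr => mu hmu; rewrite linearZ (wb_scale hpsi) (wb_wedge hpsi) ?scalerA //.
  exact/part_rho/hc.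
have E1 : Psi (ot_lift c) * antisym = Psi u' * antisym.
  apply/eqP; rewrite -subr_eq0 -mulrBl; apply/eqP.
  have -> : Psi (ot_lift c) - Psi u' = Psi (ot_lift c - u').
    by rewrite PsiD -scaleN1r PsiZ scaleN1r.
  by apply: (Psi_omega hn hH hb hi hM hT hL); rewrite linearB /= pi_lift piu' subrr.
have E2 : Psi u' * antisym = v (4 * N%:Z - 2 * L0%:Z) *: b (Psi (ot_lift c) * antisym).
  rewrite Psi_lift mulr_suml (b_sum hb) scaler_sumr /u' Psi_sum mulr_suml.
  rewrite big_seq [RHS]big_seq; apply: eq_bigr => mu hmu.
  rewrite PsiZ -!scalerAl (bZ hb) scalerC -(Psi_compat hn hH hb hi hM su0 du0); last first.
    exact/strictly_weakly_dec/part_rho/hc.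
  by rewrite scalerA.
have {E1 E2} := etrans E1 E2; rewrite /wvec; move: (Psi _ * antisym) => g E.
by rewrite (bZ hb) lbar_vpow opprK [in RHS]E !scalerA -!vpowD; congr (v _ *: _); lia.
Qed.

Lemma coeff_unique (D : A -> Prop) (hD : half_space D) beta c :
  (forall mu, mu \in msupp c -> is_part mu) -> psi (lcomb ket c) = lcomb ket c ->
  (forall j k : 'I_l, k = j.+1 :> nat -> i j = i k ->
     Hn (fin_aff (tperm j k)) * beta = v (-1) *: beta) ->
  (forall j k : 'I_l, k = j.+1 :> nat ->
     beta * Hn (fin_aff (tperm j k)) = - v 1 *: beta) ->
  b beta = v (2 * L0%:Z) *: beta ->
  (forall y, block_min i y -> strictly_decreasing (aff_act n i y) ->
     D (c@_(aff_act n i y - rho l) - ch y beta)) ->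
  forall y, block_min i y -> strictly_decreasing (aff_act n i y) ->
     c@_(aff_act n i y - rho l) = ch y beta.
Proof.
move=> hc fix_c hl hr bb hD' y hy dy; rewrite -(ch_wvec hy dy hc).
apply/eqP; rewrite -subr_eq0 -chN -chD; apply/eqP.
suff -> : wvec c - beta = 0 by rewrite ch0.
apply: (eigen_unique hn (hH := hH) hb hi su0 du0 hD) => [j k kj ij|j k kj||y' hy' dy'].
- by rewrite mulrBr hl // wvec_left // scalerBr.
- by rewrite mulrBl hr // wvec_right // scalerBr.
- by rewrite (bD hb) (bN hb) bb b_wvec // scalerBr.
by rewrite chD chN (ch_wvec hy' dy' hc); apply: hD'.
Qed.

End Orbit.

Lemma ex_orbit j : exists i y, [/\ in_alcove n i, block_min i y & aff_act n i y = j].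
Proof.
have [i [u [hi E]]] := ex_alcove hn j.
have [u' [su' hy]] := ex_block_min i (u, box_quo n j).
exists i, (fin_aff u' * (u, box_quo n j))%g; split=> //.
by rewrite aff_actM {2}/aff_act /= su' mul0rn addr0; apply/(aff_act_eqE hn hi).
Qed.

Lemma ket_inj c c' : (forall mu, mu \in msupp c -> is_part mu) ->
  (forall mu, mu \in msupp c' -> is_part mu) -> lcomb ket c = lcomb ket c' -> c = c'.
Proof.
move=> hc hc' E; apply/malgP => mu.
have [pm|npm] := pselect (is_part mu); last first.
  by rewrite !mcoeff_outdom //; apply/negP; [move/hc'|move/hc].
have [i [y [hi hy Ey]]] := ex_orbit (mu + rho l).
have dy : strictly_decreasing (aff_act n i y) by rewrite Ey; apply: part_rho.
have := congr1 (ch y) (wvec_eq hi E).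
by rewrite !(ch_wvec hi hy dy) // Ey addrK.
Qed.

End Coefficients.

Lemma beta_pos_aux (R : comPzRingType) (s q p p' q' S : R) :
  q * q' = 1 -> p' * p = 1 -> s * s = 1 -> q * (s * (p' * q') * (s * p * S)) = S.
Proof.
move=> h1 h2 h3; rewrite -[RHS]mul1r -[in RHS]h1 -[q * q']mulr1 -[in RHS]h2.
rewrite -[p' * p]mulr1 -[in RHS]h3; ring.
Qed.

Lemma kl_term_aux (R : comPzRingType) (s p q r t : R) :
  p * q = t -> s * p * (q * r) = t * (s * r).
Proof. by move=> <-; ring. Qed.

Lemma vneg_vpow (C : comNzRingType) k : k < 0 -> vneg (vpow C k).
Proof.
by move=> k0; rewrite -[k]opprK -lbar_vpow; apply/lbar_vneg/vpos_vpow; rewrite oppr_gt0.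
Qed.

Section Canonical.
Variables (C : comNzRingType) (l n : nat) (hn : (0 < n)%N).
Local Notation A := (laurent C).
Local Notation v := (vpow C).
Variables (H : algType A) (TH : affS l -> H) (hH : is_iwahori_hecke TH).
Local Notation Hn := (Hn TH).
Local Notation ch := (ch hH).
Variables (b : H -> H) (hb : is_hecke_bar TH b).
Local Notation antisym := (antisym TH).
Implicit Types (w x y t : affS l) (u z : 'S_l) (g h : H) (a j mu nu lam : Zl l).
Local Notation W := (fin_aff (w0 l)).
Local Notation N := (len W).
Variables (P : affS l -> affS l -> {poly int}).
Hypothesis P1 : forall x, P x x = 1.
Hypothesis P0 : forall y x, ~ bruhat y x -> P y x = 0.
Hypothesis Pdeg : forall y x, bruhat y x -> y <> x ->
  ((size (P y x)).-1.*2 < len x - len y)%N.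
Local Notation Cp := (kl_elt TH P).
Local Notation Cm := (Cm hH P).
Hypothesis bCp : forall x, b (Cp x) = Cp x.
Variables (M L : lmodType A) (ot : Zl l -> M) (hM : is_free_basis ot).
Variables (T X XV : 'I_l -> {linear M -> M}) (hT : is_hecke_action ot T X XV n).
Variables (pi : {linear M -> L}) (hL : is_wedge_quotient T pi).
Variables (psi : L -> L) (hpsi : is_wedge_bar ot pi n psi).
Local Notation ket := (ket ot pi).

Variables (D : A -> Prop) (hD : half_space D) (lam : Zl l) (c : {malg A[Zl l]}).
Hypothesis hlam : is_part lam.
Hypothesis hc : forall mu, mu \in msupp c -> is_part mu.
Hypothesis fix_c : psi (lcomb ket c) = lcomb ket c.
Hypothesis hcD : forall mu, D (c@_mu - (lam == mu)%:R).

Lemma coeff_other_orbit i y : in_alcove n i -> (forall w, aff_act n i w <> lam + rho l) ->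
  block_min i y -> strictly_decreasing (aff_act n i y) -> c@_(aff_act n i y - rho l) = 0.
Proof.
move=> hi no hy dy; have [u0 su0 du0] := ex_u0 hi.1.
rewrite -(ch0 hH y).
refine (coeff_unique hn (hH:=hH) hb hM hT hL hpsi hi su0 du0 hD (beta:=0) hc fix_c _ _ _ _ hy dy).
- by move=> j k _ _; rewrite mulr0 scaler0.
- by move=> j k _; rewrite mul0r scaler0.
- by rewrite (b0 hb) scaler0.
move=> y' _ _; rewrite ch0 subr0; have := hcD (aff_act n i y' - rho l).
by case: eqP => [E|_]; rewrite ?subr0 //; case: (no y'); rewrite E subrK.
Qed.

Section SameOrbit.
Variables (i : Zl l) (hi : in_alcove n i) (x : affS l).
Hypothesis (hx : block_min i x) (ix : aff_act n i x = lam + rho l).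

Let iinc : weakly_inc i. Proof. by case: hi. Qed.

Let xdec : strictly_decreasing (aff_act n i x).
Proof. by rewrite ix; apply: part_rho. Qed.

Lemma hat_dec y (j k : 'I_l) : strictly_decreasing (aff_act n i y) ->
  k = j.+1 :> nat -> hat y k < hat y j.
Proof. by move=> dy kj; apply: (act_lt hn hi); apply: dy; rewrite kj. Qed.

Lemma same_orbit y : block_min i y -> (lam == aff_act n i y - rho l) = (y == x).
Proof.
move=> hy; apply/eqP/eqP => [E|->]; last by rewrite ix addrK.
have /(stabE hn hi)[u su E'] : stab n i (y * x^-1)%g.
  rewrite /stab aff_actM; have -> : aff_act n i y = aff_act n i x by rewrite ix E subrK.
  by rewrite -aff_actM mulgV /aff_act /= mul0rn addr0 place_perm1.
have Ey : y = (fin_aff u * x)%g by rewrite -E' mulgKV.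
have u1 : u = 1%g by apply: (block_min_uniq iinc su hx); rewrite -Ey.
by rewrite Ey u1 fin_aff1 mul1g.
Qed.

Lemma coeff_no_orbit mu : is_part mu -> (forall w, aff_act n i w <> mu + rho l) -> c@_mu = 0.
Proof.
move=> pm no; have [i' [y [hi' hy Ey]]] := ex_orbit hn (mu + rho l).
have -> : mu = aff_act n i' y - rho l by rewrite Ey addrK.
apply: coeff_other_orbit hi' _ hy _ => [w Ew|]; last by rewrite Ey; apply: part_rho.
apply: (no (x * (w^-1 * y)))%g; rewrite aff_actM ix -Ew -aff_actM mulKVg.
exact: Ey.
Qed.

Let cc' : v (-1) * v 1 = 1. Proof. exact: vpowVl. Qed.
Let cq : v (-1) - v 1 = qz C. Proof. by rewrite qzE. Qed.
Let bc : lbar (v (-1)) = v 1. Proof. by rewrite lbar_vpow. Qed.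

Definition beta_neg : H := par_sum TH i (v (-1)) * Cm x.

Lemma ch_beta_neg y : block_min i y -> ch y beta_neg =
  \sum_(u : 'S_l | place_perm i u == i) v (- (len (fin_aff u))%:Z) * ch (fin_aff u * y)%g (Cm x).
Proof.
move=> hy; rewrite /beta_neg /par_sum mulr_suml ch_sum [RHS](reindex_inj invg_inj) /=.
apply: eq_big => [u|u /eqP su].
  by apply/eqP/eqP => [/place_permV //|/place_permV]; rewrite invgK.
rewrite -scalerAl chZ (ch_stab_mul hH iinc hy su) fin_affV len_inv vpowX mulN1r.
by [].
Qed.

Lemma coeff_neg : (forall p, D p <-> vneg p) -> forall y, block_min i y ->
  strictly_decreasing (aff_act n i y) -> c@_(aff_act n i y - rho l) =
  \sum_(u : 'S_l | place_perm i u == i) v (- (len (fin_aff u))%:Z) * ch (fin_aff u * y)%g (Cm x).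
Proof.
move=> hDn y hy dy; rewrite -ch_beta_neg //; have [u0 su0 du0] := ex_u0 iinc.
refine (coeff_unique hn (hH:=hH) hb hM hT hL hpsi hi su0 du0 hD (beta:=beta_neg) hc fix_c _ _ _ _ hy dy).
- move=> j k kj ij; rewrite /beta_neg mulrA (par_sum_left hH cc' cq kj ij).
  by rewrite scalerAl.
- move=> j k kj; rewrite /beta_neg -mulrA (Cm_right hH P1 P0 Pdeg hb bCp (simple_fin kj)).
    by rewrite scalerAr.
  by have /(len_fin_desc _ kj) -> := hat_dec xdec kj.
- rewrite /beta_neg (bM hH hb) (bCm hH hb bCp) (bar_par_sum hH iinc cc' cq su0 du0 hb bc).
  by rewrite vpowX scalerAl mul1r.
move=> {hy dy}y hy dy.
set mu := aff_act n i y - rho l.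
have -> : c@_mu - ch y beta_neg = (c@_mu - (lam == mu)%:R) - (ch y beta_neg - (lam == mu)%:R).
  by rewrite opprB addrA subrK.
apply: (hsD hD) => //; apply: (hsN hD); rewrite same_orbit // ch_beta_neg //.
rewrite (bigD1 1%g) /= ?place_perm1 // fin_aff1 len1 vpow0 mul1r mul1g addrAC.
have chD w : D (ch w (Cm x) - (w == x)%:R).
  case: eqP => [->|wx]; first by rewrite (ch_Cm_self hH P1 P0) subrr; apply: (hs0 hD).
  by rewrite subr0; apply/hDn; exact: (ch_Cm_vneg (hH:=hH) P0 Pdeg).
apply: (hsD hD) => //; apply: (half_sum hD) => u /andP[_ /eqP /len_fin_gt0 lu].
move: (chD (fin_aff u * y)%g); case: eqP => [->|_]; last first.
  by rewrite subr0 => /hDn h; apply/hDn/vneg_vpowM => //; lia.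
by move=> _; rewrite (ch_Cm_self hH P1 P0) mulr1; apply/hDn/vneg_vpow; lia.
Qed.

Variable u0 : 'S_l.
Hypothesis (su0 : place_perm i u0 = i)
  (du0 : forall p q : 'I_l, (p < q)%N -> i p = i q -> (u0 q < u0 p)%N).
Local Notation L0 := (len (fin_aff u0)).

(* [long y] has maximal length in its left [S_i]-coset and minimal length in its
   right [S_l]-coset. *)
Definition long y := (fin_aff u0 * y * W)%g.

Definition beta_pos : H := ((-1) ^+ N * v (- N%:Z - L0%:Z)) *: (Cp (long x) * antisym).

Lemma len_long u y : place_perm i u = i -> block_min i y ->
  strictly_decreasing (aff_act n i y) ->
  (len (fin_aff u * y * W)%g + N)%N = (len (fin_aff u) + len y)%N.
Proof.
move=> su hy dy; rewrite len_finB ?(len_stab_mul iinc su hy) // => p q pq _.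
apply: (act_lt hn hi); rewrite !aff_actM.
by have -> : aff_act n i (fin_aff u) = i; [apply/(stabE hn hi); exists u|apply: dy].
Qed.

Lemma hat_long y (j k : 'I_l) : strictly_decreasing (aff_act n i y) ->
  k = j.+1 :> nat -> hat (long y) j < hat (long y) k.
Proof.
move=> dy kj; rewrite /long !hat_fin w0V !w0E; apply: (act_lt hn hi); rewrite !aff_actM.
have -> : aff_act n i (fin_aff u0) = i by apply/(stabE hn hi); exists u0.
by apply: dy => /=; have := ltn_ord k; lia.
Qed.

Lemma long_min y : strictly_decreasing (aff_act n i y) -> min_right (long y).
Proof.
move=> dy z; rewrite len_mul_inc ?leq_addr // => j k kj; exact: hat_long.
Qed.

Lemma beta_pos_left (j k : 'I_l) : k = j.+1 :> nat -> i j = i k ->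
  Hn (fin_aff (tperm j k)) * beta_pos = v (-1) *: beta_pos.
Proof.
move=> kj ij; have st := simple_fin kj.
have sjk : place_perm i (tperm j k) = i by rewrite place_perm_tperm.
rewrite /beta_pos -scalerAr mulrA (Cp_left hH P1 P0 Pdeg hb bCp st); last first.
  have := len_long su0 hx xdec; have := len_stab_sub iinc sjk du0.
  have sju : place_perm i (tperm j k * u0)%g = i by rewrite place_permM sjk su0.
  have := len_long sju hx xdec; rewrite fin_affM -/(long x) /long !mulgA.
  rewrite (len_simple1 st) => e1 e2 e3.
  by rewrite -(ltn_add2r N) e1 e3 ltn_add2r -e2 addn1.
by rewrite -scalerAl scalerC.
Qed.

Lemma beta_pos_right (j k : 'I_l) : k = j.+1 :> nat ->
  beta_pos * Hn (fin_aff (tperm j k)) = - v 1 *: beta_pos.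
Proof.
by move=> kj; rewrite /beta_pos -scalerAl -mulrA (antisym_right hH kj) -scalerAr scalerC.
Qed.

Lemma ch_beta_pos y : block_min i y -> strictly_decreasing (aff_act n i y) ->
  ch y beta_pos = \sum_(u : 'S_l) (- v 1) ^+ len (fin_aff u) *
    ch (long y * (fin_aff u)^-1)%g (Cp (long x)).
Proof.
move=> hy dy.
have dy' : strictly_decreasing (aff_act n i (fin_aff u0 * y)%g).
  rewrite aff_actM; have -> : aff_act n i (fin_aff u0) = i by apply/(stabE hn hi); exists u0.
  exact: dy.
have -> : ch y beta_pos = v L0%:Z * ch (fin_aff u0 * y)%g beta_pos.
  have := ch_stab_mul hH iinc hy (place_permV su0) beta_pos.
  rewrite -fin_affV invgK (eigen_left hH iinc beta_pos_left (place_permV su0)).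
  by move=> <-; rewrite chZ fin_affV len_inv vpowX mulN1r mulrA vpowVr mul1r.
rewrite {1}/beta_pos chZ (ch_antisym hn hH); last by move=> j k kj; apply: hat_dec.
rewrite antisym_powN -/(long y).
set S := \sum_(u : 'S_l) _.
have -> : v (- N%:Z - L0%:Z) = v (- N%:Z) * v (- L0%:Z) by rewrite vpowD.
apply: beta_pos_aux; [exact: vpowVr|exact: vpowVl|by rewrite -expr2 sqrr_sign].
Qed.

Lemma coeff_pos : (forall p, D p <-> vpos p) -> forall y, block_min i y ->
  strictly_decreasing (aff_act n i y) ->
  c@_(aff_act n i y - rho l) = parabolic_kl C P (long y) (long x).
Proof.
move=> hDp y hy dy; transitivity (ch y beta_pos); last first.
  rewrite ch_beta_pos // /parabolic_kl mulr_sumr [RHS](reindex_inj invg_inj) /=.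
  apply: eq_bigr => u _; rewrite (ch_Cp hH P0) -fin_affV.
  rewrite len_mul_inc => [|j k kj]; last exact: hat_long.
  rewrite !fin_affV len_inv antisym_powN; apply: kl_term_aux.
  by rewrite -vpowD; congr v; lia.
refine (coeff_unique hn (hH:=hH) hb hM hT hL hpsi hi su0 du0 hD (beta:=beta_pos) hc fix_c _ _ _ _ hy dy).
- exact: beta_pos_left.
- exact: beta_pos_right.
- rewrite /beta_pos (bZ hb) (bM hH hb) bCp (b_antisym hn hH hb) -scalerAr.
  rewrite lbarM lbar_sign lbar_vpow !scalerA -mulrA -vpowD mulrCA -vpowD.
  by congr (_ * v _ *: _); lia.
move=> {hy dy}y hy dy.
set mu := aff_act n i y - rho l.
have -> : c@_mu - ch y beta_pos = (c@_mu - (lam == mu)%:R) - (ch y beta_pos - (lam == mu)%:R).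
  by rewrite opprB addrA subrK.
apply: (hsD hD) => //; apply: (hsN hD); rewrite same_orbit // ch_beta_pos //.
rewrite (bigD1 1%g) //= fin_aff1 len1 expr0 mul1r invg1 mulg1 addrAC.
have chD w : D (ch w (Cp (long x)) - (w == long x)%:R).
  case: eqP => [->|wx]; first by rewrite (ch_Cp_self hH P1 P0) subrr; apply: (hs0 hD).
  by rewrite subr0; apply/hDp; exact: (ch_Cp_vpos (hH:=hH) P0 Pdeg).
have -> : (y == x) = (long y == long x).
  by rewrite /long (inj_eq (mulIg _)) (inj_eq (mulgI _)).
apply: (hsD hD) => //; apply: (half_sum hD) => u /eqP /len_fin_gt0 lu.
rewrite antisym_powN -mulrA; apply: (half_sign hD).
move: (chD (long y * (fin_aff u)^-1)%g); case: eqP => [->|_]; last first.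
  by rewrite subr0 => /hDp h; apply/hDp/vpos_vpowM.
by move=> _; rewrite (ch_Cp_self hH P1 P0) mulr1; apply/hDp/vpos_vpow; lia.
Qed.

End SameOrbit.
End Canonical.

Lemma mulr_swap3 (R : comPzRingType) (p q r : R) : p * q * r = q * (p * r).
Proof. by rewrite -mulrA mulrCA. Qed.

Lemma canonical_expand (C : comNzRingType) (l : nat) (M L : lmodType (laurent C))
    (ot : Zl l -> M) (pi : {linear M -> L}) (D : laurent C -> Prop) (lam : Zl l) (z : L) :
  half_space D -> is_part lam -> in_lower ot pi D lam (z - ket ot pi lam) ->
  exists c : {malg (laurent C)[Zl l]},
    [/\ forall mu, mu \in msupp c -> is_part mu, z = lcomb (ket ot pi) c
      & forall mu, D (c@_mu - (lam == mu)%:R)].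
Proof.
move=> hD hlam [c0 [hc0 E]]; exists (<< 1 *g lam >> + c0); split=> [mu||mu].
- move/(fsubsetP (msuppD_le _ _)); rewrite inE => /orP[|/hc0[] //].
  by move/(fsubsetP msuppU_le); rewrite inE => /eqP ->.
- by rewrite lcombD lcombU scale1r -E addrC subrK.
rewrite mcoeffD mcoeffU addrAC subrr add0r.
case: (boolP (mu \in msupp c0)) => [/hc0[] //|/mcoeff_outdom ->]; exact: hs0.
Qed.

Lemma stab_part_mul (l n : nat) (hn : (0 < n)%N) (i : Zl l) (hi : in_alcove n i) y u :
  place_perm i u = i -> block_min i y -> stab_part n i (fin_aff u * y)%g = fin_aff u.
Proof.
move=> su hy; apply: xget_unique => /= [|w [/(stabE hn hi)[z sz ->] mz]].
  split; first by apply/(stabE hn hi); exists u.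
  move=> w /(stabE hn hi)[z sz ->]; rewrite mulKg (len_stab_mul hi.1 sz hy) leq_addl //.
have szu : place_perm i (z^-1 * u)%g = i by rewrite place_permM place_permV.
have : stab n i (fin_aff (z^-1 * u)^-1%g) by apply/(stabE hn hi); exists (z^-1 * u)^-1%g; rewrite ?place_permV.
move=> /mz; rewrite -fin_affV mulgA -fin_affM mulgA -fin_affM mulVg fin_aff1 mul1g.
rewrite (len_stab_mul hi.1 szu hy) => le.
have /eqP : (z^-1 * u)%g = 1%g.
  by apply: contrapT => /len_fin_gt0; lia.
by rewrite -eq_mulVg1 => /eqP ->.
Qed.

Lemma ch_CmE (C : comNzRingType) (l : nat) (H : algType (laurent C)) (TH : affS l -> H)
    (hH : is_iwahori_hecke TH) (P : affS l -> affS l -> {poly int}) y x :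
  (forall y x, ~ bruhat y x -> P y x = 0) ->
  ch hH y (Cm hH P x) =
    nvpow C ((len y)%:Z - (len x)%:Z) * lbar (at_q C (P y x)).
Proof.
move=> P0; rewrite ch_Cm (ch_Cp hH P0) lbarM lbar_vpow opprB /nvpow !mulrA.
have -> : (-1) ^+ len x * (-1) ^+ len y = (-1) ^+ `|((len y)%:Z - (len x)%:Z)%R|%N :> laurent C.
  rewrite -exprD -signr_odd -[RHS]signr_odd; congr ((-1) ^+ nat_of_bool _); lia.
by [].
Qed.

Lemma parabolic_kl_eq0 (C : comNzRingType) (l : nat) (hl : (0 < l)%N)
    (P : affS l -> affS l -> {poly int}) :
  (forall y x, ~ bruhat y x -> P y x = 0) ->
  exists y x, [/\ min_right y, min_right x & parabolic_kl C P y x = 0].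
Proof.
move=> P0; pose m : Zl l := [ffun=> 1]; exists (tr m), 1%g.
split=> [z|z|].
- rewrite len_mul_inc ?leq_addr // => j k kj; apply: hat_tr_lt => //.
  by rewrite !ffunE.
- by rewrite len1.
rewrite /parabolic_kl big1 ?mulr0 // => z _; rewrite P0 ?at_q0 ?mulr0 //.
rewrite tr_fin => /bruhat_len[[_ /ffunP /(_ (Ordinal hl))]|]; last by rewrite len1.
by rewrite !ffunE.
Qed.

Unset Implicit Arguments.

Theorem theorem9p5 (R : realType) (n l : nat) (hn : (0 < n)%N) (hl : (0 < l)%N)
  (* the Hecke algebra of the extended affine symmetric group and its
     Kazhdan-Lusztig polynomials *)
  (H : algType (laurent R[i])) (TH : affS l -> H) (hH : is_iwahori_hecke TH)
  (P : affS l -> affS l -> {poly int}) (hP : is_kl TH P)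
  (* the tensor module, the affine Hecke algebra action, the wedge quotient *)
  (M : lmodType (laurent R[i])) (ot : Zl l -> M) (hM : is_free_basis ot)
  (T X XV : 'I_l -> {linear M -> M}) (hT : is_hecke_action ot T X XV n)
  (L : lmodType (laurent R[i])) (pi : {linear M -> L})
  (hL : is_wedge_quotient T pi)
  (psi : L -> L) (hpsi : is_wedge_bar ot pi n psi)
  (bm bp : Zl l -> L)
  (hbm : is_canonical_basis ot pi psi (@vneg R[i]) bm)
  (hbp : is_canonical_basis ot pi psi (@vpos R[i]) bp) :
  (* (a) *)
  (forall (lam : Zl l) (x : affS l), is_part lam ->
     let i := dot n lam (x^-1)%g + rho l in
     in_alcove n i ->
     (forall x', in_alcove n (dot n lam (x'^-1)%g + rho l) ->
        (len x <= len x')%N) ->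
     bm lam =
       \sum_(y \in [set y | bruhat y x /\ is_part (dot n lam (x^-1 * y)%g)]%classic)
         (nvpow R[i] ((len y)%:Z - (len x)%:Z)
          * vpow R[i] (- (len (stab_part n i y))%:Z)
          * lbar (at_q R[i] (P y x)))
         *: ket ot pi (dot n lam (x^-1 * y)%g))
  /\
  (* (b) *)
  (forall (lam : Zl l) (c : {malg (laurent R[i])[Zl l]}), is_part lam ->
     (forall mu, mu \in msupp c -> is_part mu) ->
     bp lam = lcomb (ket ot pi) c ->
     forall mu, is_part mu ->
       exists y x : affS l,
         [/\ min_right y, min_right x & c@_mu = parabolic_kl R[i] P y x]).
Proof.
have [P1 P0 Pdeg [b [hb bCp]]] := hP.
split=> [lam x hlam i hi xmin|lam c hlam hc Ec mu hmu].
  have [fix_lam /(canonical_expand (half_vneg _) hlam)[c [hc Ec hcD]]] := hbm _ hlam.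
  rewrite Ec in fix_lam; rewrite Ec.
  have iE : i = aff_act n (lam + rho l) x^-1%g by rewrite /i /dot subrK.
  have ix : aff_act n i x = lam + rho l.
    by rewrite iE -aff_actM mulVg /aff_act /= mul0rn addr0 place_perm1.
  have dotE y : dot n lam (x^-1 * y)%g = aff_act n i y - rho l.
    by rewrite /dot iE aff_actM.
  have hx : block_min i x.
    move=> j k kj ij; have st := simple_fin kj; apply/(len_fin_asc _ kj).
    have -> : len (x^-1 * fin_aff (tperm j k))%g = len (fin_aff (tperm j k) * x)%g.
      by rewrite -len_inv invMg invgK (simpleV st).
    rewrite len_inv; case: (len_simpleL x st) => // E.
    have : in_alcove n (dot n lam ((fin_aff (tperm j k) * x)^-1)%g + rho l).
      rewrite invMg (simpleV st) dotE subrK.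
      have -> // : aff_act n i (fin_aff (tperm j k)) = i.
      by apply/(stabE hn hi); exists (tperm j k); rewrite // place_perm_tperm.
    by move=> /xmin; rewrite E ltnn.
  pose cf y : laurent R[i] := nvpow R[i] ((len y)%:Z - (len x)%:Z)
    * vpow R[i] (- (len (stab_part n i y))%:Z) * lbar (at_q R[i] (P y x)).
  set Sx := [set y | _]%classic.
  have finS : finite_set Sx by apply: sub_finite_set (bruhat_finite x) => y [].
  rewrite fsbig_finite //=; set S := fset_set Sx.
  have memS y : reflect (bruhat y x /\ is_part (aff_act n i y - rho l)) (y \in S).
    by rewrite in_fset_set //; apply: (iffP idP); rewrite inE /Sx /= dotE.
  pose c2 : {malg (laurent R[i])[Zl l]} := \sum_(y <- S) << cf y *g aff_act n i y - rho l >>.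
  suff -> : c = c2.
    by rewrite /c2 lcomb_sum; apply: eq_bigr => y _; rewrite lcombU dotE.
  apply/malgP => mu.
  have c2E : c2@_mu = \sum_(y <- S | aff_act n i y - rho l == mu) cf y.
    rewrite /c2 raddf_sum [RHS]big_mkcond /=; apply: eq_bigr => y _.
    by rewrite mcoeffU; case: eqP.
  have [pm|npm] := pselect (is_part mu); last first.
    rewrite mcoeff_outdom; last by apply/negP => /hc.
    rewrite c2E big_seq_cond big1 // => y /andP[/memS[_ py] /eqP E].
    by case: npm; rewrite -E.
  have [[w Ew]|no] := pselect (exists w, aff_act n i w = mu + rho l); last first.
    rewrite (coeff_no_orbit hn hH hb hM hT hL hpsi (half_vneg _) hc fix_lam hcD ix pm).
      rewrite c2E big_seq_cond big1 // => y /andP[_ /eqP E].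
      by case: no; exists y; rewrite -E subrK.
    by move=> w Ew; apply: no; exists w.
  have [u [su hy]] := ex_block_min i w; set y := (fin_aff u * w)%g in hy.
  have Ey : aff_act n i y = mu + rho l.
    by rewrite aff_actM; have -> : aff_act n i (fin_aff u) = i by apply/(stabE hn hi); exists u.
  have dy : strictly_decreasing (aff_act n i y) by rewrite Ey; apply: part_rho.
  have -> : mu = aff_act n i y - rho l by rewrite Ey addrK.
  rewrite (coeff_neg hn hH hb P1 P0 Pdeg bCp hM hT hL hpsi (half_vneg _) hlam hc
    fix_lam hcD hi hx ix _ hy dy) // Ey addrK c2E.
  pose s := [seq (fin_aff z * y)%g | z <- enum [pred z | place_perm i z == i]].
  have cfE z : place_perm i z == i -> cf (fin_aff z * y)%g =
      vpow R[i] (- (len (fin_aff z))%:Z) * ch hH (fin_aff z * y)%g (Cm hH P x).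
    move=> /eqP sz; rewrite (ch_CmE hH _ _ P0) /cf (stab_part_mul hn hi sz hy).
    exact: mulr_swap3.
  transitivity (\sum_(w <- s) cf w).
    rewrite big_map big_enum /=; apply: eq_bigr => z sz; symmetry; exact: cfE.
  have sP w' : reflect (aff_act n i w' = mu + rho l) (w' \in s).
    apply: (iffP mapP) => [[z]|E].
      rewrite mem_enum inE => /eqP sz ->; rewrite aff_actM -Ey; congr aff_act.
      by apply/(stabE hn hi); exists z.
    have /(stabE hn hi)[z sz Ez] : stab n i (w' * y^-1)%g.
      by rewrite /stab aff_actM E -Ey -aff_actM mulgV /aff_act /= mul0rn addr0 place_perm1.
    by exists z; rewrite ?mem_enum ?inE ?sz // -Ez mulgKV.
  transitivity (\sum_(w' <- s | w' \in S) cf w').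
    rewrite [RHS]big_mkcond big_seq [RHS]big_seq; apply: eq_bigr => w' /sP E.
    case: (boolP (w' \in S)) => // /memS nS; rewrite /cf P0 ?at_q0 ?lbar0 ?mulr0 //.
    by move=> le; apply: nS; rewrite E addrK.
  rewrite -big_filter -[RHS]big_filter; apply: perm_big; apply: uniq_perm.
  - apply: filter_uniq; rewrite map_inj_uniq ?enum_uniq // => z1 z2 /mulIg.
    by case.
  - exact/filter_uniq/fset_uniq.
  move=> w'; rewrite !mem_filter andbC; congr (_ && _).
  by apply/sP/eqP => [->|<-]; rewrite ?addrK ?subrK.
have [fix_lam /(canonical_expand (half_vpos _) hlam)[c' [hc' Ec' hcD]]] := hbp _ hlam.
have {hc' Ec'}Ec' : c' = c.
  by apply: (ket_inj hn hH hb hM hT hL hc' hc); rewrite -Ec' -Ec.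
rewrite {c'}Ec' in hcD; rewrite Ec in fix_lam.
have [i [x [hi hx ix]]] := ex_orbit hn (lam + rho l).
have [[w Ew]|no] := pselect (exists w, aff_act n i w = mu + rho l); last first.
  have [y [x' [hy hx' E]]] := parabolic_kl_eq0 R[i] hl P0; exists y, x'; split=> //.
  rewrite E; apply: (coeff_no_orbit hn hH hb hM hT hL hpsi (half_vpos _) hc fix_lam hcD ix hmu).
  by move=> w Ew; apply: no; exists w.
have [u [su hy]] := ex_block_min i w; set y := (fin_aff u * w)%g in hy.
have Ey : aff_act n i y = mu + rho l.
  by rewrite aff_actM; have -> : aff_act n i (fin_aff u) = i by apply/(stabE hn hi); exists u.
have dy : strictly_decreasing (aff_act n i y) by rewrite Ey; apply: part_rho.
have dx : strictly_decreasing (aff_act n i x) by rewrite ix; apply: part_rho.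
have [u0 su0 du0] := ex_u0 hi.1.
exists (long u0 y), (long u0 x); split; try exact: (long_min hn hi).
have -> : mu = aff_act n i y - rho l by rewrite Ey addrK.
exact: (coeff_pos hn hH hb P1 P0 Pdeg bCp hM hT hL hpsi (half_vpos _) hlam hc
  fix_lam hcD hi hx ix su0 du0).
Qed.
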